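(* Let $\gamma\in(0,\infty)$ and assume $p=p_n\to\infty$ and $p/n\to\gamma$ as $n\to\infty$. Then the following two statements are equivalent: (i) The empirical spectral distributions $F^{\mathbf{R}}$ of the sample correlation matrices $\mathbf{R}=\mathbf{R}_n$ converge weakly almost surely to the Marchenko--Pastur law with parameter $\gamma$. (ii) For all $z\in\mathbb{C}^+$ one has $$W_n(z):=\tilde{\mathbf{y}}_1\mathbf{B}(z)\tilde{\mathbf{y}}_1^\top-\frac1n\operatorname{tr}\big(\mathbf{B}(z)\big)\longrightarrow 0\quad\text{in probability, as } n\to\infty .$$
   Context: $\xi$ is a real, centered, non-degenerate random variable with $\mathbb{E}[|\xi|^{1+\delta}]<\infty$ for some $\delta>0$, and $\mathbb{E}[\xi^2]=1$ whenever $\mathbb{E}[\xi^2]<\infty$. For each $n$, $\mathbf{X}=\mathbf{X}_n=(X_{ij})_{1\le i\le p,\,1\le j\le n}$ is a $p\times n$ matrix with i.i.d. entries distributed as $\xi$ (all random variables live on one probability space). $\mathbf{Y}=\mathbf{Y}_n=(Y_{ij})$ is the $p\times n$ matrix with $Y_{ij}=X_{ij}/\sqrt{X_{i1}^2+\dots+X_{in}^2}$; the normalizing sums are implicitly taken to be nonzero almost surely, so the rows of $\mathbf{Y}$ have Euclidean norm one. The sample correlation matrix is $\mathbf{R}=\mathbf{R}_n=\mathbf{Y}\mathbf{Y}^\top$. $\tilde{\mathbf{y}}_1=(Y_{11},\dots,Y_{1n})$ is the first row of $\mathbf{Y}$, and $\mathbf{B}(z)=(\mathbf{Y}^\top\mathbf{Y}-\tilde{\mathbf{y}}_1^\top\tilde{\mathbf{y}}_1-z\mathbf{I}_n)^{-1}$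 for $z\in\mathbb{C}^+=\{z\in\mathbb{C}:\operatorname{Im}z>0\}$. For a $p\times p$ matrix $\mathbf{C}$ with real eigenvalues $\lambda_1(\mathbf{C})\ge\dots\ge\lambda_p(\mathbf{C})$, $F^{\mathbf{C}}(x)=\frac1p\sum_{i=1}^p\mathbf{1}\{\lambda_i(\mathbf{C})\le x\}$. ''Weakly almost surely'' means that, with probability one, the distributions converge weakly. The Marchenko--Pastur law with parameter $\gamma$ has density $\frac{\sqrt{(b_\gamma-x)(x-a_\gamma)}}{2\pi\gamma x}$ on $[a_\gamma,b_\gamma]$ with $a_\gamma=(1-\sqrt\gamma)^2$, $b_\gamma=(1+\sqrt\gamma)^2$, and, if $\gamma>1$, an additional point mass $1-1/\gamma$ at $0$. *)

(* Defs.v *)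
From HB Require Import structures.
From mathcomp Require Import all_boot all_order all_algebra.
From mathcomp Require Import all_classical all_reals all_analysis.
From mathcomp Require Import complex polyrcf.

Set Implicit Arguments.
Unset Strict Implicit.
Unset Printing Implicit Defensive.

Import Order.TTheory GRing.Theory Num.Theory.
Import numFieldNormedType.Exports.

Local Open Scope classical_set_scope.
Local Open Scope ring_scope.
Local Open Scope complex_scope.

Section probability_notions.
Context d (T : measurableType d) (R : realType) (P : probability T R).

Definition mutually_independent (I : finType) (X : I -> {RV P >-> R}) : Prop :=
  forall (J : {set I}) (A : I -> set R), (forall i, measurable (A i)) ->
    (P (\bigcap_(i in [set` J]) (X i @^-1` A i))
       = \prod_(i in J) P (X i @^-1` A i))%E.

Definition identically_distributed (X Y : {RV P >-> R}) : Prop :=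
  forall A : set R, measurable A -> distribution P X A = distribution P Y A.

Definition iid_entries (p n : nat) (xi : {RV P >-> R})
    (X : 'I_p -> 'I_n -> {RV P >-> R}) : Prop :=
  mutually_independent (fun ij : 'I_p * 'I_n => X ij.1 ij.2) /\
  forall i j, identically_distributed (X i j) xi.

Definition non_degenerate (X : {RV P >-> R}) : Prop :=
  forall c : R, P (X @^-1` [set c]) != 1%E.

Definition cvg_in_probability (V : nat -> T -> R[i]) (v : R[i]) : Prop :=
  forall eps : R, 0 < eps ->
    P [set w | eps%:C < `|V n w - v|] @[n --> \oo] --> 0%E.

End probability_notions.

Section spectral_distributions.
Variable R : realType.

(* The real eigenvalues of C, repeated according to algebraic multiplicity;
   there are p of them when all the eigenvalues of C are real. *)
Definition eigenvalues (p : nat) (C : 'M[R]_p) : seq R :=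
  flatten [seq nseq (mup x (char_poly C)) x | x <- rootsR (char_poly C)].

Definition ESD (p : nat) (C : 'M[R]_p) (x : R) : R :=
  p%:R^-1 * \sum_(l <- eigenvalues C) (l <= x)%R%:R.

Definition MP_left (gamma : R) : R := (1 - Num.sqrt gamma) ^+ 2.
Definition MP_right (gamma : R) : R := (1 + Num.sqrt gamma) ^+ 2.

Definition MP_density (gamma x : R) : R :=
  if MP_left gamma <= x <= MP_right gamma then
    Num.sqrt ((MP_right gamma - x) * (x - MP_left gamma))
      / (2 * pi * gamma * x)
  else 0.

Definition MP_atom (gamma : R) : R := if 1 < gamma then 1 - gamma^-1 else 0.

Definition MP_law (gamma : R) (A : set R) : \bar R :=
  (\int[lebesgue_measure]_(x in A) (MP_density gamma x)%:E
     + (MP_atom gamma)%:E * \d_(0%R : R) A)%E.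

Definition MP_cdf (gamma x : R) : R := fine (MP_law gamma `]-oo, x]).

(* Weak convergence of distribution functions. *)
Definition weak_cvg (F : nat -> R -> R) (G : R -> R) : Prop :=
  forall x : R, {for x, continuous G} -> F n x @[n --> \oo] --> G x.

End spectral_distributions.

Section correlation_matrix.
Variable R : realType.

(* If a row of X vanishes, the corresponding row of Y is 0. *)
Definition normalize_rows (p n : nat) (X : 'M[R]_(p, n)) : 'M[R]_(p, n) :=
  \matrix_(i, j) (X i j / Num.sqrt (\sum_(k < n) X i k ^+ 2)).

Definition sample_corr (p n : nat) (Y : 'M[R]_(p, n)) : 'M[R]_p := Y *m Y^T.

Definition first_row (p n : nat) (hp : (0 < p)%N) (Y : 'M[R]_(p, n)) : 'rV[R]_n :=
  row (Ordinal hp) Y.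

Definition to_complex (m n : nat) (A : 'M[R]_(m, n)) : 'M[R[i]]_(m, n) :=
  map_mx (real_complex R) A.

Definition resolventB (p n : nat) (hp : (0 < p)%N) (Y : 'M[R]_(p, n))
    (z : R[i]) : 'M[R[i]]_n :=
  let y1 := first_row hp Y in
  invmx (to_complex (Y^T *m Y - y1^T *m y1) - z%:M).

Definition W (p n : nat) (hp : (0 < p)%N) (Y : 'M[R]_(p, n)) (z : R[i]) : R[i] :=
  let y1 := to_complex (first_row hp Y) in
  let B := resolventB hp Y z in
  (y1 *m B *m y1^T) 0 0 - n%:R^-1 * \tr B.

End correlation_matrix.

Section random_matrices.
Context d (T : measurableType d) (R : realType) (P : probability T R).

Definition data_matrix (p n : nat) (X : 'I_p -> 'I_n -> {RV P >-> R}) (w : T)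
    : 'M[R]_(p, n) :=
  \matrix_(i, j) X i j w.

Definition Ymx (p n : nat) (X : 'I_p -> 'I_n -> {RV P >-> R}) (w : T)
    : 'M[R]_(p, n) :=
  normalize_rows (data_matrix X w).

End random_matrices.

(* Main.v *)
From HB Require Import structures.
Require Import Defs.
From mathcomp Require Import all_boot all_order all_algebra.
From mathcomp Require Import all_classical all_reals all_analysis.
From mathcomp Require Import complex polyrcf measurable_realfun.
From mathcomp Require Import spectral sesquilinear perm.
From mathcomp Require Import ring lra.

Set Implicit Arguments.
Unset Strict Implicit.
Unset Printing Implicit Defensive.

Import Order.TTheory GRing.Theory Num.Theory.
Import numFieldNormedType.Exports.

Local Open Scope classical_set_scope.
Local Open Scope ring_scope.

(** Everything is done with the real resolvents [(Y^T Y + t)^-1], [t > 0].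
    Let [s] be the normalized trace [n^-1 tr (Y^T Y + t)^-1] ([mean_trace]),
    let [q_i] be the quadratic form of the resolvent of [Y] without its row [i],
    evaluated at this row ([loo_quad]), and let [real_W = q_1 - s'] be the
    statistic of (ii) at the point [- t], with [s'] the normalized trace of the
    resolvent without the first row; [s] and [s'] differ by at most [1 / (n t)].

    Two reductions remove the complex points. The Cauchy kernel at any [z] of the
    upper half-plane is a uniform limit on the half-line of combinations of
    kernels [1 / (x + t)] with rational [t] ([cauchy_kernel_span], through
    Bernstein polynomials in [1 / (x + 1)]); conversely [- t] is close to
    [- t + i e]. As [W] integrates these kernels against signed measures on the
    half-line of total variation at most 2, (ii) holds if and only if
    [E |real_W|] tends to 0 for all rational [t] ([complex_W_cvg0],
    [expect_norm_real_W_cvg0]). By the same approximation, (i) holds if and only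
    if almost surely [s] tends to [MP_companion gamma t] for all rational [t]
    ([weak_cvg_mean_traceP]); the explicit value of the limit comes from an
    integral over a semicircle ([MP_mean_resolvent]).

    The link is the exact formula [t s = 1 - p/n + n^-1 sum_i 1 / (1 + q_i)]
    ([trace_resolvent_self_consistent]). The rows being exchangeable, its mean is
    [t E s = 1 - p/n + (p/n) E (1 / (1 + q_1))] ([expect_self_consistent]).

    From (ii) to (i): if [E |real_W|] tends to 0, then [q_1] may be replaced by [s],
    and [s] by [E s] because [s] changes by at most [1 / (n t)] with each row and
    so concentrates exponentially fast ([bounded_difference_tail]). Hence [E s]
    is an approximate root of [t x = 1 - gamma + gamma / (1 + x)], an equation
    with a single nonnegative root ([cvg_expect_mean_trace]); the
    concentration is summable, so the convergence is almost sure
    ([ae_cvg_mean_trace]).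

    From (i) to (ii): if [s] converges to [sg], the mean formula gives the limit
    [1 / (1 + sg)] of [E (1 / (1 + q_1))]. Moreover [E real_W] tends to 0 under
    the moment assumption alone: by exchangeability it is at most
    [2 / t (E V + 1 / n)], where [n V] is the square of the sum of the entries of
    a row of [Y] ([expect_real_W_le]), and [E V] tends to 0 by a self-normalized
    law of large numbers ([expect_row_sum_cvg0]). So [E q_1] tends to [sg] and
    [E (1 / (1 + q_1))] to [1 / (1 + sg)]; by strict convexity [q_1] tends to
    [sg] in mean ([expect_norm_real_W_of_trace]). *)

(** * Resolvents of real Gram matrices *)

Section GramResolvent.
Variable R : realFieldType.

Definition sqnorm n (u : 'rV[R]_n) : R := \sum_j u 0 j ^+ 2.

(** Rows are vectors throughout, so that the quadratic form is [u Q u^T]. *)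
Definition quad n (Q : 'M[R]_n) (u : 'rV[R]_n) : R := (u *m Q *m u^T) 0 0.

(** The resolvent of [Y^T Y] at the point [- t]. *)
Definition gram_resolvent p n (Y : 'M[R]_(p, n)) (t : R) : 'M[R]_n :=
  invmx (Y^T *m Y + t%:M).

Definition zero_row p n (i : 'I_p) (Y : 'M[R]_(p, n)) : 'M[R]_(p, n) :=
  \matrix_(k, j) (if k == i then 0 else Y k j).

(** Leave-one-out form: the resolvent does not see the row it is applied to. *)
Definition loo_quad p n (Y : 'M[R]_(p, n)) (t : R) (i : 'I_p) : R :=
  quad (gram_resolvent (zero_row i Y) t) (row i Y).

Lemma sqnormE n (u : 'rV[R]_n) : (u *m u^T) 0 0 = sqnorm u.
Proof. by rewrite mxE; apply: eq_bigr => j _; rewrite !mxE expr2. Qed.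

Lemma sqnorm_ge0 n (u : 'rV[R]_n) : 0 <= sqnorm u.
Proof. by apply: sumr_ge0 => j _; exact: sqr_ge0. Qed.

Lemma sqnorm_eq0 n (u : 'rV[R]_n) : sqnorm u = 0 -> u = 0.
Proof.
move=> /psumr_eq0P u0; apply/rowP => j; rewrite mxE; apply/eqP.
by rewrite -sqrf_eq0 u0// => k _; exact: sqr_ge0.
Qed.

Lemma quad_gram p n (Y : 'M[R]_(p, n)) (t : R) (u : 'rV[R]_n) :
  quad (Y^T *m Y + t%:M) u = sqnorm (u *m Y^T) + t * sqnorm u.
Proof.
rewrite /quad mulmxDr mulmxDl mul_mx_scalar -scalemxAl mxE [X in _ + X]mxE.
by rewrite -!sqnormE trmx_mul trmxK !mulmxA.
Qed.

Lemma gram_unit p n (Y : 'M[R]_(p, n)) (t : R) :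
  0 < t -> Y^T *m Y + t%:M \in unitmx.
Proof.
move=> t0; rewrite -row_free_unit; apply: inj_row_free => v vM.
apply: sqnorm_eq0; apply/eqP; rewrite eq_le sqnorm_ge0 andbT.
have: quad (Y^T *m Y + t%:M) v = 0 by rewrite /quad vM mul0mx mxE.
rewrite quad_gram => e.
by rewrite -(pmulr_rle0 _ t0) -e lerDr sqnorm_ge0.
Qed.

Lemma gram_mul_resolvent p n (Y : 'M[R]_(p, n)) (t : R) :
  0 < t -> (Y^T *m Y + t%:M) *m gram_resolvent Y t = 1%:M.
Proof. by move=> t0; rewrite mulmxV ?gram_unit. Qed.

Lemma resolvent_mul_gram p n (Y : 'M[R]_(p, n)) (t : R) :
  0 < t -> gram_resolvent Y t *m (Y^T *m Y + t%:M) = 1%:M.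
Proof. by move=> t0; rewrite mulVmx ?gram_unit. Qed.

Lemma gram_resolvent_sym p n (Y : 'M[R]_(p, n)) (t : R) :
  (gram_resolvent Y t)^T = gram_resolvent Y t.
Proof.
by rewrite /gram_resolvent trmx_inv linearD /= trmx_mul trmxK tr_scalar_mx.
Qed.

(** With [v = u Q] one has [u Q u^T = v (Y^T Y + t) v^T], and [Y^T Y] is
    positive semidefinite. *)
Lemma quad_resolvent_ge p n (Y : 'M[R]_(p, n)) (t : R) (u : 'rV[R]_n) :
  0 < t -> t * sqnorm (u *m gram_resolvent Y t) <= quad (gram_resolvent Y t) u.
Proof.
move=> t0; set Q := gram_resolvent Y t.
have -> : quad Q u = quad (Y^T *m Y + t%:M) (u *m Q).
  rewrite /quad trmx_mul gram_resolvent_sym -/Q -!mulmxA.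
  by rewrite [in RHS](mulmxA _ Q u^T) gram_mul_resolvent// mul1mx.
by rewrite quad_gram lerDr sqnorm_ge0.
Qed.

Lemma quad_resolvent_ge0 p n (Y : 'M[R]_(p, n)) (t : R) (u : 'rV[R]_n) :
  0 < t -> 0 <= quad (gram_resolvent Y t) u.
Proof.
move=> t0; apply: le_trans (quad_resolvent_ge _ _ t0).
by rewrite mulr_ge0 ?sqnorm_ge0// ltW.
Qed.

(** Expand [0 <= |u - t u Q|^2] and use the previous bound. *)
Lemma quad_resolvent_le p n (Y : 'M[R]_(p, n)) (t : R) (u : 'rV[R]_n) :
  0 < t -> quad (gram_resolvent Y t) u <= sqnorm u / t.
Proof.
move=> t0; rewrite ler_pdivlMr// mulrC.
have := quad_resolvent_ge Y u t0; set Q := gram_resolvent Y t => h.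
have: 0 <= sqnorm (u - t *: (u *m Q)) by exact: sqnorm_ge0.
have -> : sqnorm (u - t *: (u *m Q))
    = sqnorm u - 2 * (t * quad Q u) + t * (t * sqnorm (u *m Q)).
  rewrite /quad mxE /sqnorm !mulr_sumr -sumrB -big_split /=.
  by apply: eq_bigr => j _; rewrite !mxE; ring.
by move: h; rewrite -(ler_pM2l t0); lra.
Qed.

Lemma sqnorm_delta n (j : 'I_n) : sqnorm (delta_mx 0 j) = 1 :> R.
Proof.
rewrite /sqnorm (bigD1 j)//= big1 ?addr0 => [|k kj]; rewrite !mxE eqxx/=.
  by rewrite eqxx expr1n.
by rewrite (negbTE kj) expr0n.
Qed.

Lemma quad_delta n (Q : 'M[R]_n) j : quad Q (delta_mx 0 j) = Q j j.
Proof. by rewrite /quad -rowE trmx_delta -colE !mxE. Qed.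

Lemma resolvent_diag_ge0 p n (Y : 'M[R]_(p, n)) (t : R) j :
  0 < t -> 0 <= gram_resolvent Y t j j.
Proof. by move=> t0; rewrite -quad_delta quad_resolvent_ge0. Qed.

Lemma trace_resolvent_ge0 p n (Y : 'M[R]_(p, n)) (t : R) :
  0 < t -> 0 <= \tr (gram_resolvent Y t).
Proof. by move=> t0; apply: sumr_ge0 => j _; exact: resolvent_diag_ge0. Qed.

Lemma trace_resolvent_le p n (Y : 'M[R]_(p, n)) (t : R) :
  0 < t -> \tr (gram_resolvent Y t) <= n%:R / t.
Proof.
move=> t0; rewrite -[n in leRHS]card_ord mulr_natl -sumr_const.
apply: ler_sum => j _; rewrite -quad_delta -[leRHS]mul1r -(sqnorm_delta j).
exact: quad_resolvent_le.
Qed.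

Lemma gram_zero_row p n (Y : 'M[R]_(p, n)) i :
  Y^T *m Y = (zero_row i Y)^T *m zero_row i Y + (row i Y)^T *m row i Y.
Proof.
apply/matrixP => a b; rewrite !mxE (bigD1 i)//= [in RHS](bigD1 i)//=.
rewrite big_ord1 !mxE eqxx mul0r add0r addrC; congr (_ + _).
by apply: eq_bigr => k ki; rewrite !mxE (negbTE ki).
Qed.

(** Multiplying [y B (Y^T Y + t)] out with [Y^T Y + t = B^-1 + y^T y]. *)
Lemma sherman_morrison p n (Y : 'M[R]_(p, n)) (t : R) i : 0 < t ->
  row i Y *m gram_resolvent (zero_row i Y) t
    = (1 + loo_quad Y t i) *: (row i Y *m gram_resolvent Y t).
Proof.
move=> t0; set y := row i Y; set B := gram_resolvent _ t.
have e : y *m B *m (Y^T *m Y + t%:M) = (1 + loo_quad Y t i) *: y.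
  rewrite (gram_zero_row Y i) addrAC mulmxDr -/y.
  rewrite -mulmxA resolvent_mul_gram// mulmx1 mulmxA.
  rewrite [y *m B *m y^T]mx11_scalar -/(quad B y) mul_scalar_mx.
  by rewrite scalerDl scale1r.
by rewrite -[LHS]mulmx1 -(gram_mul_resolvent Y t0) mulmxA e -scalemxAl.
Qed.

Lemma loo_quad_ge0 p n (Y : 'M[R]_(p, n)) (t : R) i :
  0 < t -> 0 <= loo_quad Y t i.
Proof. exact: quad_resolvent_ge0. Qed.

Lemma quad_row_resolvent p n (Y : 'M[R]_(p, n)) (t : R) i : 0 < t ->
  quad (gram_resolvent Y t) (row i Y) = 1 - (1 + loo_quad Y t i)^-1.
Proof.
move=> t0; have q0 := loo_quad_ge0 Y i t0.
have q1 : 1 + loo_quad Y t i != 0 by rewrite gt_eqF// ltr_pwDl.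
apply: (mulfI q1); rewrite mulrBr mulr1 mulfV// addrAC subrr add0r.
rewrite [in RHS]/loo_quad /quad sherman_morrison// -scalemxAl.
by rewrite [in RHS]mxE.
Qed.

(** The resolvent identity [B - Q = B (y^T y) Q], where [y Q = y B / (1 + q)]. *)
Lemma trace_loo p n (Y : 'M[R]_(p, n)) (t : R) i : 0 < t ->
  \tr (gram_resolvent (zero_row i Y) t) - \tr (gram_resolvent Y t)
    = sqnorm (row i Y *m gram_resolvent (zero_row i Y) t)
        / (1 + loo_quad Y t i).
Proof.
move=> t0; set B := gram_resolvent (zero_row i Y) t; set Q := gram_resolvent Y t.
have q1 : 1 + loo_quad Y t i != 0.
  by rewrite gt_eqF// ltr_pwDl// loo_quad_ge0.
have -> : sqnorm (row i Y *m B) / (1 + loo_quad Y t i)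
    = ((row i Y *m Q) *m (row i Y *m B)^T) 0 0.
  rewrite -sqnormE -/B {1}sherman_morrison// -scalemxAl mxE -/Q.
  by rewrite mulrC mulrA mulVf// mul1r.
rewrite trmx_mul gram_resolvent_sym -/B -trace_mx11 mxtrace_mulC -raddfB /=.
congr (\tr _).
have -> : B *m (row i Y)^T *m (row i Y *m Q)
    = B *m ((Y^T *m Y + t%:M) - ((zero_row i Y)^T *m zero_row i Y + t%:M)) *m Q.
  rewrite opprD addrACA subrr addr0 (gram_zero_row Y i) addrAC subrr add0r.
  by rewrite !mulmxA.
rewrite mulmxBr mulmxBl resolvent_mul_gram// mul1mx -mulmxA gram_mul_resolvent//.
by rewrite mulmx1.
Qed.

Lemma trace_loo_ge p n (Y : 'M[R]_(p, n)) (t : R) i : 0 < t ->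
  \tr (gram_resolvent Y t) <= \tr (gram_resolvent (zero_row i Y) t).
Proof.
move=> t0; rewrite -subr_ge0 trace_loo// divr_ge0 ?sqnorm_ge0// addr_ge0//.
exact: loo_quad_ge0.
Qed.

(** [t |y B|^2 <= y B y^T = q], so the deletion of a row costs at most
    [q / (t (1 + q))]. *)
Lemma trace_loo_le p n (Y : 'M[R]_(p, n)) (t : R) i : 0 < t ->
  \tr (gram_resolvent (zero_row i Y) t) <= \tr (gram_resolvent Y t) + t^-1.
Proof.
move=> t0; rewrite -lerBlDl trace_loo//; have q0 := loo_quad_ge0 Y i t0.
have := quad_resolvent_ge (zero_row i Y) (row i Y) t0.
rewrite -/(loo_quad Y t i) => h.
rewrite ler_pdivrMr ?ltr_pwDl// -(ler_pM2l t0) mulrA mulfV ?gt_eqF// mul1r.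
by apply: le_trans h _; rewrite lerDr.
Qed.

(** Both matrices give the same one after the row is deleted. *)
Lemma trace_resolvent_bounded_difference p n (Y Y' : 'M[R]_(p, n)) (t : R) i :
  0 < t -> (forall k, k != i -> forall j, Y k j = Y' k j) ->
  `|\tr (gram_resolvent Y t) - \tr (gram_resolvent Y' t)| <= t^-1.
Proof.
move=> t0 YY'; have e : zero_row i Y = zero_row i Y'.
  by apply/matrixP => k j; rewrite !mxE; case: (eqVneq k i) => // /YY'.
have := trace_loo_ge Y i t0; have := trace_loo_le Y i t0.
have := trace_loo_ge Y' i t0; have := trace_loo_le Y' i t0.
by rewrite -e ler_norml; lra.
Qed.

Lemma trace_gram_resolvent p n (Y : 'M[R]_(p, n)) (t : R) : 0 < t ->
  \tr (Y *m gram_resolvent Y t *m Y^T) = n%:R - t * \tr (gram_resolvent Y t).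
Proof.
move=> t0; rewrite mxtrace_mulC mulmxA -mxtrace1 -mxtraceZ -raddfB /=.
congr (\tr _); apply/esym/eqP; rewrite subr_eq -mul_scalar_mx -mulmxDl.
by rewrite gram_mul_resolvent.
Qed.

(** The exact self-consistency relation behind the Marchenko--Pastur
    equation: both sides are the trace of [Y (Y^T Y + t)^-1 Y^T], computed
    row by row on the right. *)
Lemma trace_resolvent_self_consistent p n (Y : 'M[R]_(p, n)) (t : R) : 0 < t ->
  t * \tr (gram_resolvent Y t)
    = n%:R - p%:R + \sum_i (1 + loo_quad Y t i)^-1.
Proof.
move=> t0; suff : n%:R - t * \tr (gram_resolvent Y t)
    = p%:R - \sum_i (1 + loo_quad Y t i)^-1 by move=> h; lra.
have -> : p%:R = \sum_(i < p) 1 :> R by rewrite sumr_const card_ord.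
rewrite -trace_gram_resolvent// -sumrB.
apply: eq_bigr => i _; rewrite -quad_row_resolvent//.
rewrite /quad -row_mul [LHS]mxE [RHS]mxE.
by apply: eq_bigr => j _; rewrite [_^T _ _]mxE [row _ _ _ _]mxE !mxE.
Qed.

(** [Y Y^T] and [Y^T Y] have the same nonzero spectrum. *)
Lemma trace_companion p n (Y : 'M[R]_(p, n)) (t : R) : 0 < t ->
  t * \tr (gram_resolvent Y^T t)
    = p%:R - n%:R + t * \tr (gram_resolvent Y t).
Proof.
move=> t0; suff : p%:R - t * \tr (gram_resolvent Y^T t)
    = n%:R - t * \tr (gram_resolvent Y t) by move=> h; lra.
have e : gram_resolvent Y^T t *m Y = Y *m gram_resolvent Y t.
  have u := gram_unit Y t0; have u' := gram_unit Y^T t0.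
  rewrite trmxK in u'.
  apply: (canRL (mulmxK u)); rewrite -mulmxA mulmxDr mul_mx_scalar.
  rewrite -mul_scalar_mx mulmxA -mulmxDl mulmxA /gram_resolvent trmxK.
  by rewrite mulVmx// mul1mx.
by rewrite -!trace_gram_resolvent// trmxK -mulmxA e [RHS]mxtrace_mulC.
Qed.

End GramResolvent.

(** * Spectral measures and eigenvalues of Gram matrices *)

Section SpectralMeasure.
Local Open Scope complex_scope.
Local Open Scope sesquilinear_scope.
Variable R : realType.
Local Notation C := R[i].

Lemma to_complexM m n q (A : 'M[R]_(m, n)) (B : 'M[R]_(n, q)) :
  to_complex (A *m B) = to_complex A *m to_complex B.
Proof. exact: map_mxM. Qed.

Lemma to_complex_conjT m n (A : 'M[R]_(m, n)) :
  (to_complex A)^t* = to_complex A^T.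
Proof. by apply/matrixP => i j; rewrite !mxE; exact: conjc_real. Qed.

Lemma ge0_complexE (x : C) : 0 <= x -> x = (complex.Re x)%:C /\ 0 <= complex.Re x.
Proof. by case: x => a b; rewrite lecE /= => /andP[/eqP -> ?]. Qed.

Lemma mul_conjT_ge0 n (u : 'rV[C]_n) : 0 <= (u *m u^t*) 0 0.
Proof.
by rewrite mxE; apply: sumr_ge0 => j _; rewrite !mxE -normCK exprn_ge0.
Qed.

Lemma gram_diagonalization p n (Y : 'M[R]_(p, n)) :
  exists (V : 'M[C]_n) (d : 'I_n -> R), [/\ V \is unitarymx,
    forall k, 0 <= d k &
    to_complex (Y^T *m Y) = V^t* *m diag_mx (\row_k (d k)%:C) *m V].
Proof.
set A := to_complex _.
have Anormal : A \is normalmx.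
  by apply/normalmxP; rewrite to_complex_conjT trmx_mul trmxK.
pose V := spectralmx A; pose D := spectral_diag A.
have VU : V \is unitarymx by exact: spectral_unitarymx.
have AE : A = V^t* *m diag_mx D *m V.
  by rewrite -invmx_unitary//; apply/orthomx_spectralP.
have D0 k : 0 <= D 0 k.
  pose M := V *m to_complex Y^T.
  have -> : D 0 k = (row k M *m (row k M)^t*) 0 0.
    have -> : D 0 k = (M *m M^t*) k k.
      rewrite /M trmx_mul map_mxM /= to_complex_conjT trmxK !mulmxA.
      rewrite -(mulmxA V) -to_complexM -/A AE !mulmxA (unitarymxP VU) mul1mx.
      by rewrite -mulmxA (unitarymxP VU) mulmx1 !mxE eqxx mulr1n.
    by rewrite !mxE; apply: eq_bigr => j _; rewrite !mxE.
  exact: mul_conjT_ge0.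
exists V, (fun k => complex.Re (D 0 k)); split => //.
  by move=> k; have [] := ge0_complexE (D0 k).
rewrite AE; congr (_ *m diag_mx _ *m _); apply/rowP => k; rewrite mxE.
by have [] := ge0_complexE (D0 k).
Qed.

Lemma resolvent_unitary_diag n (V : 'M[C]_n) (D : 'rV[C]_n) (z : C) :
  V \is unitarymx -> (forall k, D 0 k - z != 0) ->
  V^t* *m diag_mx D *m V - z%:M \in unitmx /\
  invmx (V^t* *m diag_mx D *m V - z%:M)
    = V^t* *m diag_mx (\row_k (D 0 k - z)^-1) *m V.
Proof.
move=> VU Dz.
have VV : V^t* *m V = 1%:M by rewrite -invmx_unitary// mulVmx// unitarymx_unit.
set E := diag_mx (\row_k _).
have e : (V^t* *m diag_mx D *m V - z%:M) *m (V^t* *m E *m V) = 1%:M.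
  have -> : V^t* *m diag_mx D *m V - z%:M
      = V^t* *m diag_mx (\row_k (D 0 k - z)) *m V.
    have -> : \row_k (D 0 k - z) = D - const_mx z by apply/rowP => k; rewrite !mxE.
    rewrite linearB /= mulmxBr mulmxBl diag_const_mx mul_mx_scalar -scalemxAl VV.
    by rewrite scalemx1.
  rewrite !mulmxA -(mulmxA _ V) (unitarymxP VU) mulmx1 -(mulmxA (V^t*)).
  rewrite mulmx_diag -[RHS]VV; congr (_ *m _); rewrite -[RHS]mulmx1.
  congr (_ *m _); rewrite -diag_const_mx; congr diag_mx.
  by apply/rowP => k; rewrite !mxE mulfV.
have [u _] := mulmx1_unit e.
by split=> //; rewrite -[LHS]mulmx1 -e mulKmx.
Qed.

Lemma mul_conj_ReE (x : C) : x * Num.conj x = (complex.Re (x * Num.conj x))%:C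
  /\ 0 <= complex.Re (x * Num.conj x).
Proof. by apply: ge0_complexE; rewrite -normCK exprn_ge0. Qed.

Lemma quad_diag_mx n (u D : 'rV[C]_n) : (u *m diag_mx D *m u^t*) 0 0
  = \sum_k (complex.Re (u 0 k * Num.conj (u 0 k)))%:C * D 0 k.
Proof.
rewrite mxE; apply: eq_bigr => k _; rewrite mul_mx_diag !mxE.
by rewrite mulrAC; have [<- _] := mul_conj_ReE (u 0 k).
Qed.

(** The spectral measure of [Y^T Y] seen from the vector [y] puts the weight
    [w k] on the eigenvalue [d k]. *)
Lemma gram_spectral_measure p n (Y : 'M[R]_(p, n)) (y : 'rV[R]_n) :
  exists d w : 'I_n -> R, [/\ forall k, 0 <= d k, forall k, 0 <= w k,
    \sum_k w k = sqnorm y &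
    forall z : C, (forall x : R, 0 <= x -> x%:C - z != 0) ->
      to_complex (Y^T *m Y) - z%:M \in unitmx /\
      ((to_complex y *m invmx (to_complex (Y^T *m Y) - z%:M)
        *m (to_complex y)^T) 0 0 = \sum_k (w k)%:C / ((d k)%:C - z)
      /\ \tr (invmx (to_complex (Y^T *m Y) - z%:M))
          = \sum_k ((d k)%:C - z)^-1)].
Proof.
have [V [d [VU d0 AE]]] := gram_diagonalization Y.
pose u := to_complex y *m V^t*.
have uT : u^t* = V *m (to_complex y)^T.
  rewrite /u trmx_mul map_mxM /= to_complex_conjT trmxCK.
  by rewrite /to_complex map_trmx.
exists d, (fun k => complex.Re (u 0 k * Num.conj (u 0 k))); split => //.
- by move=> k; have [] := mul_conj_ReE (u 0 k).
- apply: (@complexI R); rewrite rmorph_sum /=.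
  have := quad_diag_mx u (const_mx 1); rewrite diag_const_mx mulmx1 uT.
  rewrite -mulmxA (mulmxA _ V) -invmx_unitary// mulVmx ?unitarymx_unit//.
  rewrite mul1mx /to_complex map_trmx -map_mxM mxE sqnormE => ->.
  by apply: eq_bigr => k _; rewrite [const_mx _ _ _]mxE mulr1.
move=> z zd; have Dz k : (\row_k (d k)%:C) 0 k - z != 0.
  by rewrite mxE; exact: zd.
have [zu zE] := resolvent_unitary_diag VU Dz; rewrite AE; split; first exact: zu.
rewrite zE; split.
  rewrite !mulmxA -/u -mulmxA -uT quad_diag_mx; apply: eq_bigr => k _.
  by rewrite !mxE.
rewrite mxtrace_mulC mulmxA (unitarymxP VU) mul1mx mxtrace_diag.
by apply: eq_bigr => k _; rewrite !mxE.
Qed.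

Lemma to_complex_gram_resolvent p n (Y : 'M[R]_(p, n)) (t : R) :
  to_complex (gram_resolvent Y t)
    = invmx (to_complex (Y^T *m Y) - (- t%:C)%:M).
Proof.
rewrite /to_complex map_invmx map_mxD map_scalar_mx; congr invmx.
by rewrite raddfN /= opprK.
Qed.

(** One spectral measure serves the real points [- t] and the upper half-plane
    at the same time. *)
Lemma real_gram_spectral_measure p n (Y : 'M[R]_(p, n)) (y : 'rV[R]_n) :
  exists d w : 'I_n -> R, [/\ forall k, 0 <= d k, forall k, 0 <= w k,
    \sum_k w k = sqnorm y,
    forall t : R, 0 < t ->
      quad (gram_resolvent Y t) y = \sum_k w k / (d k + t) /\
      \tr (gram_resolvent Y t) = \sum_k (d k + t)^-1 &
    forall z : C, 0 < complex.Im z ->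
      to_complex (Y^T *m Y) - z%:M \in unitmx /\
      ((to_complex y *m invmx (to_complex (Y^T *m Y) - z%:M)
        *m (to_complex y)^T) 0 0 = \sum_k (w k)%:C / ((d k)%:C - z)
      /\ \tr (invmx (to_complex (Y^T *m Y) - z%:M))
          = \sum_k ((d k)%:C - z)^-1)].
Proof.
have [d [w [d0 w0 wy dwz]]] := gram_spectral_measure Y y.
exists d, w; split => // [t t0|z z0]; last first.
  apply: dwz => x _; apply/eqP => /(congr1 (@complex.Im R)) /= h.
  by move: z0; case: z h => a b /= h; lra.
have [|_ [e1 e2]] := dwz (- t%:C).
  move=> x x0; rewrite opprK -rmorphD /= fmorph_eq0 gt_eqF//.
  by rewrite ltr_pwDr.
rewrite -to_complex_gram_resolvent in e1 e2.
have eD k : (d k)%:C - - t%:C = (d k + t)%:C :> C by rewrite opprK rmorphD.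
split; apply: (@complexI R); rewrite [RHS]rmorph_sum /=.
  have -> : (quad (gram_resolvent Y t) y)%:C
     = (to_complex y *m to_complex (gram_resolvent Y t) *m (to_complex y)^T) 0 0.
    by rewrite /to_complex map_trmx -!map_mxM mxE.
  by rewrite e1; apply: eq_bigr => k _; rewrite eD -fmorphV -rmorphM.
have -> : (\tr (gram_resolvent Y t))%:C = \tr (to_complex (gram_resolvent Y t)).
  by rewrite rmorph_sum; apply: eq_bigr => k _; rewrite mxE.
by rewrite e2; apply: eq_bigr => k _; rewrite eD -fmorphV.
Qed.

(** Every root of a product of monic linear factors shows up with its
    multiplicity. *)
Lemma perm_eigenvalues m (A : 'M[R]_m) (s : seq R) :
  char_poly A = \prod_(x <- s) ('X - x%:P) -> perm_eq (eigenvalues A) s.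
Proof.
move=> As; have A0 : char_poly A != 0 by rewrite monic_neq0// char_poly_monic.
apply/seq.permP => a; rewrite /eigenvalues.
suff /seq.permP : perm_eq
  (flatten [seq nseq (mup x (char_poly A)) x | x <- rootsR (char_poly A)]) s.
  by apply.
apply/allP => x _ /=; rewrite count_flatten -map_comp.
have -> : count_mem x s = mup x (char_poly A) by rewrite As mu_prod_XsubC.
rewrite sumnE big_map.
rewrite (eq_bigr (fun y => (y == x) * mup y (char_poly A))%N); last first.
  by move=> y _; exact: count_nseq.
have [xr|xr] := boolP (x \in rootsR (char_poly A)).
  rewrite (big_rem _ xr) /= eqxx mul1n big_seq big1 ?addn0// => y.
  by rewrite mem_rem_uniq ?uniq_roots// inE => /andP[/negbTE yx _]; rewrite yx.
rewrite big_seq big1 => [|y yr].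
  by rewrite mupNroot//; have := roots_on_rootsR A0 x; rewrite inE /= => ->.
by case: eqVneq => // yx; rewrite yx (negbTE xr) in yr.
Qed.

Lemma char_poly_similar m (V D : 'M[C]_m) :
  V \is unitarymx -> char_poly (V^t* *m D *m V) = char_poly D.
Proof.
move=> VU; pose f := map_mx (@polyC C).
have VV : V^t* *m V = 1%:M by rewrite -invmx_unitary// mulVmx// unitarymx_unit.
have fVV : f _ _ (V^t*) *m f _ _ V = 1%:M by rewrite -map_mxM VV map_mx1.
rewrite /char_poly.
have -> : char_poly_mx (V^t* *m D *m V)
    = f _ _ (V^t*) *m char_poly_mx D *m f _ _ V.
  rewrite /char_poly_mx mulmxBr mulmxBl !map_mxM mul_mx_scalar -scalemxAl fVV.
  by rewrite scalemx1.
by rewrite !det_mulmx mulrAC -det_mulmx fVV det1 mul1r.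
Qed.

(** [eigenvalues] extracts the real roots of the characteristic polynomial,
    which for a Gram matrix are all of its roots. *)
Lemma eigenvalues_gram p n (Y : 'M[R]_(p, n)) :
  exists d : 'I_n -> R, [/\ forall k, 0 <= d k,
    perm_eq (eigenvalues (Y^T *m Y)) (codom d) &
    forall t, 0 < t -> \tr (gram_resolvent Y t) = \sum_k (d k + t)^-1].
Proof.
have [V [d [VU d0 AE]]] := gram_diagonalization Y.
exists d; split => // [|t t0].
  apply: perm_eigenvalues; apply: (map_poly_inj (real_complex R)).
  rewrite map_char_poly -/(to_complex _) AE char_poly_similar// char_poly_trig.
    rewrite rmorph_prod /= big_image /=; apply: eq_bigr => k _.
    by rewrite rmorphB /= map_polyX map_polyC /= !mxE eqxx mulr1n.
  exact: diag_mx_is_trig.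
apply: (@complexI R); rewrite [RHS]rmorph_sum /=.
have -> : (\tr (gram_resolvent Y t))%:C = \tr (to_complex (gram_resolvent Y t)).
  by rewrite rmorph_sum; apply: eq_bigr => k _; rewrite mxE.
have e k : (\row_k (d k)%:C) 0 k - - t%:C = (d k + t)%:C :> C.
  by rewrite mxE opprK rmorphD.
have Dz k : (\row_k (d k)%:C) 0 k - - t%:C != 0.
  by rewrite e fmorph_eq0 gt_eqF// ltr_pwDr.
have [_ zE] := resolvent_unitary_diag VU Dz.
rewrite to_complex_gram_resolvent AE zE.
rewrite mxtrace_mulC mulmxA (unitarymxP VU) mul1mx mxtrace_diag.
by apply: eq_bigr => k _; rewrite mxE e -fmorphV.
Qed.

End SpectralMeasure.

(** * Uniform approximation by combinations of resolvents *)

Section StieltjesSpan.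
Variable R : realType.
Implicit Types f g : R -> R.

(** Each pair of [l] is a coefficient and a pole; poles are rational so that
    only countably many test functions occur. *)
Definition resolvent_comb (l : seq (R * rat)) (x : R) : R :=
  \sum_(ct <- l) ct.1 / (x + ratr ct.2).

(** The closure of the resolvents in the uniform norm on [x >= 0]. *)
Definition stieltjes_span f : Prop := forall eta : R, 0 < eta ->
  exists l : seq (R * rat), all (fun ct => 0 < ct.2) l /\
    forall x : R, 0 <= x -> `|f x - resolvent_comb l x| <= eta.

Lemma resolvent_comb_cons ct l x : resolvent_comb (ct :: l) x
  = ct.1 / (x + ratr ct.2) + resolvent_comb l x.
Proof. exact: big_cons. Qed.

Lemma resolvent_comb_nil x : resolvent_comb [::] x = 0.
Proof. exact: big_nil. Qed.

Lemma resolvent_comb_cat l l' x : resolvent_comb (l ++ l') x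
  = resolvent_comb l x + resolvent_comb l' x.
Proof. exact: big_cat. Qed.

Lemma resolvent_combZ a l x :
  resolvent_comb [seq (a * ct.1, ct.2) | ct <- l] x = a * resolvent_comb l x.
Proof.
by rewrite /resolvent_comb big_map mulr_sumr; apply: eq_bigr => ct _; rewrite mulrA.
Qed.

Lemma stieltjes_span_closed f :
  (forall eta : R, 0 < eta -> exists2 g, stieltjes_span g &
     forall x : R, 0 <= x -> `|f x - g x| <= eta) -> stieltjes_span f.
Proof.
move=> h eta eta0; have e2 : 0 < eta / 2 by rewrite divr_gt0.
have [g /(_ _ e2) [l [l0 gl]] fg] := h _ e2.
exists l; split => // x x0; rewrite (splitr eta).
by rewrite (le_trans (ler_distD (g x) _ _))// lerD ?fg ?gl.
Qed.

Lemma eq_stieltjes_span f g :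
  (forall x : R, 0 <= x -> f x = g x) -> stieltjes_span g -> stieltjes_span f.
Proof.
move=> fg gs eta /gs[l [l0 gl]]; exists l; split => // x x0.
by rewrite fg ?gl.
Qed.

Lemma resolvent_comb_span l : all (fun ct => 0 < ct.2) l ->
  stieltjes_span (resolvent_comb l).
Proof.
by move=> l0 eta eta0; exists l; split => // x _; rewrite subrr normr0 ltW.
Qed.

Lemma stieltjes_span0 : stieltjes_span (fun=> 0).
Proof.
apply: eq_stieltjes_span (@resolvent_comb_span [::] isT) => x _.
by rewrite resolvent_comb_nil.
Qed.

Lemma resolvent_span (q : rat) : 0 < q ->
  stieltjes_span (fun x => (x + ratr q)^-1).
Proof.
move=> q0; have h : all (fun ct : R * rat => 0 < ct.2) [:: (1, q)].
  by rewrite /= q0.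
apply: eq_stieltjes_span (resolvent_comb_span h) => x _.
by rewrite resolvent_comb_cons resolvent_comb_nil addr0 mul1r.
Qed.

Lemma stieltjes_spanD f g : stieltjes_span f -> stieltjes_span g ->
  stieltjes_span (fun x => f x + g x).
Proof.
move=> fs gs eta eta0; have e2 : 0 < eta / 2 by rewrite divr_gt0.
have [l [l0 fl]] := fs _ e2; have [l' [l'0 gl]] := gs _ e2.
exists (l ++ l'); split => [|x x0]; first by rewrite all_cat l0.
rewrite resolvent_comb_cat opprD addrACA (splitr eta).
by rewrite (le_trans (ler_normD _ _))// lerD ?fl ?gl.
Qed.

Lemma stieltjes_spanZ a f : stieltjes_span f -> stieltjes_span (fun x => a * f x).
Proof.
move=> fs eta eta0; have a1 : 0 < `|a| + 1 by rewrite ltr_wpDl.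
have [l [l0 fl]] := fs _ (divr_gt0 eta0 a1).
exists [seq (a * ct.1, ct.2) | ct <- l]; split => [|x x0].
  by rewrite all_map.
rewrite resolvent_combZ -mulrBr normrM.
rewrite (le_trans (ler_wpM2l (normr_ge0 a) (fl x x0)))// mulrCA.
by rewrite ger_pMr// ler_pdivrMr// mul1r lerDl.
Qed.

Lemma stieltjes_spanB f g : stieltjes_span f -> stieltjes_span g ->
  stieltjes_span (fun x => f x - g x).
Proof.
move=> fs gs; apply: eq_stieltjes_span (stieltjes_spanD fs (stieltjes_spanZ (-1) gs)).
by move=> x _; rewrite mulN1r.
Qed.

(** Partial fractions turn the product of two resolvents with distinct poles
    into a combination of them; the double pole is a limit of such products. *)
Lemma resolvent_mul_span (q : rat) : 0 < q ->
  stieltjes_span (fun x => (x + ratr q)^-1 * (x + 1)^-1).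
Proof.
move=> q0.
have dist (r : rat) : 0 < r -> r != 1 ->
    stieltjes_span (fun x => (x + ratr r)^-1 * (x + 1)^-1).
  move=> r0 r1; have s1 := resolvent_span r0.
  have := stieltjes_spanB s1 (resolvent_span (@ltr01 rat)).
  move=> /(stieltjes_spanZ (1 - ratr r)^-1); apply: eq_stieltjes_span => x x0.
  rewrite rmorph1; field.
  have r1' : (1 : R) - ratr r != 0.
    by rewrite subr_eq0 eq_sym -(rmorph1 (@ratr R)) (inj_eq (fmorph_inj _)).
  by rewrite r1' !gt_eqF ?ltr_wpDl ?ltr0q.
have [->|] := eqVneq q 1; last exact: dist.
rewrite rmorph1; apply: stieltjes_span_closed => eta eta0.
have [r r0 reta] : exists2 r : rat, 0 < r & ratr r <= eta.
  have [r /andP[r0 re]] := rat_in_itvoo eta0.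
  by exists r; [rewrite -(ltr0q R)|exact: ltW].
exists (fun x => (x + ratr (1 + r))^-1 * (x + 1)^-1).
  apply: dist; first by rewrite ltr_wpDr ?ltW.
  by rewrite -subr_eq0 addrAC subrr add0r gt_eqF.
move=> x x0; rewrite rmorphD rmorph1 /=; have r0' : 0 < ratr r :> R by rewrite ltr0q.
have x1 : 0 < x + 1 by rewrite ltr_wpDl.
have x2 : 0 < x + (1 + ratr r) by rewrite ltr_wpDl// ltr_wpDl.
have -> : (x + 1)^-1 * (x + 1)^-1 - (x + (1 + ratr r))^-1 * (x + 1)^-1
   = ratr r / ((x + 1) * (x + 1) * (x + (1 + ratr r))).
  by field; rewrite !gt_eqF.
have d1 : 1 <= (x + 1) * (x + 1) * (x + (1 + ratr r)).
  by rewrite !mulr_ege1//; lra.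
have d0 := lt_le_trans ltr01 d1.
rewrite (ger0_norm (divr_ge0 (ltW r0') (ltW d0))); apply: le_trans reta.
by rewrite ler_pdivrMr// ler_peMr// ltW.
Qed.

(** With [u = 1 / (x + 1)] in the span, this makes the span contain every
    polynomial in [u] without constant term. *)
Lemma stieltjes_span_mul f : stieltjes_span f ->
  stieltjes_span (fun x => f x * (x + 1)^-1).
Proof.
move=> fs; apply: stieltjes_span_closed => eta /fs[l [l0 fl]].
exists (fun x => resolvent_comb l x * (x + 1)^-1).
  elim: l l0 {fl} => [_|[c t] l ih /= /andP[t0 l0]].
    apply: eq_stieltjes_span stieltjes_span0 => x _.
    by rewrite resolvent_comb_nil mul0r.
  have := stieltjes_spanD (stieltjes_spanZ c (resolvent_mul_span t0)) (ih l0).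
  apply: eq_stieltjes_span => x _.
  by rewrite resolvent_comb_cons mulrDl mulrA.
move=> x x0; rewrite -mulrBl normrM; apply: le_trans (fl x x0).
rewrite ler_piMr// normfV invf_le1 ?normr_gt0 ?gt_eqF ?ltr_wpDl//.
by rewrite ger0_norm ?addr_ge0// lerDr.
Qed.

(** [bernstein n g u k] is the expectation of [g] at [k] plus a binomial
    variable with parameters [n] and [u]; the recursion conditions on the
    first trial. *)
Fixpoint bernstein (n : nat) (g : nat -> R) (u : R) (k : nat) : R :=
  if n is n'.+1 then
    (1 - u) * bernstein n' g u k + u * bernstein n' g u k.+1
  else g k.

Lemma bernstein_span n (g : nat -> R) k :
  stieltjes_span (fun x => bernstein n g (x + 1)^-1 k - g k).
Proof.
elim: n k => [|n ih] k /=.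
  by apply: eq_stieltjes_span stieltjes_span0 => x _; rewrite subrr.
have u := @resolvent_span 1 ltr01; rewrite rmorph1 in u.
have := stieltjes_spanD (ih k) (stieltjes_spanD
  (stieltjes_span_mul (stieltjes_spanB (ih k.+1) (ih k)))
  (stieltjes_spanZ (g k.+1 - g k) u)).
by apply: eq_stieltjes_span => x _; ring.
Qed.

(** The right-hand side is computed from the mean [n u] and the variance
    [n u (1 - u)] of the binomial law. *)
Lemma bernstein_le n (g : nat -> R) (u v a b c : R) k : 0 <= u <= 1 ->
  (forall k, `|g k - v| <= a + b * (k%:R - c) ^+ 2) ->
  `|bernstein n g u k - v|
    <= a + b * ((k%:R + n%:R * u - c) ^+ 2 + n%:R * (u * (1 - u))).
Proof.
move=> /andP[u0 u1] gv; elim: n k => [|n ih] k /=.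
  by rewrite !mul0r !addr0; exact: gv.
have -> : (1 - u) * bernstein n g u k + u * bernstein n g u k.+1 - v
  = (1 - u) * (bernstein n g u k - v) + u * (bernstein n g u k.+1 - v) by ring.
have := ler_wpM2l u0 (ih k.+1).
have u1' : 0 <= 1 - u by lra.
have := ler_wpM2l u1' (ih k) => h1 h2.
apply: le_trans (ler_normD _ _) _.
rewrite !normrM (ger0_norm u0) (ger0_norm u1').
apply: le_trans (lerD h1 h2) _; rewrite le_eqVlt; apply/orP; left; apply/eqP.
by rewrite -!natr1; ring.
Qed.

(** Bernstein's proof of the Weierstrass theorem, in the variable
    [u = 1 / (x + 1)]. *)
Lemma lipschitz_span (g : R -> R) (L : R) : 0 <= L -> g 0 = 0 ->
  (forall u v : R, 0 <= u <= 1 -> 0 <= v <= 1 -> `|g u - g v| <= L * `|u - v|) ->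
  stieltjes_span (fun x => g (x + 1)^-1).
Proof.
move=> L0 g0 gL; apply: stieltjes_span_closed => eta eta0.
have L1 : 0 < L + 1 by rewrite ltr_wpDl.
have [h h0 hE] : exists2 h, 0 < h & L * h + h = eta.
  by exists (eta / (L + 1)); [rewrite divr_gt0|field; rewrite gt_eqF].
pose N := (Num.truncn (h ^+ 2)^-1).+1.
have hN : (h ^+ 2)^-1 < N%:R by exact: truncnS_gt.
have N0 : 0 < N%:R :> R by rewrite ltr0n.
pose gN k := g (Num.min 1 (k%:R / N%:R)).
exists (fun x => bernstein N gN (x + 1)^-1 0 - gN 0%N); first exact: bernstein_span.
move=> x x0; have -> : gN 0%N = 0.
  by rewrite /gN mul0r min_r// ler01.
rewrite subr0; set u := (x + 1)^-1; have u01 : 0 <= u <= 1.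
  by rewrite invr_ge0 addr_ge0//= invf_le1 ?lerDr// ltr_wpDl.
have key k : `|gN k - g u|
    <= L / 2 * h + L / 2 / h / N%:R ^+ 2 * (k%:R - N%:R * u) ^+ 2.
  pose a := k%:R / N%:R : R; have a0 : 0 <= a by rewrite divr_ge0.
  have /le_trans -> // : `|gN k - g u| <= L * `|a - u|.
    apply: le_trans (gL _ _ _ u01) _.
      by rewrite le_min ler01 a0 ge_min lexx.
    apply: ler_wpM2l => //; rewrite -/a; have [a1|a1] := leP 1 a; last by [].
    by move: u01 => /andP[_ u1]; rewrite !ger0_norm; lra.
  have -> : L / 2 * h + L / 2 / h / N%:R ^+ 2 * (k%:R - N%:R * u) ^+ 2
     = L * ((h + (a - u) ^+ 2 / h) / 2).
    by rewrite /a; field; rewrite !gt_eqF.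
  apply: ler_wpM2l => //; rewrite ler_pdivlMr// -(ler_pM2r h0).
  rewrite [leRHS]mulrDl mulfVK ?gt_eqF// -(real_normK (num_real (a - u))).
  by have := sqr_ge0 (h - `|a - u|); lra.
rewrite distrC; have /le_trans-> // := bernstein_le N 0 u01 key.
rewrite add0r subrr expr0n /= add0r.
have -> : L / 2 / h / N%:R ^+ 2 * (N%:R * (u * (1 - u)))
    = L / 2 * ((u * (1 - u)) / (h * N%:R)) by field; rewrite !gt_eqF.
have uu : (u * (1 - u)) / (h * N%:R) <= h.
  rewrite ler_pdivrMr ?mulr_gt0//.
  have : 1 < h ^+ 2 * N%:R.
    by rewrite -ltr_pdivrMl ?exprn_gt0// mulr1.
  by move: u01 => /andP[? ?]; nra.
apply: (@le_trans _ _ (L * h)).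
  have := ler_wpM2l (_ : 0 <= L / 2) uu; rewrite divr_ge0// => /(_ isT); lra.
by rewrite -hE lerDl ltW.
Qed.

(** A quotient is Lipschitz as soon as its cross difference is and its
    denominator is bounded below. *)
Lemma lipschitz_ratio (nu de : R -> R) (K m : R) : 0 < m -> 0 <= K ->
  (forall u : R, 0 <= u <= 1 -> m <= de u) ->
  (forall u v : R, 0 <= u <= 1 -> 0 <= v <= 1 ->
     `|nu u * de v - nu v * de u| <= K * `|u - v|) ->
  forall u v : R, 0 <= u <= 1 -> 0 <= v <= 1 ->
    `|nu u / de u - nu v / de v| <= K / m ^+ 2 * `|u - v|.
Proof.
move=> m0 K0 dm nd u v u01 v01.
have du := lt_le_trans m0 (dm u u01); have dv := lt_le_trans m0 (dm v v01).
have -> : nu u / de u - nu v / de v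
    = (nu u * de v - nu v * de u) / (de u * de v).
  by field; rewrite !gt_eqF.
rewrite normrM normfV (gtr0_norm (mulr_gt0 du dv)) ler_pdivrMr ?mulr_gt0//.
apply: le_trans (nd u v u01 v01) _; rewrite [leRHS]mulrAC ler_wpM2r//.
rewrite -mulrA ler_peMr// mulrC ler_pdivlMr ?exprn_gt0// mul1r expr2.
by rewrite ler_pM ?dm// ltW.
Qed.

Lemma clamp_lipschitz (a b : R) :
  `|Num.max 0 (Num.min 1 a) - Num.max 0 (Num.min 1 b)| <= `|a - b|.
Proof.
rewrite ler_norml; have := ler_norm (a - b); have := ler_norm (b - a).
rewrite [`|b - a|]distrC => h1 h2.
by have [|] := leP 1 a; have [|] := leP 1 b => ? ?;
  have [] := leP 0 a => ?; have [] := leP 0 b => ?;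
  rewrite ?(max_r ler01) //; apply/andP; split; lra.
Qed.

(** A clamped affine function of [1 / (y + 1)] interpolates between the two
    half-lines, so that Stieltjes transforms control distribution functions. *)
Lemma indicator_span (x x' : R) : 0 <= x -> x < x' ->
  exists2 f, stieltjes_span f & forall y : R, 0 <= y ->
    (y <= x)%R%:R <= f y <= (y <= x')%R%:R.
Proof.
move=> x0 xx'; have x'0 : 0 < x' := le_lt_trans x0 xx'.
pose u1 := (x + 1)^-1; pose u2 := (x' + 1)^-1.
have u20 : 0 < u2 by rewrite invr_gt0; lra.
have u12 : u2 < u1 by rewrite ltf_pV2 ?posrE; lra.
have d0 : 0 < u1 - u2 by rewrite subr_gt0.
pose g u := Num.max 0 (Num.min 1 ((u - u2) / (u1 - u2))).
exists (fun y => g (y + 1)^-1).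
  apply: (@lipschitz_span g (u1 - u2)^-1); first by rewrite invr_ge0 ltW.
    rewrite /g max_l// sub0r mulNr ge_min; apply/orP; right.
    by rewrite oppr_le0 divr_ge0// ltW.
  move=> u v _ _; apply: le_trans (clamp_lipschitz _ _) _.
  rewrite -mulrBl opprB addrA subrK normrM mulrC ger0_norm//.
  by rewrite invr_ge0 ltW.
move=> y y0; have y1 : 0 < y + 1 by lra.
apply/andP; split.
  have [yx|_] := leP y x; last by rewrite le_max lexx.
  rewrite le_max; apply/orP; right; rewrite le_min lexx/= ler_pdivlMr// mul1r.
  by rewrite lerD2r lef_pV2 ?posrE; lra.
have [yx|yx] := leP y x'; first by rewrite ge_max ler01 ge_min lexx.
rewrite ge_max lexx ge_min; apply/orP; right.
rewrite ler_pdivrMr// mul0r subr_le0 lef_pV2 ?posrE; lra.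
Qed.

(** These are the real and the imaginary part of [1 / (x - z)], [z = a + i b]:
    in the variable [u = 1 / (x + 1)] they become rational functions whose
    denominator stays away from zero. *)
Lemma cauchy_kernel_span (a b : R) : b != 0 ->
  stieltjes_span (fun x => (x - a) / ((x - a) ^+ 2 + b ^+ 2)) /\
  stieltjes_span (fun x => b / ((x - a) ^+ 2 + b ^+ 2)).
Proof.
move=> b0; pose c := 1 + a; have b2 : 0 < b ^+ 2 by rewrite exprn_even_gt0.
pose e := c ^+ 2 + b ^+ 2; have e0 : 0 < e by rewrite ltr_wpDl ?sqr_ge0.
pose de u := (1 - c * u) ^+ 2 + b ^+ 2 * u ^+ 2.
pose m := b ^+ 2 / e; have m0 : 0 < m by rewrite divr_gt0.
have dm u : 0 <= u <= 1 -> m <= de u.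
  move=> _; rewrite /m ler_pdivrMr// /de /e.
  by have := sqr_ge0 ((c ^+ 2 + b ^+ 2) * u - c); nra.
have den x : 0 <= x -> de (x + 1)^-1 = (x + 1)^-1 ^+ 2 * ((x - a) ^+ 2 + b ^+ 2).
  by move=> x0; rewrite /de /c; field; rewrite gt_eqF// ltr_wpDl.
have den0 x : (x - a) ^+ 2 + b ^+ 2 != 0.
  by rewrite gt_eqF// ltr_wpDl// sqr_ge0.
split.
- pose g u := u * (1 - c * u) / de u.
  apply: (@eq_stieltjes_span _ (fun x => g (x + 1)^-1)) => [x x0|].
    rewrite /g den// /c; field.
    by rewrite den0 gt_eqF// ltr_wpDl.
  pose K := 1 + `|c| * 2 + `|2 * c ^+ 2 - e|.
  have K0 : 0 <= K by rewrite /K !addr_ge0 ?mulr_ge0.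
  apply: (@lipschitz_span _ (K / m ^+ 2)); first by rewrite divr_ge0 ?sqr_ge0.
    by rewrite /g !mul0r.
  apply: lipschitz_ratio => // u v /andP[u0 u1] /andP[v0 v1].
  have -> : u * (1 - c * u) * de v - v * (1 - c * v) * de u
     = (1 - c * (u + v) + (2 * c ^+ 2 - e) * (u * v)) * (u - v).
    by rewrite /de /e; ring.
  rewrite normrM ler_wpM2r// /K; apply: le_trans (ler_normD _ _) _.
  apply: lerD; last first.
    rewrite normrM ler_piMr// ger0_norm ?mulr_ge0// -[leRHS]mulr1.
    by rewrite ler_pM.
  apply: le_trans (ler_normB _ _) _; rewrite normr1 lerD2l normrM.
  by rewrite ler_wpM2l// ger0_norm; lra.
- pose g u := b * u ^+ 2 / de u.
  apply: (@eq_stieltjes_span _ (fun x => g (x + 1)^-1)) => [x x0|].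
    by rewrite /g den//; field; rewrite den0 gt_eqF// ltr_wpDl.
  pose K := `|b| * (2 + `|c| * 2).
  have K0 : 0 <= K by rewrite /K mulr_ge0 ?addr_ge0 ?mulr_ge0.
  apply: (@lipschitz_span _ (K / m ^+ 2)); first by rewrite divr_ge0 ?sqr_ge0.
    by rewrite /g expr0n /= mulr0 mul0r.
  apply: lipschitz_ratio => // u v /andP[u0 u1] /andP[v0 v1].
  have -> : b * u ^+ 2 * de v - b * v ^+ 2 * de u
     = b * ((u + v) - c * (2 * (u * v))) * (u - v).
    by rewrite /de; ring.
  rewrite normrM ler_wpM2r// /K normrM ler_wpM2l//.
  apply: le_trans (ler_normB _ _) _; apply: lerD.
    by rewrite ger0_norm; lra.
  rewrite normrM ler_wpM2l// ger0_norm ?mulr_ge0// -[leRHS]mulr1 ler_pM2l//.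
  by rewrite -[leRHS]mulr1 ler_pM.
Qed.

End StieltjesSpan.

(** * The semicircle integral *)

Section MeasurableInverse.
Context d (T : measurableType d) (R : realType).

Lemma measurable_funV (D : set T) (f : T -> R) :
  measurable_fun D f -> measurable_fun D (fun x => (f x)^-1).
Proof.
move=> mf; have -> : (fun x => (f x)^-1) = (fun x => f x * (f x ^+ 2) `^ (-1)).
  apply/funext => x; rewrite powR_inv1 ?sqr_ge0//.
  have [->|fx0] := eqVneq (f x) 0; first by rewrite invr0 mul0r.
  by rewrite expr2 invfM mulrA mulfV// mul1r.
apply: measurable_funM => //.
apply: (@measurableT_comp _ _ _ _ _ _ (@powR R ^~ (-1))) => //.
exact: measurable_funX.
Qed.

End MeasurableInverse.

Section SemicircleIntegral.
Variable R : realType.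
Local Notation mu := (@lebesgue_measure R).

Lemma cvg_acos (T : Type) (F : set_system T) {FF : Filter F}
    (f : T -> R) (l : R) :
  f @ F --> l -> -1 <= l <= 1 -> (\forall x \near F, -1 <= f x <= 1) ->
  acos (f x) @[x --> F] --> acos l.
Proof.
move=> fl l1 f1.
have cont : {within `[cos (pi : R), cos (0 : R)], continuous (@acos R)}.
  apply: segment_can_ge_continuous; first exact: pi_ge0.
    by apply: continuous_subspaceT; exact: continuous_cos.
  by move=> x x0; rewrite cosK.
rewrite cospi cos0 in cont.
have /subspace_continuousP /(_ l) := cont.
rewrite /= in_itv /= => /(_ l1); apply: cvg_comp => A /= [e e0 h].
near=> x; apply: h => /=; last by rewrite in_itv /=; near: x.
by near: x; move/cvgrPdist_lt : fl; exact.
Unshelve. all: by end_near. Qed.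

Definition semicircle (c r x : R) := Num.sqrt (r ^+ 2 - (x - c) ^+ 2).

(** The Moebius map sending [c - r], [c + r] and [- t] to [- 1], [1] and
    infinity. *)
Definition semicircle_moebius (c r t x : R) :=
  (r ^+ 2 + (c + t) * (x - c)) / (r * (x + t)).

Definition semicircle_primitive (c r t x : R) :=
  semicircle c r x - (c + t) * acos ((x - c) / r)
    + Num.sqrt ((c + t) ^+ 2 - r ^+ 2) * acos (semicircle_moebius c r t x).

Lemma radicand_gt0 (c r x : R) :
  c - r < x < c + r -> 0 < r ^+ 2 - (x - c) ^+ 2.
Proof. by move=> /andP[? ?]; rewrite subr_sqr mulr_gt0//; lra. Qed.

Lemma semicircle_gt0 (c r x : R) : c - r < x < c + r -> 0 < semicircle c r x.
Proof. by move=> ?; rewrite sqrtr_gt0 radicand_gt0. Qed.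

Lemma sqr_semicircle (c r x : R) :
  c - r < x < c + r -> semicircle c r x ^+ 2 = r ^+ 2 - (x - c) ^+ 2.
Proof. by move=> ?; rewrite sqr_sqrtr// ltW// radicand_gt0. Qed.

Lemma affine_bound (c r x : R) : 0 < r ->
  c - r <= x <= c + r -> -1 <= (x - c) / r <= 1.
Proof.
move=> r0 /andP[? ?]; rewrite ler_pdivrMr// ler_pdivlMr//.
by apply/andP; split; lra.
Qed.

Lemma moebius_bound (c r t x : R) : 0 < r -> r <= c -> 0 < t ->
  c - r <= x <= c + r -> -1 <= semicircle_moebius c r t x <= 1.
Proof.
move=> r0 rc t0 /andP[? ?].
have d0 : 0 < r * (x + t) by rewrite mulr_gt0//; lra.
have p1 : 0 <= (r + (x - c)) * (r + (c + t)) by rewrite mulr_ge0//; lra.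
have p2 : 0 <= (r - (x - c)) * (c + t - r) by rewrite mulr_ge0//; lra.
rewrite /semicircle_moebius ler_pdivrMr// ler_pdivlMr//.
by apply/andP; split; lra.
Qed.

Lemma sqrt_1Bsqr_lt1 (x : R) : Num.sqrt (1 - x ^+ 2) != 0 -> -1 < x < 1.
Proof.
rewrite sqrtr_eq0 -ltNge subr_gt0 => x1; rewrite -ltr_norml.
by rewrite -(ltr_pXn2r (n := 2)) ?nnegrE// expr1n real_normK ?num_real.
Qed.

(** With [S] the semicircle and [q] the square root in the definition, the
    derivatives of the three terms are [- (x - c) / S], [(c + t) / S] and
    [- q^2 / ((x + t) S)]; their sum is [S^2 / ((x + t) S)]. *)
Lemma is_derive_semicircle_primitive (c r t x : R) :
  0 < r -> r <= c -> 0 < t -> c - r < x < c + r ->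
  is_derive x 1 (semicircle_primitive c r t) (semicircle c r x / (x + t)).
Proof.
move=> r0 rc t0 xcr; have /andP[x1 x2] := xcr; have xt : 0 < x + t by lra.
pose q := Num.sqrt ((c + t) ^+ 2 - r ^+ 2).
have d0 : 0 < (c + t) ^+ 2 - r ^+ 2 by rewrite subr_sqr mulr_gt0//; lra.
have q2 : q ^+ 2 = (c + t) ^+ 2 - r ^+ 2 by rewrite sqr_sqrtr// ltW.
have q_gt0 : 0 < q by rewrite sqrtr_gt0.
have Sx := semicircle_gt0 xcr; have S2 := sqr_semicircle xcr.
set S := semicircle c r in Sx S2 *; set h := semicircle_moebius c r t.
have sqrt_y : Num.sqrt (1 - ((x - c) / r) ^+ 2) = S x / r.
  have -> : 1 - ((x - c) / r) ^+ 2 = (S x / r) ^+ 2.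
    by rewrite [RHS]expr_div_n S2//; field; rewrite gt_eqF.
  by rewrite sqrtr_sqr ger0_norm// divr_ge0 ?ltW.
have sqrt_h : Num.sqrt (1 - h x ^+ 2) = q * S x / (r * (x + t)).
  have -> : 1 - h x ^+ 2 = (q * S x / (r * (x + t))) ^+ 2.
    rewrite [RHS]expr_div_n [in RHS]exprMn S2// q2 /h /semicircle_moebius; field.
    by rewrite !gt_eqF.
  by rewrite sqrtr_sqr ger0_norm// divr_ge0 ?mulr_ge0 ?ltW.
have y1 : -1 < (x - c) / r < 1.
  by apply: sqrt_1Bsqr_lt1; rewrite sqrt_y// gt_eqF// divr_gt0.
have h1 : -1 < h x < 1.
  by apply: sqrt_1Bsqr_lt1; rewrite sqrt_h// gt_eqF// divr_gt0 ?mulr_gt0.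
have dS : is_derive x 1 S (- (x - c) / S x).
  have d1 : is_derive x 1 (fun x : R => r ^+ 2 - (x - c) ^+ 2) (- (2 * (x - c))).
    by apply: is_derive_eq; rewrite /GRing.scale /=; ring.
  have e := @is_derive1_comp _ _ (fun x : R => r ^+ 2 - (x - c) ^+ 2) _ _ _
    (is_derive1_sqrt (radicand_gt0 xcr)) d1.
  apply: (is_derive_eq (e : is_derive x 1 S _)); rewrite -/(semicircle c r x) -/S; field.
  by rewrite gt_eqF.
have dy : is_derive x 1 (fun x : R => acos ((x - c) / r)) (- (S x)^-1).
  have d1 : is_derive x 1 (fun x : R => (x - c) / r) r^-1.
    by apply: is_derive_eq; rewrite /GRing.scale /=; ring.
  have e := @is_derive1_comp _ _ (fun x : R => (x - c) / r) _ _ _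
    (is_derive1_acos y1) d1.
  apply: (is_derive_eq (e : is_derive x 1 (fun x => acos ((x - c) / r)) _)); rewrite sqrt_y//; field.
  by rewrite !gt_eqF.
have dh : is_derive x 1 (fun x : R => acos (h x)) (- (q / ((x + t) * S x))).
  have d1 : is_derive x 1 h (q ^+ 2 / (r * (x + t) ^+ 2)).
    have n0 : r * (x + t) != 0 by rewrite mulf_neq0// gt_eqF.
    have dn : is_derive x 1 (fun x : R => r ^+ 2 + (c + t) * (x - c)) (c + t).
      by apply: is_derive_eq; rewrite /GRing.scale /=; ring.
    have dd : is_derive x 1 (fun x : R => r * (x + t)) r.
      by apply: is_derive_eq; rewrite /GRing.scale /=; ring.
    have dv := @is_deriveV _ (fun x : R => r * (x + t)) _ _ _ n0 dd.
    apply: (is_derive_eq (is_deriveM dn dv : is_derive x 1 h _)).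
    rewrite /GRing.scale /= q2; field.
    by rewrite !gt_eqF.
  have e := @is_derive1_comp _ _ h _ _ _ (is_derive1_acos h1) d1.
  apply: (is_derive_eq (e : is_derive x 1 (fun x => acos (h x)) _)); rewrite sqrt_h//; field.
  by rewrite !gt_eqF.
have e := is_deriveD (is_deriveB dS (is_deriveZ (c + t) dy)) (is_deriveZ q dh).
apply: (is_derive_eq (e : is_derive x 1 (semicircle_primitive c r t) _)).
rewrite /GRing.scale /=.
have -> : - (x - c) / S x - (c + t) * - (S x)^-1 + q * - (q / ((x + t) * S x))
  = ((c + t) ^+ 2 - (x - c) ^+ 2 - q ^+ 2) / ((x + t) * S x).
  by field; rewrite !gt_eqF.
rewrite q2.
have -> : (c + t) ^+ 2 - (x - c) ^+ 2 - ((c + t) ^+ 2 - r ^+ 2) = S x ^+ 2.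
  by rewrite S2; ring.
by field; rewrite !gt_eqF.
Qed.

Lemma semicircle_primitive_cvg (c r t x : R) (F : set_system R) {FF : Filter F} :
  0 < r -> r <= c -> 0 < t -> c - r <= x <= c + r ->
  y @[y --> F] --> x -> (\forall y \near F, c - r <= y <= c + r) ->
  semicircle_primitive c r t y @[y --> F] --> semicircle_primitive c r t x.
Proof.
move=> r0 rc t0 xcr Fx Fcr; have xc : y - c @[y --> F] --> x - c.
  by apply: cvgB => //; exact: cvg_cst.
apply: cvgD; [apply: cvgB|].
- apply: continuous_cvg; first exact: sqrt_continuous.
  by apply: cvgB; [exact: cvg_cst|rewrite expr2; exact: cvgM].
- apply: cvgMr; apply: cvg_acos; [exact: cvgMl|exact: affine_bound|].
  by apply: filterS Fcr => y; exact: affine_bound.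
- apply: cvgMr; apply: cvg_acos; [|exact: moebius_bound|].
    apply: cvgM.
      by apply: cvgD; [exact: cvg_cst|exact: cvgMr].
    apply: cvgV; last by apply: cvgMr; apply: cvgD => //; exact: cvg_cst.
    by rewrite mulf_neq0// gt_eqF//; move: xcr => /andP[]; lra.
  by apply: filterS Fcr => y; exact: moebius_bound.
Qed.

Lemma semicircle_resolvent_integral (c r t : R) : 0 < r -> r <= c -> 0 < t ->
  (\int[mu]_(x in `[(c - r)%R, (c + r)%R]) (semicircle c r x / (x + t))%:E)%E
    = (pi * (c + t - Num.sqrt ((c + t) ^+ 2 - r ^+ 2)))%:E.
Proof.
move=> r0 rc t0; have crcr : c - r < c + r by lra.
have prim := semicircle_primitive_cvg r0 rc t0.
rewrite (@continuous_FTC2 _ _ (semicircle_primitive c r t)) //=.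
- rewrite -EFinB /semicircle_primitive /semicircle /semicircle_moebius.
  have -> : (c + r - c) = r by ring.
  have -> : (c - r - c) = - r by ring.
  rewrite sqrrN subrr sqrtr0 mulNr mulfV ?gt_eqF//.
  have -> : (r ^+ 2 + (c + t) * r) / (r * (c + r + t)) = 1.
    by field; rewrite !gt_eqF//; lra.
  have -> : (r ^+ 2 + (c + t) * - r) / (r * (c - r + t)) = - 1.
    by field; rewrite !gt_eqF//; lra.
  by rewrite acos1 acosN1; congr EFin; ring.
- apply/continuous_in_subspaceT => x; rewrite inE /= in_itv /= => /andP[x1 x2].
  apply: cvgM.
    apply: continuous_cvg; first exact: sqrt_continuous.
    apply: cvgB; first exact: cvg_cst.
    by rewrite expr2; apply: cvgM; (apply: cvgB; [exact: cvg_id|exact: cvg_cst]).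
  apply: cvgV; first by rewrite gt_eqF//; lra.
  by apply: cvgD; [exact: cvg_id|exact: cvg_cst].
- split.
  + move=> x; rewrite in_itv /= => xcr.
    by have [] := is_derive_semicircle_primitive r0 rc t0 xcr.
  + apply: prim; first by lra.
      by apply: cvg_at_right_filter; exact: cvg_id.
    near=> y; apply/andP; split; first by near: y; exact: nbhs_right_ge.
    by near: y; exact: nbhs_right_le.
  + apply: prim; first by lra.
      by apply: cvg_at_left_filter; exact: cvg_id.
    near=> y; apply/andP; split; last by near: y; exact: nbhs_left_le.
    by near: y; exact: nbhs_left_ge.
- move=> x; rewrite in_itv /= => xcr; rewrite derive1E.
  by have [_ ->] := is_derive_semicircle_primitive r0 rc t0 xcr.
Unshelve. all: by end_near. Qed.

Lemma measurable_semicircle (c r : R) :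
  measurable_fun setT (semicircle c r).
Proof.
apply: continuous_measurable_fun => x.
apply: continuous_cvg; first exact: sqrt_continuous.
apply: cvgB; first exact: cvg_cst.
by rewrite expr2; apply: cvgM; (apply: cvgB; [exact: cvg_id|exact: cvg_cst]).
Qed.

(** The integrand is singular at the origin when [r = c], so the value at
    [t = 0] is reached by monotone convergence. *)
Lemma semicircle_resolvent_integral0 (c r : R) : 0 < r -> r <= c ->
  (\int[mu]_(x in `[(c - r)%R, (c + r)%R]) (semicircle c r x / x)%:E)%E
    = (pi * (c - Num.sqrt (c ^+ 2 - r ^+ 2)))%:E.
Proof.
move=> r0 rc; pose s n : R := n.+1%:R^-1.
have s0 n : 0 < s n by rewrite invr_gt0.
pose g n (x : R) : \bar R := (semicircle c r x / (x + s n))%:E.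
have scv : s n @[n --> \oo] --> (0 : R) by exact: (@cvg_harmonic R).
have xge0 x : x \in `[c - r, c + r] -> 0 <= x.
  by rewrite in_itv /= => /andP[? ?]; lra.
have glim x : x \in `[c - r, c + r] ->
    g n x @[n --> \oo] --> (semicircle c r x / x)%:E.
  move=> xcr; apply: cvg_EFin; first exact: nearW.
  have [x0|x0] := eqVneq x 0.
    have xr : r = c by move: xcr; rewrite x0 in_itv /= => /andP[? _]; lra.
    rewrite [X in _ --> X](_ : _ = 0); last by rewrite x0 invr0 mulr0.
    apply: cvg_near_cst; apply: nearW => n /=.
    by rewrite x0 /semicircle xr sub0r sqrrN subrr sqrtr0 mul0r.
  apply: cvgMr; apply: cvgV => //; rewrite -[X in _ --> X]addr0.
  by apply: cvgD => //; exact: cvg_cst.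
have mono : forall x, `[c - r, c + r]%classic x ->
    {homo g ^~ x : m n / (m <= n)%N >-> (m <= n)%E}.
  move=> x /= /xge0 x0 m n mn; rewrite lee_fin ler_wpM2l ?sqrtr_ge0//.
  rewrite lef_pV2 ?posrE ?ltr_wpDl// lerD2l lef_pV2 ?posrE//.
  by rewrite ler_nat.
have mg n : measurable_fun `[c - r, c + r]%classic (g n).
  apply/measurable_EFinP; apply: measurable_funTS; apply: measurable_funM.
    exact: measurable_semicircle.
  by apply: measurable_funV; exact: measurable_funD.
have g0 n x : `[c - r, c + r]%classic x -> (0 <= g n x)%E.
  move=> /= /xge0 x0; rewrite lee_fin divr_ge0 ?sqrtr_ge0//.
  by rewrite addr_ge0// ltW.
have := @cvg_monotone_convergence _ _ _ mu _ (measurable_itv _) g mg g0 mono.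
have -> : (\int[mu]_(x in `[(c - r)%R, (c + r)%R]) limn (g ^~ x))%E
  = (\int[mu]_(x in `[(c - r)%R, (c + r)%R]) (semicircle c r x / x)%:E)%E.
  by apply: eq_integral => x /set_mem /glim /cvg_lim; apply.
move=> /cvg_lim <- //; apply: cvg_lim => //.
under eq_fun do rewrite semicircle_resolvent_integral//.
apply: cvg_EFin; first exact: nearW.
apply: cvgMr.
have ccv : c + s n @[n --> \oo] --> c.
  by rewrite -[X in _ --> X]addr0; apply: cvgD => //; exact: cvg_cst.
apply: cvgB => //; apply: continuous_cvg; first exact: sqrt_continuous.
by apply: cvgB; [exact: (cvgM ccv ccv)|exact: cvg_cst].
Qed.

End SemicircleIntegral.

(** * Means under the Marchenko--Pastur law *)

Section MarchenkoPastur.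
Variable R : realType.
Local Notation mu := (@lebesgue_measure R).
Implicit Types (gamma x t : R) (f g : R -> R).

Let center gamma := 1 + gamma.
Let radius gamma := 2 * Num.sqrt gamma.

Lemma MP_radius_gt0 gamma : 0 < gamma -> 0 < radius gamma.
Proof. by move=> g0; rewrite mulr_gt0 ?sqrtr_gt0. Qed.

Lemma MP_radius_le_center gamma : 0 < gamma -> radius gamma <= center gamma.
Proof.
move=> g0; have := sqr_ge0 (1 - Num.sqrt gamma).
have := sqr_sqrtr (ltW g0); rewrite /radius /center; lra.
Qed.

Lemma MP_left_radius gamma : 0 < gamma -> MP_left gamma = center gamma - radius gamma.
Proof.
move=> g0; have := sqr_sqrtr (ltW g0); rewrite /MP_left /radius /center.
by move=> h; rewrite -{2}h; ring.
Qed.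

Lemma MP_right_radius gamma : 0 < gamma -> MP_right gamma = center gamma + radius gamma.
Proof.
move=> g0; have := sqr_sqrtr (ltW g0); rewrite /MP_right /radius /center.
by move=> h; rewrite -{2}h; ring.
Qed.

Lemma MP_left_ge0 gamma : 0 <= MP_left gamma.
Proof. exact: sqr_ge0. Qed.

Lemma MP_densityE gamma : 0 < gamma -> MP_density gamma =
  (fun x => (2 * pi * gamma)^-1 * (semicircle (center gamma) (radius gamma) x / x))
    \_ `[(center gamma - radius gamma), (center gamma + radius gamma)].
Proof.
move=> g0; apply/funext => x; rewrite /MP_density patchE MP_left_radius// MP_right_radius//.
rewrite mem_setE in_itv /=; case: ifP => // _.
have -> : (center gamma + radius gamma - x) * (x - (center gamma - radius gamma))
  = radius gamma ^+ 2 - (x - center gamma) ^+ 2 by ring.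
by rewrite invfM mulrCA.
Qed.

Lemma MP_density_ge0 gamma x : 0 < gamma -> 0 <= MP_density gamma x.
Proof.
move=> g0; rewrite /MP_density; case: ifP => // /andP[ax _].
have x0 : 0 <= x := le_trans (MP_left_ge0 gamma) ax.
by rewrite divr_ge0 ?sqrtr_ge0// !mulr_ge0 ?pi_ge0 ?(ltW g0).
Qed.

Lemma MP_density_lt0 gamma x : x < 0 -> MP_density gamma x = 0.
Proof.
move=> x0; rewrite /MP_density; case: ifP => // /andP[ax _].
by have := le_lt_trans ax x0; rewrite ltNge MP_left_ge0.
Qed.

Lemma measurable_MP_density gamma : 0 < gamma ->
  measurable_fun setT (MP_density gamma).
Proof.
move=> g0; rewrite MP_densityE//; apply/(measurable_restrictT _ _).1 => //.
apply: measurable_funTS; apply: measurable_funM => //; apply: measurable_funM.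
  exact: measurable_semicircle.
exact: measurable_funV.
Qed.

Lemma MP_discriminant gamma : 0 < gamma ->
  Num.sqrt (center gamma ^+ 2 - radius gamma ^+ 2) = `|1 - gamma|.
Proof.
move=> g0; rewrite /center /radius exprMn sqr_sqrtr; last exact: ltW.
by rewrite -sqrtr_sqr; congr Num.sqrt; ring.
Qed.

(** Both cases [gamma <= 1] and [gamma > 1] at once. *)
Lemma MP_atomE gamma : 0 < gamma ->
  2 * gamma * (1 - MP_atom gamma) = center gamma - `|1 - gamma|.
Proof.
move=> g0; rewrite /MP_atom /center; case: ltP => g1.
  by rewrite ltr0_norm; [field; rewrite gt_eqF|lra].
by rewrite ger0_norm; lra.
Qed.

Lemma MP_density_mass gamma : 0 < gamma ->
  (\int[mu]_x (MP_density gamma x)%:E)%E = (1 - MP_atom gamma)%:E.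
Proof.
move=> g0; pose S := semicircle (center gamma) (radius gamma).
transitivity (\int[mu]_(x in
  `[(center gamma - radius gamma)%R, (center gamma + radius gamma)%R])
    (((2 * pi * gamma)^-1)%:E * (S x / x)%:E))%E.
  rewrite [RHS]integral_mkcond MP_densityE//; apply: eq_integral => x _.
  by rewrite !patchE; case: ifP => //; rewrite EFinM.
rewrite ge0_integralZl_EFin//=.
- rewrite semicircle_resolvent_integral0 ?MP_radius_gt0 ?MP_radius_le_center//.
  rewrite MP_discriminant// -MP_atomE// -EFinM; congr EFin.
  by move: (pi : R) (pi_gt0 R) => P P0; field; rewrite !gt_eqF.
- move=> x; rewrite in_itv /= -MP_left_radius// => /andP[ax _].
  by rewrite lee_fin divr_ge0 ?sqrtr_ge0// (le_trans _ ax) ?MP_left_ge0.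
- apply/measurable_EFinP; apply: measurable_funTS; apply: measurable_funM.
    exact: measurable_semicircle.
  exact: measurable_funV.
- by rewrite invr_ge0 !mulr_ge0 ?pi_ge0 ?ltW.
Qed.

Lemma MP_density_integrable gamma : 0 < gamma ->
  mu.-integrable setT (EFin \o MP_density gamma).
Proof.
move=> g0; apply/integrableP; split.
  by apply/measurable_EFinP; exact: measurable_MP_density.
under eq_integral do rewrite /= ger0_norm ?MP_density_ge0//.
by rewrite MP_density_mass// ltry.
Qed.

(** Test functions for measures on the half-line [x >= 0]. *)
Definition halfline_bounded f :=
  measurable_fun setT f /\ exists M, forall x, 0 <= x -> `|f x| <= M.

Definition MP_mean gamma f : R :=
  \int[mu]_x (MP_density gamma x * f x) + MP_atom gamma * f 0.

Lemma MP_mean_integrable gamma f : 0 < gamma -> halfline_bounded f ->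
  mu.-integrable setT (EFin \o (fun x => MP_density gamma x * f x)).
Proof.
move=> g0 [mf [M fM]].
have di := MP_density_integrable g0.
apply: (le_integrable measurableT _ _ (integrableZl measurableT M di)).
- by apply/measurable_EFinP; apply: measurable_funM => //; exact: measurable_MP_density.
- move=> x _ /=; rewrite lee_fin normrM normrM.
  have [x0|x0] := leP 0 x; last by rewrite MP_density_lt0// normr0 mul0r mulr0.
  rewrite mulrC ler_wpM2r//; apply: le_trans (fM x x0) _.
  exact: ler_norm.
Qed.

Lemma MP_meanD gamma f g : 0 < gamma -> halfline_bounded f -> halfline_bounded g ->
  MP_mean gamma (fun x => f x + g x) = MP_mean gamma f + MP_mean gamma g.
Proof.
move=> g0 bf bg; rewrite /MP_mean; under eq_Rintegral do rewrite mulrDr.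
rewrite RintegralD//; [|exact: MP_mean_integrable..].
by rewrite mulrDr addrACA.
Qed.

Lemma MP_meanZ gamma a f : 0 < gamma -> halfline_bounded f ->
  MP_mean gamma (fun x => a * f x) = a * MP_mean gamma f.
Proof.
move=> g0 bf; rewrite /MP_mean; under eq_Rintegral do rewrite mulrCA.
rewrite RintegralZl//; last exact: MP_mean_integrable.
by rewrite mulrDr (mulrCA a).
Qed.

Lemma MP_atom_ge0 gamma : 0 <= MP_atom gamma.
Proof.
rewrite /MP_atom; case: ltP => // g1; rewrite subr_ge0 invf_le1 ?ltW//.
exact: lt_trans g1.
Qed.

Lemma MP_mean_le gamma f g : 0 < gamma -> halfline_bounded f -> halfline_bounded g ->
  (forall x, 0 <= x -> f x <= g x) -> MP_mean gamma f <= MP_mean gamma g.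
Proof.
move=> g0 bf bg fg; apply: lerD; last by rewrite ler_wpM2l ?MP_atom_ge0 ?fg.
apply: le_Rintegral; [by []|exact: MP_mean_integrable|exact: MP_mean_integrable|].
move=> x _; have [x0|x0] := leP 0 x; last by rewrite MP_density_lt0// !mul0r.
by rewrite ler_wpM2l ?MP_density_ge0 ?fg.
Qed.

Lemma MP_mean1 gamma : 0 < gamma -> MP_mean gamma (fun=> 1) = 1.
Proof.
move=> g0; rewrite /MP_mean; under eq_Rintegral do rewrite mulr1.
by rewrite /Rintegral MP_density_mass//= mulr1 subrK.
Qed.

Lemma halfline_bounded_cst a : halfline_bounded (fun=> a).
Proof. by split=> //; exists `|a|. Qed.

Lemma halfline_boundedD f g : halfline_bounded f -> halfline_bounded g ->
  halfline_bounded (fun x => f x + g x).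
Proof.
move=> [mf [M fM]] [mg [N gN]]; split; first exact: measurable_funD.
exists (M + N) => x x0; apply: le_trans (ler_normD _ _) _.
by rewrite lerD ?fM ?gN.
Qed.

Lemma halfline_boundedZ a f : halfline_bounded f -> halfline_bounded (fun x => a * f x).
Proof.
move=> [mf [M fM]]; split; first exact: measurable_funM.
by exists (`|a| * M) => x x0; rewrite normrM ler_wpM2l ?fM.
Qed.

Lemma halfline_bounded_resolvent t : 0 < t -> halfline_bounded (fun x => (x + t)^-1).
Proof.
move=> t0; split; first by apply: measurable_funV; exact: measurable_funD.
exists t^-1 => x x0; have x1 : 0 < x + t by rewrite ltr_wpDl.
by rewrite ger0_norm ?invr_ge0 ?(ltW x1)// lef_pV2 ?posrE// lerDr.
Qed.

Lemma halfline_bounded_le a : halfline_bounded (fun x => (x <= a)%R%:R).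
Proof.
split; last by exists 1 => x _; rewrite normr_nat lern1 leq_b1.
have -> : (fun x => (x <= a)%R%:R) = \1_(`]-oo, a]%classic : set R) :> (R -> R).
  by apply/funext => x; rewrite indicE mem_setE in_itv.
exact: measurable_indic.
Qed.

Lemma MP_cdf_mean gamma a : 0 < gamma ->
  MP_cdf gamma a = MP_mean gamma (fun x => (x <= a)%R%:R).
Proof.
move=> g0; rewrite /MP_cdf /MP_law /MP_mean.
rewrite integral_mkcond.
rewrite (_ : (\int[mu]_x _)%E
   = (\int[mu]_x (MP_density gamma x * (x <= a)%R%:R)%:E)%E); last first.
  apply: eq_integral => x _; rewrite patchE mem_setE in_itv /=.
  by case: (x <= a); rewrite ?mulr1 ?mulr0.
have fin := integrable_fin_num measurableT
  (MP_mean_integrable g0 (halfline_bounded_le a)).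
rewrite diracE mem_setE in_itv /= -EFinM fineD//.
Qed.

(** Partial fractions reduce the integrand [S / (x (x + t))] to the two
    semicircle integrals. *)
Lemma MP_mean_resolvent gamma t : 0 < gamma -> 0 < t ->
  MP_mean gamma (fun x => (x + t)^-1)
   = (Num.sqrt ((1 + gamma + t) ^+ 2 - 4 * gamma) - t - (1 - gamma))
      / (2 * gamma * t).
Proof.
move=> g0 t0; set D := Num.sqrt _.
have rp := MP_radius_gt0 g0; have rc := MP_radius_le_center g0.
have DE : D = Num.sqrt ((center gamma + t) ^+ 2 - radius gamma ^+ 2).
  rewrite /D /center /radius exprMn sqr_sqrtr; last exact: ltW.
  by congr (Num.sqrt (_ - _ * _)); rewrite expr2 -natrM.
have intE : (\int[mu]_x (MP_density gamma x * (x + t)^-1)%:E)%E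
  = ((2 * gamma * t)^-1 * (center gamma - `|1 - gamma| - (center gamma + t - D)))%:E.
  pose k := (2 * pi * gamma * t)^-1.
  pose S := semicircle (center gamma) (radius gamma).
  pose I := [set` `[(center gamma - radius gamma), (center gamma + radius gamma)]].
  have I0 x : I x -> 0 <= x.
    rewrite /I /= in_itv /= -MP_left_radius// => /andP[ax _].
    by rewrite (le_trans _ ax) ?MP_left_ge0.
  have mS0 : measurable_fun I (fun x => (S x / x)%:E).
    apply/measurable_EFinP; apply: measurable_funTS; apply: measurable_funM.
      exact: measurable_semicircle.
    exact: measurable_funV.
  have mSt : measurable_fun I (fun x => (S x / (x + t))%:E).
    apply/measurable_EFinP; apply: measurable_funTS; apply: measurable_funM.
      exact: measurable_semicircle.
    by apply: measurable_funV; exact: measurable_funD.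
  have i0 : mu.-integrable I (fun x => (S x / x)%:E).
    apply/integrableP; split => //.
    under eq_integral => x /set_mem /I0 x0.
      rewrite gee0_abs ?lee_fin ?divr_ge0 ?sqrtr_ge0//; over.
    by rewrite semicircle_resolvent_integral0// ltry.
  have it : mu.-integrable I (fun x => (S x / (x + t))%:E).
    apply/integrableP; split => //.
    under eq_integral => x /set_mem /I0 x0.
      have x1 : 0 <= x + t by rewrite addr_ge0// ltW.
      rewrite gee0_abs ?lee_fin ?divr_ge0 ?sqrtr_ge0//; over.
    by rewrite semicircle_resolvent_integral// ltry.
  have ib : mu.-integrable I
      ((fun x => (S x / x)%:E) \- (fun x => (S x / (x + t))%:E))%E.
    by apply: integrableB => //; exact: measurable_itv.
  transitivity (\int[mu]_(x in I) (k%:E *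
      ((fun x => (S x / x)%:E) \- (fun x => (S x / (x + t))%:E)) x))%E.
    rewrite [RHS]integral_mkcond; apply: eq_integral => x _.
    rewrite MP_densityE// !patchE -/I; case: ifPn => [/set_mem xI|_]; last by rewrite mul0r.
    rewrite /S; have x0 := I0 _ xI; rewrite -EFinB -EFinM; congr EFin.
    have [x00|xn0] := eqVneq x 0.
      have rE : radius gamma = center gamma.
        by move: xI; rewrite x00 /I /= in_itv /= => /andP[h _]; lra.
      have -> : semicircle (center gamma) (radius gamma) x = 0.
        by rewrite /semicircle x00 rE sub0r sqrrN subrr sqrtr0.
      by rewrite !(mul0r, mulr0, subrr).
    rewrite /k; move: (semicircle _ _ x) => Sx; move: (pi : R) (pi_gt0 R) => P P0; field.
    by rewrite xn0 !gt_eqF// ltr_wpDl.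
  rewrite (integralZl _ ib); last exact: measurable_itv.
  rewrite integralB//; last exact: measurable_itv.
  rewrite semicircle_resolvent_integral0//.
  rewrite semicircle_resolvent_integral// MP_discriminant// -DE -EFinB -EFinM.
  congr EFin; rewrite /k.
  by move: (pi : R) (pi_gt0 R) => P P0; field; rewrite !gt_eqF.
rewrite /MP_mean /Rintegral intE /= add0r.
have := MP_atomE g0; set at_ := MP_atom gamma; set na := `|_| => e.
have -> : at_ = 1 - (center gamma - na) / (2 * gamma).
  by rewrite -e; field; rewrite gt_eqF.
by rewrite /center; field; rewrite !gt_eqF.
Qed.

(** The limit of [n^-1 tr (Y^T Y + t)^-1]: the Stieltjes transform at [- t] of
    the companion law, that of [Y^T Y] instead of [Y Y^T]. *)
Definition MP_companion gamma t : R :=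
  (Num.sqrt ((1 + gamma + t) ^+ 2 - 4 * gamma) - t + (1 - gamma)) / (2 * t).

Lemma MP_companion_mean gamma t : 0 < gamma -> 0 < t ->
  t * MP_companion gamma t
    = 1 - gamma + gamma * (t * MP_mean gamma (fun x => (x + t)^-1)).
Proof.
move=> g0 t0; rewrite MP_mean_resolvent// /MP_companion; field.
by rewrite !gt_eqF.
Qed.

Lemma MP_companion_ge0 gamma t : 0 < gamma -> 0 < t -> 0 <= MP_companion gamma t.
Proof.
move=> g0 t0; apply: divr_ge0; last by rewrite mulr_ge0 // ltW.
set D := Num.sqrt _; have D0 : 0 <= D by exact: sqrtr_ge0.
have : `|t - (1 - gamma)| <= D.
  rewrite -sqrtr_sqr ler_wsqrtr//.
  by have := mulr_gt0 g0 t0; lra.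
by have := ler_norm (t - (1 - gamma)); lra.
Qed.

(** The Marchenko--Pastur equation. *)
Lemma MP_companion_equation gamma t : 0 < gamma -> 0 < t ->
  t * MP_companion gamma t
    = 1 - gamma + gamma * (1 + MP_companion gamma t)^-1.
Proof.
move=> g0 t0; have s0 := MP_companion_ge0 g0 t0.
have s1 : 1 + MP_companion gamma t != 0 by rewrite gt_eqF// ltr_pwDl.
apply: (mulIf s1); rewrite [RHS]mulrDl mulfVK// {s0 s1}.
rewrite /MP_companion; set D := Num.sqrt _.
have DD : D ^+ 2 = (1 + gamma + t) ^+ 2 - 4 * gamma.
  rewrite sqr_sqrtr//.
  by have := sqr_ge0 (1 - gamma); have := sqr_ge0 t; have := mulr_gt0 g0 t0; lra.
apply/eqP; rewrite -subr_eq0; apply/eqP.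
transitivity ((D ^+ 2 - ((1 + gamma + t) ^+ 2 - 4 * gamma)) / (4 * t)).
  by field; rewrite gt_eqF.
by rewrite DD subrr mul0r.
Qed.

End MarchenkoPastur.

(** * Weak convergence and resolvents *)

Section WeakConvergence.
Variable R : realType.
Local Notation mu := (@lebesgue_measure R).
Implicit Types (gamma x t : R) (f g : R -> R) (s : seq R).

Definition empirical_mean s f : R := (size s)%:R^-1 * \sum_(l <- s) f l.

Lemma empirical_mean_le s f g : (forall l, l \in s -> f l <= g l) ->
  empirical_mean s f <= empirical_mean s g.
Proof.
by move=> fg; rewrite ler_wpM2l ?invr_ge0// !big_seq; apply: ler_sum.
Qed.

Lemma empirical_meanD s f g : empirical_mean s (fun x => f x + g x)
  = empirical_mean s f + empirical_mean s g.
Proof. by rewrite /empirical_mean big_split mulrDr. Qed.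

Lemma empirical_meanZ s a f : empirical_mean s (fun x => a * f x)
  = a * empirical_mean s f.
Proof. by rewrite /empirical_mean -mulr_sumr mulrCA. Qed.

Lemma empirical_mean_cst s a : (0 < size s)%N -> empirical_mean s (fun=> a) = a.
Proof.
move=> s0; rewrite /empirical_mean big_const_seq count_predT iter_addr addr0.
by rewrite -[a *+ _]mulr_natl mulrA mulVf ?mul1r// pnatr_eq0 -lt0n.
Qed.

Lemma halfline_bounded_comb (l : seq (R * rat)) :
  all (fun ct => 0 < ct.2) l -> halfline_bounded (resolvent_comb l).
Proof.
elim: l => [_|[c q] l ih /= /andP[q0 l0]].
  have -> : resolvent_comb [::] = fun=> 0 :> R.
    by apply/funext => x; exact: resolvent_comb_nil.
  exact: halfline_bounded_cst.
have -> : resolvent_comb ((c, q) :: l)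
    = fun x => c * (x + ratr q)^-1 + resolvent_comb l x.
  by apply/funext => x; exact: resolvent_comb_cons.
apply: halfline_boundedD (ih l0); apply: halfline_boundedZ.
by apply: halfline_bounded_resolvent; rewrite ltr0q.
Qed.

Lemma MP_mean0 gamma : 0 < gamma -> MP_mean gamma (fun=> 0) = 0.
Proof.
move=> g0; have := MP_meanZ 0 g0 (halfline_bounded_cst 1).
by under eq_fun do rewrite mul0r; rewrite mul0r.
Qed.

Lemma MP_mean_cst gamma (a : R) : 0 < gamma -> MP_mean gamma (fun=> a) = a.
Proof.
move=> g0; have := MP_meanZ a g0 (halfline_bounded_cst 1).
by under eq_fun do rewrite mulr1; rewrite MP_mean1// mulr1.
Qed.

Lemma empirical_mean0 s : empirical_mean s (fun=> 0) = 0.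
Proof. by rewrite /empirical_mean big1 ?mulr0. Qed.

Lemma cvg_empirical_comb (e : nat -> seq R) gamma (l : seq (R * rat)) :
  0 < gamma ->
  (forall q : rat, 0 < q ->
    empirical_mean (e n) (fun x => (x + ratr q)^-1) @[n --> \oo]
      --> MP_mean gamma (fun x => (x + ratr q)^-1)) ->
  all (fun ct => 0 < ct.2) l ->
  empirical_mean (e n) (resolvent_comb l) @[n --> \oo]
    --> MP_mean gamma (resolvent_comb l).
Proof.
move=> gamma_gt0 h; elim: l => [_|[c q] l ih /= /andP[q0 l0]].
  have -> : resolvent_comb [::] = fun=> 0 :> R.
    by apply/funext => x; exact: resolvent_comb_nil.
  rewrite MP_mean0//; under eq_fun do rewrite empirical_mean0.
  exact: cvg_cst.
have -> : resolvent_comb ((c, q) :: l)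
    = fun x => c * (x + ratr q)^-1 + resolvent_comb l x.
  by apply/funext => x; exact: resolvent_comb_cons.
have q0' : 0 < ratr q :> R by rewrite ltr0q.
have bq := halfline_bounded_resolvent q0'.
rewrite MP_meanD//; [|exact: halfline_boundedZ|exact: halfline_bounded_comb].
rewrite MP_meanZ//; under eq_fun do rewrite empirical_meanD empirical_meanZ.
by apply: cvgD (ih l0); apply: cvgMr; exact: h.
Qed.

Lemma MP_cdf_lt0 gamma x : 0 < gamma -> x < 0 -> MP_cdf gamma x = 0.
Proof.
move=> g0 x0; rewrite MP_cdf_mean//.
have b := halfline_bounded_le x; have b0 := halfline_bounded_cst (0 : R).
have f0 y : 0 <= y -> (y <= x)%R%:R = 0 :> R.
  by move=> y0; rewrite leNgt (lt_le_trans x0 y0).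
rewrite -(MP_mean0 g0); apply/eqP; rewrite eq_le.
by rewrite !MP_mean_le// => y y0; rewrite f0.
Qed.

(** The atom is at the origin, so every point to the right of it can be used
    in weak convergence. *)
Lemma continuous_MP_cdf gamma x : 0 < gamma -> 0 < x ->
  {for x, continuous (MP_cdf gamma)}.
Proof.
move=> g0 x0; have di := MP_density_integrable g0.
pose G y := parameterized_integral mu (-1) y (MP_density gamma) + MP_atom gamma.
have GE y : 0 < y -> MP_cdf gamma y = G y.
  move=> y0; rewrite MP_cdf_mean// /G /MP_mean (ltW y0) mulr1; congr (_ + _).
  rewrite /parameterized_integral [RHS]Rintegral_mkcond; apply: eq_Rintegral => z _.
  rewrite patchE mem_setE in_itv /=; have [zy|zy] := leP z y; last first.
    by rewrite mulr0 andbF.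
  have [|z1] := leP (-1) z; first by rewrite mulr1.
  by rewrite MP_density_lt0 ?mul0r//; lra.
have Gc : {for x, continuous G}.
  have x1 : -1 < x + 1 by lra.
  have di1 : mu.-integrable [set` `[-1, x + 1]] (EFin \o MP_density gamma).
    by apply: integrableS di.
  have /(continuous_within_itvP _ x1)[Gc _ _] :=
    parameterized_integral_continuous (ltW x1) di1.
  by apply: cvgD; [apply: Gc; rewrite in_itv /=; lra|exact: cvg_cst].
rewrite /prop_for /continuous_at GE//; apply: cvg_trans Gc.
apply: near_eq_cvg; near=> y; apply/esym/GE.
by near: y; exact: lt_nbhsr.
Unshelve. all: by end_near. Qed.

Lemma empirical_mean_dist s f g (eta : R) : (0 < size s)%N ->
  (forall l, l \in s -> 0 <= l) ->
  (forall x, 0 <= x -> `|f x - g x| <= eta) ->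
  `|empirical_mean s f - empirical_mean s g| <= eta.
Proof.
move=> s0 sge fg; rewrite ler_distl.
rewrite -{1 2}(empirical_mean_cst eta s0) -mulN1r -empirical_meanZ -!empirical_meanD.
by rewrite !empirical_mean_le// => l /sge /fg; rewrite ler_distl; lra.
Qed.

Lemma MP_mean_dist gamma f g (eta : R) : 0 < gamma ->
  halfline_bounded f -> halfline_bounded g ->
  (forall x, 0 <= x -> `|f x - g x| <= eta) ->
  `|MP_mean gamma f - MP_mean gamma g| <= eta.
Proof.
move=> g0 bf bg fg; have bc (a : R) := halfline_bounded_cst a.
rewrite ler_distl; apply/andP; split.
  rewrite -[X in _ - X <= _](MP_mean_cst eta g0) lerBlDr -MP_meanD//.
  apply: MP_mean_le => //; first exact: halfline_boundedD.
  by move=> x /fg; rewrite ler_distl; lra.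
rewrite -[X in _ <= _ + X](MP_mean_cst eta g0) -MP_meanD//.
apply: MP_mean_le => //; first exact: halfline_boundedD.
by move=> x /fg; rewrite ler_distl; lra.
Qed.

Lemma cvg_empirical_uniform (e : nat -> seq R) gamma f : 0 < gamma ->
  (forall n, (0 < size (e n))%N) -> (forall n l, l \in e n -> 0 <= l) ->
  halfline_bounded f ->
  (forall eta : R, 0 < eta -> exists g, [/\ halfline_bounded g,
     forall x, 0 <= x -> `|f x - g x| <= eta &
     empirical_mean (e n) g @[n --> \oo] --> MP_mean gamma g]) ->
  empirical_mean (e n) f @[n --> \oo] --> MP_mean gamma f.
Proof.
move=> g0 e0 ege bf h; apply/cvgrPdist_le => /= eta eta0.
have eta3 : 0 < eta / 3 by rewrite divr_gt0.
have [g [bg fg /cvgrPdist_le /(_ _ eta3) gcv]] := h _ eta3.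
apply: filterS gcv => n h1.
have := empirical_mean_dist (e0 n) (@ege n) fg.
have := MP_mean_dist g0 bf bg fg.
move: h1; rewrite !ler_norml => /andP[? ?] /andP[? ?] /andP[? ?].
by apply/andP; split; lra.
Qed.

(** The indicators of [y <= x] and [y <= x'] leave room for a function that
    resolvents approximate. *)
Lemma squeeze_indicator_comb (x x' eta : R) : 0 <= x -> x < x' -> 0 < eta ->
  exists2 l : seq (R * rat), all (fun ct => 0 < ct.2) l &
    forall y, 0 <= y -> (y <= x)%R%:R <= resolvent_comb l y + eta /\
                        resolvent_comb l y <= (y <= x')%R%:R + eta.
Proof.
move=> x0 xx' eta0; have [f fs fb] := indicator_span x0 xx'.
have [l [l0 fl]] := fs _ eta0; exists l => // y y0.
have := fl _ y0; have /andP[? ?] := fb _ y0; rewrite ler_distl => /andP[? ?].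
by split; lra.
Qed.

(** Sandwich the distribution function between the means of two combinations of
    resolvents, at points at distance [d / 2] on either side of [x]. *)
Lemma weak_cvg_of_resolvents (e : nat -> seq R) gamma : 0 < gamma ->
  (forall n, (0 < size (e n))%N) -> (forall n l, l \in e n -> 0 <= l) ->
  (forall q : rat, 0 < q ->
    empirical_mean (e n) (fun x => (x + ratr q)^-1) @[n --> \oo]
      --> MP_mean gamma (fun x => (x + ratr q)^-1)) ->
  weak_cvg (fun n x => empirical_mean (e n) (fun l => (l <= x)%R%:R))
    (MP_cdf gamma).
Proof.
move=> g0 e0 ege h x Gx; pose F n x := empirical_mean (e n) (fun l => (l <= x)%R%:R).
have F_ge0 n y : 0 <= F n y.
  by rewrite /F /empirical_mean mulr_ge0 ?invr_ge0// sumr_ge0.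
have [x0|x0] := ltP x 0.
  rewrite MP_cdf_lt0//; apply: cvg_near_cst; apply: nearW => n.
  rewrite /empirical_mean big_seq big1 ?mulr0// => l /ege l0.
  by rewrite leNgt (lt_le_trans x0 l0).
have bc (a : R) := halfline_bounded_cst a.
have comb_near l eta : all (fun ct => 0 < ct.2) l -> 0 < eta ->
    \forall n \near \oo, `|MP_mean gamma (resolvent_comb l)
       - empirical_mean (e n) (resolvent_comb l)| <= eta.
  move=> l0 eta0; have /cvgrPdist_le := cvg_empirical_comb g0 h l0.
  by apply.
have upper x' eta : x < x' -> 0 < eta ->
    \forall n \near \oo, F n x <= MP_cdf gamma x' + eta.
  move=> xx' eta0; have eta3 : 0 < eta / 3 by rewrite divr_gt0.
  have [l l0 lb] := squeeze_indicator_comb x0 xx' eta3.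
  apply: filterS (comb_near _ _ l0 eta3) => n; rewrite ler_distl => /andP[h2 _].
  have bl := halfline_bounded_comb l0.
  have h1 : F n x <= empirical_mean (e n) (resolvent_comb l) + eta / 3.
    rewrite -[X in _ <= _ + X](empirical_mean_cst _ (e0 n)) -empirical_meanD.
    by apply: empirical_mean_le => y /ege /lb[].
  have h3 : MP_mean gamma (resolvent_comb l) <= MP_cdf gamma x' + eta / 3.
    have bi := halfline_bounded_le x'.
    rewrite MP_cdf_mean// -[X in _ <= _ + X](MP_mean_cst _ g0) -MP_meanD//.
    apply: MP_mean_le => //; first exact: halfline_boundedD.
    by move=> y /lb[_].
  by move: h1 h2 h3 => *; lra.
have lower x' eta : x' < x -> 0 < eta ->
    \forall n \near \oo, MP_cdf gamma x' - eta <= F n x.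
  move=> xx' eta0; have [x'0|x'0] := ltP x' 0.
    by apply: nearW => n; rewrite MP_cdf_lt0//; have := F_ge0 n x; lra.
  have eta3 : 0 < eta / 3 by rewrite divr_gt0.
  have [l l0 lb] := squeeze_indicator_comb x'0 xx' eta3.
  apply: filterS (comb_near _ _ l0 eta3) => n; rewrite ler_distl => /andP[_ h2].
  have bl := halfline_bounded_comb l0.
  have h1 : empirical_mean (e n) (resolvent_comb l) <= F n x + eta / 3.
    rewrite -[X in _ <= _ + X](empirical_mean_cst _ (e0 n)) -empirical_meanD.
    by apply: empirical_mean_le => y /ege /lb[].
  have h3 : MP_cdf gamma x' <= MP_mean gamma (resolvent_comb l) + eta / 3.
    have bi := halfline_bounded_le x'.
    rewrite MP_cdf_mean// -[X in _ <= _ + X](MP_mean_cst _ g0) -MP_meanD//.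
    apply: MP_mean_le => //; first exact: halfline_boundedD.
    by move=> y /lb[].
  by move: h1 h2 h3 => *; lra.
apply/cvgrPdist_le => /= eta eta0; have eta2 : 0 < eta / 2 by rewrite divr_gt0.
have /cvgrPdist_le /(_ _ eta2) /nbhs_ballP [d /= d0 Gd] := Gx.
have near_x y : `|x - y| < d -> `|MP_cdf gamma x - MP_cdf gamma y| <= eta / 2.
  by move=> xy; apply: Gd.
have d2 : 0 < d / 2 by rewrite divr_gt0.
have := near_x (x + d / 2); have := near_x (x - d / 2).
rewrite opprB addrC subrK opprD addrA subrr add0r normrN gtr0_norm//.
have dd : d / 2 < d by lra.
move=> /(_ dd) + /(_ dd); rewrite !ler_norml => /andP[h1 h1'] /andP[h2 h2'].
near=> n; have u : F n x <= MP_cdf gamma (x + d / 2) + eta / 2.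
  by near: n; apply: upper => //; lra.
have v : MP_cdf gamma (x - d / 2) - eta / 2 <= F n x.
  by near: n; apply: lower => //; lra.
by rewrite ler_norml; apply/andP; split; rewrite -/(F n x); lra.
Unshelve. all: by end_near. Qed.

(** Summation by parts on the grid [d, 2 d, ..., N d]. *)
Definition step_approx f (d : R) (N : nat) (y : R) : R :=
  \sum_(j < N) (f (j%:R * d) - f (j.+1%:R * d)) * (y <= j.+1%:R * d)%R%:R.

Lemma step_approx_dist f (d c : R) N y : 0 < d -> 0 <= y ->
  (forall x x', 0 <= x -> x <= x' -> x' <= x + d -> f x' <= f x <= f x' + c) ->
  if y <= N%:R * d then f y <= step_approx f d N y + f (N%:R * d) <= f y + c
  else step_approx f d N y == 0.
Proof.
move=> d0 y0 fd; have fc x : 0 <= x -> f x <= f x <= f x + c.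
  by move=> x0; apply: fd; lra.
elim: N => [|N ih].
  rewrite mul0r; case: ifPn => [y00|_]; last by rewrite /step_approx big_ord0.
  have -> : y = 0 by lra.
  by rewrite /step_approx big_ord0 add0r; exact: fc.
rewrite /step_approx big_ord_recr /= -/(step_approx f d N y).
have NS : N.+1%:R * d = N%:R * d + d by rewrite -natr1; ring.
have Nd : 0 <= N%:R * d by rewrite mulr_ge0// ltW.
case: (leP y (N.+1%:R * d)) => yS.
  case: (leP y (N%:R * d)) ih => yN; first by rewrite mulr1; lra.
  move=> /eqP ->; rewrite mulr1 add0r subrK; apply: fd => //; lra.
case: (leP y (N%:R * d)) ih => yN; first by lra.
by move=> /eqP ->; rewrite mulr0 addr0.
Qed.

(** The resolvent kernel decreases to zero, so it is a uniform limit of step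
    functions with jumps at positive points, where the limit is continuous. *)
Lemma resolvents_of_weak_cvg (e : nat -> seq R) gamma t : 0 < gamma -> 0 < t ->
  (forall n, (0 < size (e n))%N) -> (forall n l, l \in e n -> 0 <= l) ->
  weak_cvg (fun n x => empirical_mean (e n) (fun l => (l <= x)%R%:R))
    (MP_cdf gamma) ->
  empirical_mean (e n) (fun x => (x + t)^-1) @[n --> \oo]
    --> MP_mean gamma (fun x => (x + t)^-1).
Proof.
move=> g0 t0 e0 ege w; apply: cvg_empirical_uniform => //.
  exact: halfline_bounded_resolvent.
move=> eta eta0; pose f x := (x + t)^-1; pose d := eta / 2 * t ^+ 2.
have d0 : 0 < d by rewrite mulr_gt0 ?divr_gt0 ?exprn_gt0.
have [N Nd] : exists N : nat, 2 / eta <= N%:R * d.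
  exists (Num.truncn (2 / eta / d)).+1; rewrite -ler_pdivrMr//.
  exact/ltW/truncnS_gt.
have stepb M : halfline_bounded (step_approx f d M) /\
    empirical_mean (e n) (step_approx f d M) @[n --> \oo]
      --> MP_mean gamma (step_approx f d M).
  elim: M => [|M [ihb ihc]].
    have -> : step_approx f d 0 = fun=> 0.
      by apply/funext => y; rewrite /step_approx big_ord0.
    split; first exact: halfline_bounded_cst.
    by rewrite MP_mean0//; under eq_fun do rewrite empirical_mean0; exact: cvg_cst.
  have -> : step_approx f d M.+1 = fun y => step_approx f d M y
      + (f (M%:R * d) - f (M.+1%:R * d)) * (y <= M.+1%:R * d)%R%:R.
    by apply/funext => y; rewrite /step_approx big_ord_recr.
  have bi := halfline_boundedZ (f (M%:R * d) - f (M.+1%:R * d))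
    (halfline_bounded_le (M.+1%:R * d)).
  split; first exact: halfline_boundedD.
  rewrite MP_meanD// MP_meanZ//; last exact: halfline_bounded_le.
  under eq_fun do rewrite empirical_meanD empirical_meanZ.
  apply: cvgD => //; apply: cvgMr; rewrite -MP_cdf_mean//; apply: w.
  by apply: continuous_MP_cdf => //; rewrite mulr_gt0.
have [bs cs] := stepb N; exists (step_approx f d N); split => // y y0.
have fd x x' : 0 <= x -> x <= x' -> x' <= x + d ->
    f x' <= f x <= f x' + eta / 2.
  move=> x0 xx' x'd; have xt : 0 < x + t by lra.
  have x't : 0 < x' + t by lra.
  rewrite /f lef_pV2 ?posrE// lerD2r xx' /= -lerBlDl.
  have -> : (x + t)^-1 - (x' + t)^-1 = (x' - x) / ((x + t) * (x' + t)).
    by field; rewrite !gt_eqF.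
  rewrite ler_pdivrMr ?mulr_gt0//; apply: (@le_trans _ _ d); first by lra.
  apply: ler_wpM2l; first by rewrite divr_ge0// ltW.
  by rewrite expr2 ler_pM ?(ltW t0)//; lra.
have fN x : N%:R * d <= x -> 0 <= f x <= eta / 2.
  move=> Nx; have x1 : 2 / eta <= x := le_trans Nd Nx.
  have e20 : 0 < 2 / eta by rewrite divr_gt0.
  have xt : 2 / eta <= x + t by lra.
  rewrite invr_ge0 (le_trans (ltW e20) xt)/= -[leRHS]invrK invf_div lef_pV2 ?posrE//.
  exact: lt_le_trans xt.
have := step_approx_dist N d0 y0 fd; case: leP => [yN|yN].
  move=> /andP[h1 h2]; have /andP[h3 h4] := fN _ (lexx _).
  move: h1 h2 h3 h4; rewrite -[(y + t)^-1]/(f y).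
  move: (f y) (f _) (step_approx _ _ _ _) => A B C *.
  by rewrite ler_norml; apply/andP; split; lra.
move=> /eqP ->; have /andP[h3 h4] := fN _ (ltW yN).
by rewrite subr0 -/(f y) ger0_norm//; lra.
Qed.

End WeakConvergence.

(** * Bounded random variables and joint laws *)

Section BoundedExpectation.
Context d (T : measurableType d) (R : realType).
Implicit Types f g : T -> R.

Definition bounded_rv f :=
  measurable_fun setT f /\ exists M, forall w, `|f w| <= M.

Lemma bounded_rv_cst (a : R) : bounded_rv (fun=> a).
Proof. by split => //; exists `|a|. Qed.

Lemma bounded_rvD f g : bounded_rv f -> bounded_rv g ->
  bounded_rv (fun w => f w + g w).
Proof.
move=> [mf [M fM]] [mg [N gN]]; split; first exact: measurable_funD.
by exists (M + N) => w; rewrite (le_trans (ler_normD _ _))// lerD.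
Qed.

Lemma bounded_rvM f g : bounded_rv f -> bounded_rv g ->
  bounded_rv (fun w => f w * g w).
Proof.
move=> [mf [M fM]] [mg [N gN]]; split; first exact: measurable_funM.
by exists (M * N) => w; rewrite normrM ler_pM.
Qed.

Lemma bounded_rvZ a f : bounded_rv f -> bounded_rv (fun w => a * f w).
Proof. by move=> bf; exact: (bounded_rvM (bounded_rv_cst a)). Qed.

Lemma bounded_rvN f : bounded_rv f -> bounded_rv (fun w => - f w).
Proof.
move=> [mf [M fM]]; split; first exact: measurableT_comp.
by exists M => w; rewrite normrN.
Qed.

Lemma bounded_rvB f g : bounded_rv f -> bounded_rv g ->
  bounded_rv (fun w => f w - g w).
Proof. by move=> bf bg; apply: bounded_rvD => //; exact: bounded_rvN. Qed.

Lemma bounded_rv_sum (I : Type) (r : seq I) (F : I -> T -> R) :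
  (forall i, bounded_rv (F i)) -> bounded_rv (fun w => \sum_(i <- r) F i w).
Proof.
move=> bF; elim: r => [|i r ih].
  by under eq_fun do rewrite big_nil; exact: bounded_rv_cst.
by under eq_fun do rewrite big_cons; exact: bounded_rvD.
Qed.

Lemma bounded_rv_norm f : bounded_rv f -> bounded_rv (fun w => `|f w|).
Proof.
move=> [mf [M fM]]; split; first exact: measurableT_comp.
by exists M => w; rewrite normr_id.
Qed.

Lemma bounded_rv_expR f : bounded_rv f -> bounded_rv (fun w => expR (f w)).
Proof.
move=> [mf [M fM]]; split; first exact: measurableT_comp.
exists (expR M) => w; rewrite ger0_norm ?expR_ge0// ler_expR.
exact: le_trans (ler_norm _) (fM w).
Qed.

Variable P : probability T R.

Definition expect f : R := \int[P]_w f w.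

Lemma bounded_rv_integrable f : bounded_rv f -> P.-integrable setT (EFin \o f).
Proof.
move=> [mf [M fM]].
have iM := finite_measure_integrable_cst P M (@measurableT _ T).
apply: le_integrable iM => //; first exact/measurable_EFinP.
by move=> w _ /=; rewrite lee_fin (le_trans (fM w))// ler_norm.
Qed.

Lemma expect_cst a : expect (fun=> a) = a.
Proof.
rewrite /expect Rintegral_cst// -[RHS]mulr1; congr (_ * _).
exact: (congr1 fine (@probability_setT _ _ _ P)).
Qed.

Lemma expectD f g : bounded_rv f -> bounded_rv g ->
  expect (fun w => f w + g w) = expect f + expect g.
Proof.
by move=> bf bg; rewrite /expect RintegralD//; exact: bounded_rv_integrable.
Qed.

Lemma expectZ a f : bounded_rv f -> expect (fun w => a * f w) = a * expect f.
Proof. by move=> bf; rewrite /expect RintegralZl//; exact: bounded_rv_integrable. Qed.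

Lemma expectN f : bounded_rv f -> expect (fun w => - f w) = - expect f.
Proof.
move=> bf; rewrite -mulN1r -expectZ//.
by congr expect; apply/funext => w; rewrite mulN1r.
Qed.

Lemma expectB f g : bounded_rv f -> bounded_rv g ->
  expect (fun w => f w - g w) = expect f - expect g.
Proof. by move=> bf bg; rewrite expectD ?expectN//; exact: bounded_rvN. Qed.

Lemma expect_sum (I : Type) (r : seq I) (F : I -> T -> R) :
  (forall i, bounded_rv (F i)) ->
  expect (fun w => \sum_(i <- r) F i w) = \sum_(i <- r) expect (F i).
Proof.
move=> bF; elim: r => [|i r ih].
  by rewrite big_nil -[RHS](expect_cst 0); congr expect; apply/funext => w; rewrite big_nil.
rewrite big_cons -ih -expectD//; last exact: bounded_rv_sum.
by congr expect; apply/funext => w; rewrite big_cons.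
Qed.

Lemma expect_le f g : bounded_rv f -> bounded_rv g ->
  (forall w, f w <= g w) -> expect f <= expect g.
Proof. by move=> bf bg fg; apply: le_Rintegral => //; exact: bounded_rv_integrable. Qed.

Lemma expect_le_cst f a : bounded_rv f -> (forall w, f w <= a) -> expect f <= a.
Proof.
by move=> bf fa; rewrite -(expect_cst a) expect_le//; exact: bounded_rv_cst.
Qed.

Lemma expect_ge_cst f a : bounded_rv f -> (forall w, a <= f w) -> a <= expect f.
Proof.
by move=> bf fa; rewrite -(expect_cst a) expect_le//; exact: bounded_rv_cst.
Qed.

Lemma expect_norm f : bounded_rv f -> `|expect f| <= expect (fun w => `|f w|).
Proof. by move=> bf; apply: le_normr_Rintegral => //; exact: bounded_rv_integrable. Qed.

Lemma ae_eq_expect f g : bounded_rv f -> bounded_rv g ->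
  {ae P, forall w, f w = g w} -> expect f = expect g.
Proof.
move=> [mf _] [mg _] fg; rewrite /expect /Rintegral; congr fine.
apply: ae_eq_integral => //; try exact/measurable_EFinP.
by apply: filterS fg => w fgw _ /=; rewrite fgw.
Qed.

Lemma measurable_superlevel f (a : R) : measurable_fun setT f ->
  measurable [set w | a < f w].
Proof.
move=> mf; have -> : [set w | a < f w] = setT `&` f @^-1` `]a, +oo[%classic.
  by rewrite setTI; apply/seteqP; split => w /=; rewrite in_itv /= andbT.
exact: mf.
Qed.

Lemma bounded_rv_superlevel f (a : R) : measurable_fun setT f ->
  bounded_rv (\1_[set w | a < f w] : T -> R).
Proof.
move=> mf; split; first by apply: measurable_indic; exact: measurable_superlevel.
by exists 1 => w; rewrite indicE normr_nat lern1 leq_b1.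
Qed.

Lemma probability_superlevel f (a : R) : measurable_fun setT f ->
  (P [set w | (a < f w)%R] = (expect \1_[set w | (a < f w)%R])%:E)%E.
Proof.
move=> mf; have mA := measurable_superlevel a mf.
rewrite /expect /Rintegral; have -> := integral_indic P measurableT mA.
by rewrite setIT fineK// fin_num_measure.
Qed.

Lemma markov_bounded f eps : 0 < eps -> bounded_rv f -> (forall w, 0 <= f w) ->
  (P [set w | (eps < f w)%R] <= (expect f / eps)%:E)%E.
Proof.
move=> e0 bf f0; have [mf _] := bf; have b1 := bounded_rv_superlevel eps mf.
rewrite probability_superlevel// lee_fin ler_pdivlMr// mulrC -(expectZ eps b1).
apply: expect_le => //; first exact: bounded_rvZ.
move=> w; rewrite indicE; have [/set_mem /= fw|_] := boolP (w \in _).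
  by rewrite mulr1 ltW.
by rewrite mulr0.
Qed.

End BoundedExpectation.

Section JointLaw.
Variables (E : finType) (R : realType).

Definition rectangles : set (set (E -> R)) :=
  [set A | exists B : E -> set R, (forall e, measurable (B e)) /\
     A = [set x | forall e, B e (x e)]].

(** Samples of a finite family of real random variables, with the product
    sigma-algebra. *)
Definition config := g_sigma_algebraType rectangles.

Lemma measurable_coord (e : E) : measurable_fun setT (fun x : config => x e).
Proof.
move=> _ B mB; rewrite setTI; apply: sub_sigma_algebra.
exists (fun e' => if e' == e then B else setT); split.
  by move=> e'; case: ifP.
apply/seteqP; split => x /=; last by move=> /(_ e); rewrite eqxx.
by move=> Bx e'; case: ifPn => // /eqP ->.
Qed.

Lemma measurable_config d (T : measurableType d) (Z : T -> config) :
  (forall e, measurable_fun setT (fun w => Z w e)) -> measurable_fun setT Z.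
Proof.
move=> mZ; apply: (@measurability _ _ T config setT Z rectangles (erefl _)).
move=> _ [A [B [mB ->]] <-]; rewrite setTI.
have -> : Z @^-1` [set x | forall e, B e (x e)]
    = \bigcap_(e in [set: E]) ((fun w => Z w e) @^-1` B e).
  by apply/seteqP; split => w /= h e => [_|]; exact: h.
apply: fin_bigcap_measurable => // e _.
by rewrite -[X in measurable X]setTI; exact: mZ.
Qed.

Lemma rectangles_setI : setI_closed rectangles.
Proof.
move=> _ _ [A [mA ->]] [B [mB ->]]; exists (fun e => A e `&` B e); split.
  by move=> e; exact: measurableI.
apply/seteqP; split => x /=; first by move=> [a b] e; split.
by move=> ab; split => e; have [] := ab e.
Qed.

(** Rectangles form a pi-system that generates the product sigma-algebra, so
    they determine the joint law. *)
Lemma eq_expect_of_rectangles d1 d2 (T1 : measurableType d1)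
    (T2 : measurableType d2) (P1 : probability T1 R) (P2 : probability T2 R)
    (Z1 : T1 -> config) (Z2 : T2 -> config) (F : config -> R) :
  measurable_fun setT Z1 -> measurable_fun setT Z2 ->
  (forall B : E -> set R, (forall e, measurable (B e)) ->
     P1 [set w | forall e, B e (Z1 w e)] = P2 [set w | forall e, B e (Z2 w e)]) ->
  bounded_rv F ->
  expect P1 (fun w => F (Z1 w)) = expect P2 (fun w => F (Z2 w)).
Proof.
move=> mZ1 mZ2 ZZ bF; have [mF [M FM]] := bF.
pose f1 : {RV P1 >-> config} := HB.pack Z1 (isMeasurableFun.Build _ _ _ _ _ mZ1).
pose f2 : {RV P2 >-> config} := HB.pack Z2 (isMeasurableFun.Build _ _ _ _ _ mZ2).
have law A : measurable A -> distribution P1 f1 A = distribution P2 f2 A.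
  move=> mA; apply: (@measure_unique _ R config rectangles (fun=> setT) erefl
    rectangles_setI _ _ (distribution P1 f1) (distribution P2 f2)) => //.
  - by move=> _; exists (fun=> setT); split => //; apply/seteqP; split.
  - by apply/seteqP; split => // x _; exists 0%N.
  - by move=> _ [B [mB ->]]; exact: ZZ.
  - move=> k; apply: (@le_lt_trans _ _ (1%E : \bar R)); last exact: ltry.
    exact: (@probability_le1 _ _ _ (distribution P1 f1)).
have mFE : measurable_fun setT (EFin \o F) by exact/measurable_EFinP.
have bFZ dd (TT : measurableType dd) (Z : TT -> config) :
    measurable_fun setT Z -> bounded_rv (fun w => F (Z w)).
  move=> mZ; split; first exact: (measurableT_comp mF mZ).
  by exists M => w; exact: FM.
have i1 : P1.-integrable setT ((EFin \o F) \o f1).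
  by apply: bounded_rv_integrable; exact: bFZ.
have i2 : P2.-integrable setT ((EFin \o F) \o f2).
  by apply: bounded_rv_integrable; exact: bFZ.
rewrite /expect /Rintegral; congr fine.
have <- := integral_distribution mFE i1; have <- := integral_distribution mFE i2.
by apply: eq_measure_integral => A mA _; exact: law.
Qed.

End JointLaw.

(** * Independence and concentration *)

Section ProductExpectation.
Context d1 d2 (T1 : measurableType d1) (T2 : measurableType d2) (R : realType).
Variables (P1 : probability T1 R) (P2 : probability T2 R).

Lemma expect_fubini (h : T1 * T2 -> R) : bounded_rv h ->
  bounded_rv (fun x => expect P2 (fun y => h (x, y))) /\
  expect (P1 \x P2)%E h = expect P1 (fun x => expect P2 (fun y => h (x, y))).
Proof.
move=> bh; have ih := bounded_rv_integrable (P1 \x P2)%E bh.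
have [mh [M hM]] := bh.
have bs x : bounded_rv (fun y => h (x, y)).
  split; last by exists M.
  exact: (measurableT_comp mh (measurable_pair1 x)).
have finE x : fubini_F P2 (EFin \o h) x = (expect P2 (fun y => h (x, y)))%:E.
  rewrite /fubini_F /expect /Rintegral fineK//.
  exact: integrable_fin_num (bounded_rv_integrable P2 (bs x)).
split; last first.
  rewrite {1}/expect /Rintegral -(integral12_prod_meas1 ih).
  by congr fine; apply: eq_integral => x _; exact: finE.
split.
  apply/measurable_EFinP; have := measurable_fubini_F ih.
  by congr measurable_fun; apply/funext => x; exact: finE.
exists M => x; rewrite ler_norml; apply/andP; split.
  apply: expect_ge_cst => // y; have := hM (x, y).
  by rewrite ler_norml => /andP[].
apply: expect_le_cst => // y; have := hM (x, y).
by rewrite ler_norml => /andP[].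
Qed.

End ProductExpectation.

Section Independence.
Context d (T : measurableType d) (R : realType) (P : probability T R).
Variables (E : finType) (X : E -> {RV P >-> R}).
Implicit Types (J : {set E}) (x y : config E R) (F G : config E R -> R).

Definition sample (w : T) : config E R := fun e => X e w.

Definition mix J x y : config E R := fun e => if e \in J then x e else y e.

Lemma measurable_sample : measurable_fun setT sample.
Proof. by apply: measurable_config => e; exact: measurable_funPT. Qed.

Lemma measurable_mix d' (T' : measurableType d') J (Z1 Z2 : T' -> config E R) :
  measurable_fun setT Z1 -> measurable_fun setT Z2 ->
  measurable_fun setT (fun w => mix J (Z1 w) (Z2 w)).
Proof.
move=> m1 m2; apply: measurable_config => e; rewrite /mix; case: (e \in J).
  exact: (measurableT_comp (measurable_coord e) m1).
exact: (measurableT_comp (measurable_coord e) m2).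
Qed.

Lemma bounded_rv_comp d' (T' : measurableType d') (Z : T' -> config E R) F :
  measurable_fun setT Z -> bounded_rv F -> bounded_rv (fun w => F (Z w)).
Proof.
move=> mZ [mF [M FM]]; split; last by exists M.
exact: (measurableT_comp mF mZ).
Qed.

Hypothesis X_indep : mutually_independent X.

Lemma probability_rectangle J (B : E -> set R) : (forall e, measurable (B e)) ->
  P [set w | forall e, e \in J -> B e (X e w)]
    = (\prod_(e in J) P (X e @^-1` B e))%E.
Proof.
by move=> mB; rewrite -X_indep.
Qed.

Lemma measurable_rectangle J (B : E -> set R) : (forall e, measurable (B e)) ->
  measurable [set w | forall e, e \in J -> B e (X e w)].
Proof.
move=> mB; have -> : [set w | forall e, e \in J -> B e (X e w)]
    = \bigcap_(e in [set` J]) (X e @^-1` B e).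
  by apply/seteqP; split => w /= h e eJ; exact: h.
apply: fin_bigcap_measurable => // e _.
by rewrite -[X in measurable X]setTI; exact: measurable_funPT.
Qed.

(** Under independence both sides integrate the same product law, and it is
    enough to compare them on rectangles. *)
Lemma expect_resample J F : bounded_rv F ->
  expect P (fun w => F (sample w))
    = expect P (fun w' => expect P (fun w => F (mix J (sample w') (sample w)))).
Proof.
move=> bF; pose Z (z : T * T) := mix J (sample z.1) (sample z.2).
have mZ : measurable_fun setT Z.
  apply: measurable_mix.
    exact: (measurableT_comp measurable_sample measurable_fst).
  exact: (measurableT_comp measurable_sample measurable_snd).
have [_ <-] := expect_fubini P P (bounded_rv_comp mZ bF).
apply: eq_expect_of_rectangles => // [|B mB]; first exact: measurable_sample.
transitivity (P [set w | forall e, e \in [set: E]%SET -> B e (X e w)]).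
  by congr (P _); apply/seteqP; split => w /= h e;
    [move=> _; exact: h|by apply: h; rewrite inE].
transitivity ((P \x P)%E ([set w | forall e, e \in J -> B e (X e w)]
    `*` [set w | forall e, e \in ~: J -> B e (X e w)])).
  transitivity (P [set w | forall e, e \in J -> B e (X e w)] *
      P [set w | forall e, e \in ~: J -> B e (X e w)])%E; last first.
    by apply/esym/product_measure1E; exact: measurable_rectangle.
  rewrite (probability_rectangle [set: E]%SET mB) (probability_rectangle J mB).
  rewrite (probability_rectangle (~: J) mB) (bigID (mem J)) /=.
  by congr (_ * _)%E; apply: eq_bigl => e; rewrite !inE.
congr ((P \x P)%E _); apply/seteqP; split => -[w1 w2] /=.
  move=> [h1 h2] e; rewrite /Z /mix /=; have [eJ|eJ] := boolP (e \in J).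
    exact: h1.
  by apply: h2; rewrite inE.
move=> h; split => e eJ; have := h e; rewrite /Z /mix /= ?eJ//.
by rewrite inE in eJ; rewrite (negbTE eJ).
Qed.

Lemma bounded_rv_resample J F : bounded_rv F ->
  bounded_rv (fun w' => expect P (fun w => F (mix J (sample w') (sample w)))).
Proof.
move=> bF; pose Z (z : T * T) := mix J (sample z.1) (sample z.2).
have mZ : measurable_fun setT Z.
  apply: measurable_mix.
    exact: (measurableT_comp measurable_sample measurable_fst).
  exact: (measurableT_comp measurable_sample measurable_snd).
by have [] := expect_fubini P P (bounded_rv_comp mZ bF).
Qed.

Lemma expect_indep_mul J F G : bounded_rv F -> bounded_rv G ->
  (forall x y, {in J, x =1 y} -> F x = F y) ->
  (forall x y, {in ~: J, x =1 y} -> G x = G y) ->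
  expect P (fun w => F (sample w) * G (sample w))
    = expect P (fun w => F (sample w)) * expect P (fun w => G (sample w)).
Proof.
move=> bF bG FJ GJ.
have bFs := bounded_rv_comp measurable_sample bF.
have bGs := bounded_rv_comp measurable_sample bG.
rewrite (expect_resample J (bounded_rvM bF bG)) [RHS]mulrC -expectZ//.
congr expect; apply/funext => w'; rewrite [RHS]mulrC -expectZ//.
congr expect; apply/funext => w; congr (_ * _).
  by apply: FJ => e eJ; rewrite /mix eJ.
by apply: GJ => e; rewrite inE /mix => /negbTE ->.
Qed.

(** Exchangeability of a family of independent identically distributed
    variables. *)
Lemma expect_permute (s s' : E -> E) (xi : {RV P >-> R}) F :
  cancel s s' -> cancel s' s -> bounded_rv F ->
  (forall e, identically_distributed (X e) xi) ->
  expect P (fun w => F (sample w)) = expect P (fun w => F (fun e => X (s e) w)).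
Proof.
move=> ss' s's bF X_id; apply: eq_expect_of_rectangles => //.
- exact: measurable_sample.
- by apply: measurable_config => e; exact: measurable_funPT.
move=> B mB.
have idE e A : measurable A -> P (X e @^-1` A) = P (xi @^-1` A).
  by move=> mA; exact: X_id.
transitivity (\prod_(e : E) P (xi @^-1` B e))%E.
  transitivity (P [set w | forall e, e \in [set: E]%SET -> B e (X e w)]).
    by congr (P _); apply/seteqP; split => w /= h e;
    [move=> _; exact: h|by apply: h; rewrite inE].
  rewrite probability_rectangle//; apply: eq_big => e; first by rewrite inE.
  by move=> _; exact: idE.
transitivity (P [set w | forall e, e \in [set: E]%SET -> B (s' e) (X e w)]).
  rewrite (@probability_rectangle _ (fun e => B (s' e)))//.
  rewrite (reindex s') /=; last first.
    by exists s => e _; [exact: s's|exact: ss'].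
  by apply: eq_big => e; [rewrite inE|move=> _; rewrite idE].
congr (P _); apply/seteqP; split => w /= h e.
  by have := h (s e) (finset.in_setT _); rewrite ss'.
by move=> _; have := h (s' e); rewrite s's.
Qed.

End Independence.

Section Concentration.
Context d (T : measurableType d) (R : realType) (P : probability T R).

Lemma expR_le_quadratic (x : R) : x <= 2^-1 -> expR x <= 1 + x + 2 * x ^+ 2.
Proof.
move=> x2; have e1 : 0 < 1 - x by lra.
have h : expR x <= (1 - x)^-1.
  rewrite -[expR x]invrK lef_pV2 ?posrE ?invr_gt0 ?expR_gt0// -expRN.
  exact: expR_ge1Dx.
apply: le_trans h _; rewrite -[leLHS]mul1r ler_pdivrMr//.
have x2' : 0 <= 1 - 2 * x by lra.
by have := mulr_ge0 (sqr_ge0 x) x2'; lra.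
Qed.

(** [exp x <= 1 + x + 2 x^2] kills the first-order term. *)
Lemma expect_expR_centered (f : T -> R) (c : R) : bounded_rv f ->
  expect P f = 0 -> (forall w, `|f w| <= c) -> c <= 2^-1 ->
  expect P (fun w => expR (f w)) <= expR (2 * c ^+ 2).
Proof.
move=> bf f0 fc c2; apply: le_trans (expR_ge1Dx _).
have b1 := bounded_rvD bf (bounded_rv_cst T (1 + 2 * c ^+ 2)).
have -> : 1 + 2 * c ^+ 2 = expect P (fun w => f w + (1 + 2 * c ^+ 2)).
  by rewrite expectD ?expect_cst ?f0 ?add0r//; exact: bounded_rv_cst.
apply: expect_le => // [|w]; first exact: bounded_rv_expR.
have fw : f w <= 2^-1 := le_trans (ler_norm _) (le_trans (fc w) c2).
apply: le_trans (expR_le_quadratic fw) _.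
have : f w ^+ 2 <= c ^+ 2.
  by rewrite -(real_normK (num_real (f w))) lerXn2r ?nnegrE// (le_trans _ (fc w)).
lra.
Qed.

Variables (E : finType) (X : E -> {RV P >-> R}).
Variables (q : nat) (row_of : E -> 'I_q).
Implicit Types (x y : config E R) (f : config E R -> R).

(** The coordinates are grouped in [q] rows, revealed one after the other. *)
Definition rows_below (k : nat) : {set E} := [set e | (row_of e < k)%N]%SET.

(** The conditional expectation of [f] given the first [k] rows, computed by
    integrating over an independent copy of the others. *)
Definition partial_mean f (k : nat) (x : config E R) : R :=
  expect P (fun w => f (mix (rows_below k) x (sample X w))).

Lemma measurable_mix_cst J x : measurable_fun setT (fun y => mix J x y).
Proof. by apply: measurable_mix => //; exact: measurable_id. Qed.

(** Induction on the number [j] of rows that are still random: the row [k] is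
    resampled first, and the increment of the partial mean is centered and
    bounded by [c]. *)
Lemma expect_expR_partial_mean f (c lam : R) : mutually_independent X ->
  bounded_rv f -> 0 <= lam -> lam * c <= 2^-1 ->
  (forall i x y, (forall e, row_of e != i -> x e = y e) -> `|f x - f y| <= c) ->
  forall j k x, (k + j = q)%N ->
  expect P (fun w =>
      expR (lam * (f (mix (rows_below k) x (sample X w)) - partial_mean f k x)))
    <= expR (2 * (lam * c) ^+ 2) ^+ j.
Proof.
move=> X_indep bf lam0 lc fd.
have bfm k x : bounded_rv (fun y => f (mix (rows_below k) x y)).
  by apply: bounded_rv_comp bf; exact: measurable_mix_cst.
have bfs k x : bounded_rv (fun w => f (mix (rows_below k) x (sample X w))).
  exact: (bounded_rv_comp (measurable_sample X) (bfm k x)).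
elim=> [|j ih] k x kj.
  rewrite expr0; apply: expect_le_cst => [|w].
    apply/bounded_rv_expR/bounded_rvZ/bounded_rvB => //; exact: bounded_rv_cst.
  have e w' : mix (rows_below k) x (sample X w') = x.
    apply/funext => e; rewrite /mix inE.
    by rewrite addn0 in kj; rewrite kj ltn_ord.
  rewrite /partial_mean; under eq_fun do rewrite e.
  by rewrite expect_cst e subrr mulr0 expR0.
have kq : (k < q)%N by rewrite -kj addnS ltnS leq_addr.
pose M w' := mix (rows_below k) x (sample X w').
have mixE w' w : mix (rows_below k) x (mix (rows_below k.+1) (sample X w') (sample X w))
    = mix (rows_below k.+1) (M w') (sample X w).
  apply/funext => e; rewrite /M /mix !inE ltnS.
  by case: ltngtP => // ke; rewrite ?(ltnW ke).
have mean_step : partial_mean f k x = expect P (fun w' => partial_mean f k.+1 (M w')).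
  rewrite {1}/partial_mean (expect_resample X_indep (rows_below k.+1) (bfm k x)).
  by congr expect; apply/funext => w'; congr expect; apply/funext => w; rewrite mixE.
pose phi w' := lam * (partial_mean f k.+1 (M w') - partial_mean f k x).
have bpm : bounded_rv (fun w' => partial_mean f k.+1 (M w')).
  have := bounded_rv_resample X (rows_below k.+1) (bfm k x).
  by congr bounded_rv; apply/funext => w'; congr expect; apply/funext => w; rewrite mixE.
have bphi : bounded_rv phi.
  by apply/bounded_rvZ/bounded_rvB => //; exact: bounded_rv_cst.
have phi0 : expect P phi = 0.
  rewrite expectZ; last by apply/bounded_rvB => //; exact: bounded_rv_cst.
  rewrite expectB//; last exact: bounded_rv_cst.
  by rewrite expect_cst -mean_step subrr mulr0.
have pm_dist w1 w2 :
    `|partial_mean f k.+1 (M w1) - partial_mean f k.+1 (M w2)| <= c.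
  have bd := bounded_rvB (bfs k.+1 (M w1)) (bfs k.+1 (M w2)).
  rewrite -expectB//; apply: le_trans (expect_norm _ bd) _.
  apply: expect_le_cst => [|w]; first exact: bounded_rv_norm.
  apply: (fd (Ordinal kq)) => e ek; rewrite /M /mix !inE ltnS.
  by case: ltngtP => // ke; case/eqP: ek; exact: val_inj.
have phic w' : `|phi w'| <= lam * c.
  rewrite normrM ger0_norm// ler_wpM2l// mean_step.
  rewrite -(expect_cst P (partial_mean f k.+1 (M w'))) -expectB//; last exact: bounded_rv_cst.
  have bd : bounded_rv (fun w => partial_mean f k.+1 (M w') - partial_mean f k.+1 (M w)).
    by apply: bounded_rvB => //; exact: bounded_rv_cst.
  apply: le_trans (expect_norm _ bd) _.
  by apply: expect_le_cst => [|w]; [exact: bounded_rv_norm|exact: pm_dist].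
pose F y := expR (lam * (f (mix (rows_below k) x y) - partial_mean f k x)).
have bF : bounded_rv F.
  by apply/bounded_rv_expR/bounded_rvZ/bounded_rvB => //; exact: bounded_rv_cst.
rewrite -[leLHS]/(expect P (fun w => F (sample X w))).
rewrite (expect_resample X_indep (rows_below k.+1) bF) exprS.
have c0 : 0 <= expR (2 * (lam * c) ^+ 2) ^+ j by rewrite exprn_ge0// expR_ge0.
have step w' : expect P (fun w => F (mix (rows_below k.+1) (sample X w') (sample X w)))
    <= expR (2 * (lam * c) ^+ 2) ^+ j * expR (phi w').
  have -> : (fun w => F (mix (rows_below k.+1) (sample X w') (sample X w)))
     = (fun w => expR (phi w') * expR (lam *
         (f (mix (rows_below k.+1) (M w') (sample X w)) - partial_mean f k.+1 (M w')))).
    apply/funext => w; rewrite /F mixE /phi -expRD; congr expR; ring.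
  rewrite expectZ; last first.
    by apply/bounded_rv_expR/bounded_rvZ/bounded_rvB => //; exact: bounded_rv_cst.
  rewrite mulrC ler_wpM2r ?expR_ge0// ih//.
  by rewrite addSnnS.
have be := bounded_rv_expR bphi.
apply: le_trans (expect_le P (bounded_rv_resample X _ bF) (bounded_rvZ _ be) step) _.
rewrite expectZ; last exact: bounded_rv_expR.
rewrite mulrC ler_wpM2r//.
exact: expect_expR_centered.
Qed.

(** Chernoff's bound for [f] and for [- f]; [lam] is left free. *)
Lemma bounded_difference_tail f (c lam eps : R) : mutually_independent X ->
  bounded_rv f -> 0 < lam -> lam * c <= 2^-1 ->
  (forall i x y, (forall e, row_of e != i -> x e = y e) -> `|f x - f y| <= c) ->
  (P [set w | (eps < `|f (sample X w) - expect P (fun w => f (sample X w))|)%R]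
    <= (2 * expR (2 * q%:R * (lam * c) ^+ 2 - lam * eps))%:E)%E.
Proof.
move=> X_indep bf lam0 lc fd; pose m g := expect P (fun w => g (sample X w)).
have mgf g : bounded_rv g ->
    (forall i x y, (forall e, row_of e != i -> x e = y e) -> `|g x - g y| <= c) ->
    expect P (fun w => expR (lam * (g (sample X w) - m g)))
      <= expR (2 * q%:R * (lam * c) ^+ 2).
  move=> bg gd; pose x0 : config E R := fun=> 0.
  have mix0 w : mix (rows_below 0) x0 (sample X w) = sample X w.
    by apply/funext => e; rewrite /mix inE ltn0.
  have := expect_expR_partial_mean X_indep bg (ltW lam0) lc gd x0 (add0n q).
  have -> : partial_mean g 0 x0 = m g.
    by congr expect; apply/funext => w; rewrite mix0.
  under eq_fun do rewrite mix0.
  by rewrite -expRM_natl mulrA [2 * _]mulrC -mulrA.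
have one_sided g : bounded_rv g ->
    (forall i x y, (forall e, row_of e != i -> x e = y e) -> `|g x - g y| <= c) ->
    (P [set w | (expR (lam * eps) < expR (lam * (g (sample X w) - m g)))%R]
      <= (expR (2 * q%:R * (lam * c) ^+ 2 - lam * eps))%:E)%E.
  move=> bg gd; have bgs := bounded_rv_comp (measurable_sample X) bg.
  have be : bounded_rv (fun w => expR (lam * (g (sample X w) - m g))).
    by apply/bounded_rv_expR/bounded_rvZ/bounded_rvB => //; exact: bounded_rv_cst.
  apply: le_trans (markov_bounded _ (expR_gt0 _) be _) _ => [w|].
    exact: expR_ge0.
  by rewrite lee_fin expRB ler_wpM2r ?invr_ge0 ?expR_ge0// mgf.
have fNd i x y : (forall e, row_of e != i -> x e = y e) -> `|- f x - - f y| <= c.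
  by move=> /fd; rewrite -opprD normrN.
have mN : m (fun x => - f x) = - m f.
  by rewrite /m expectN//; exact: (bounded_rv_comp (measurable_sample X) bf).
have bfs := bounded_rv_comp (measurable_sample X) bf.
have mes g : bounded_rv g ->
    measurable [set w | expR (lam * eps) < expR (lam * (g (sample X w) - m g))].
  move=> bg; have bgs := bounded_rv_comp (measurable_sample X) bg.
  apply: measurable_superlevel.
  have [] : bounded_rv (fun w => expR (lam * (g (sample X w) - m g))) => //.
  by apply/bounded_rv_expR/bounded_rvZ/bounded_rvB => //; exact: bounded_rv_cst.
have -> : [set w | eps < `|f (sample X w) - m f|]
    = [set w | expR (lam * eps) < expR (lam * (f (sample X w) - m f))]
     `|` [set w | expR (lam * eps) < expR (lam * (- f (sample X w) - m (fun x => - f x)))].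
  apply/seteqP; split => w /=; rewrite mN -opprD !ltr_expR !(ltr_pM2l lam0) ltr_normr.
    by move=> /orP[]; [left|right].
  by move=> [->//|->]; rewrite orbT.
apply: le_trans (measureU2 P (mes _ bf) (mes _ (bounded_rvN bf))) _.
apply: le_trans (leeD (one_sided _ bf fd) (one_sided _ (bounded_rvN bf) fNd)) _.
by rewrite -EFinD lee_fin; lra.
Qed.

End Concentration.

(** * The random matrices and the statistic W *)

(** A class of functions closed under the field operations contains the entries
    of every matrix computed from such functions. *)
Section MatrixClosure.
Variables (T : Type) (K : fieldType) (M : (T -> K) -> Prop).
Hypothesis M_cst : forall a, M (fun=> a).
Hypothesis M_add : forall f g, M f -> M g -> M (fun w => f w + g w).
Hypothesis M_mul : forall f g, M f -> M g -> M (fun w => f w * g w).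
Hypothesis M_inv : forall f, M f -> M (fun w => (f w)^-1).

Definition entrywise m n (A : T -> 'M[K]_(m, n)) : Prop :=
  forall i j, M (fun w => A w i j).

Lemma M_sum (I : Type) (r : seq I) (F : I -> T -> K) :
  (forall i, M (F i)) -> M (fun w => \sum_(i <- r) F i w).
Proof.
move=> mF; elim: r => [|i r ih].
  by under eq_fun do rewrite big_nil; exact: M_cst.
by under eq_fun do rewrite big_cons; exact: M_add.
Qed.

Lemma M_prod (I : Type) (r : seq I) (F : I -> T -> K) :
  (forall i, M (F i)) -> M (fun w => \prod_(i <- r) F i w).
Proof.
move=> mF; elim: r => [|i r ih].
  by under eq_fun do rewrite big_nil; exact: M_cst.
by under eq_fun do rewrite big_cons; exact: M_mul.
Qed.

Lemma entrywise_cst m n (A : 'M[K]_(m, n)) : entrywise (fun=> A).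
Proof. by move=> i j; exact: M_cst. Qed.

Lemma entrywiseD m n (A B : T -> 'M[K]_(m, n)) : entrywise A -> entrywise B ->
  entrywise (fun w => A w + B w).
Proof.
by move=> mA mB i j; under eq_fun do rewrite mxE; exact: M_add.
Qed.

Lemma entrywise_tr m n (A : T -> 'M[K]_(m, n)) : entrywise A ->
  entrywise (fun w => (A w)^T).
Proof. by move=> mA i j; under eq_fun do rewrite mxE; exact: mA. Qed.

Lemma entrywiseM m n q (A : T -> 'M[K]_(m, n)) (B : T -> 'M[K]_(n, q)) :
  entrywise A -> entrywise B -> entrywise (fun w => A w *m B w).
Proof.
move=> mA mB i j; under eq_fun do rewrite mxE.
by apply: M_sum => k; exact: M_mul.
Qed.

Lemma entrywise_det n (A : T -> 'M[K]_n) : entrywise A -> M (fun w => \det (A w)).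
Proof.
move=> mA; apply: M_sum => s; apply: M_mul; first exact: M_cst.
by apply: M_prod => i; exact: mA.
Qed.

Lemma entrywise_trace n (A : T -> 'M[K]_n) : entrywise A -> M (fun w => \tr (A w)).
Proof. by move=> mA; apply: M_sum => i; exact: mA. Qed.

Lemma entrywise_inv n (A : T -> 'M[K]_n) : (forall w, A w \in unitmx) ->
  entrywise A -> entrywise (fun w => invmx (A w)).
Proof.
move=> uA mA i j.
have -> : (fun w => invmx (A w) i j) = (fun w => (\det (A w))^-1 * \adj (A w) i j).
  by apply/funext => w; rewrite /invmx uA mxE.
apply: M_mul; first exact/M_inv/entrywise_det.
under eq_fun do rewrite mxE; apply: M_mul; first exact: M_cst.
by apply: entrywise_det => k l; under eq_fun do rewrite !mxE; exact: mA.
Qed.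

End MatrixClosure.

Section NormalizedRows.
Variables (R : realType) (p n : nat).
Local Notation config := (config ('I_p * 'I_n)%type R).
Local Notation mfun := (fun f : config -> R => measurable_fun setT f).
Implicit Types (x : config) (t : R).

Definition normalized x : 'M[R]_(p, n) := normalize_rows (\matrix_(i, j) x (i, j)).

Lemma measurable_normalized : entrywise mfun normalized.
Proof.
move=> i j.
have -> : (fun x => normalized x i j)
    = (fun x => x (i, j) / Num.sqrt (\sum_(k < n) x (i, k) ^+ 2)).
  apply/funext => x; rewrite !mxE; congr (_ / Num.sqrt _).
  by apply: eq_bigr => k _; rewrite mxE.
apply: measurable_funM; first exact: measurable_coord.
apply: measurable_funV.
apply: (@measurableT_comp _ _ _ _ _ _ (@Num.sqrt R)).
  by apply: continuous_measurable_fun; exact: sqrt_continuous.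
apply: measurable_sum => k.
by apply: measurable_funX; exact: measurable_coord.
Qed.

Lemma mfun_add (f g : config -> R) : mfun f -> mfun g -> mfun (fun x => f x + g x).
Proof. by move=> mf mg; exact: (measurable_funD mf mg). Qed.

Lemma mfun_mul (f g : config -> R) : mfun f -> mfun g -> mfun (fun x => f x * g x).
Proof. by move=> mf mg; exact: (measurable_funM mf mg). Qed.

Lemma mfun_inv (f : config -> R) : mfun f -> mfun (fun x => (f x)^-1).
Proof. by move=> mf; exact: (measurable_funV mf). Qed.

Lemma mfun_cst (a : R) : mfun (fun=> a).
Proof. exact: measurable_cst. Qed.

Lemma measurable_gram_resolvent q (Y : config -> 'M[R]_(q, n)) t : 0 < t ->
  entrywise mfun Y -> entrywise mfun (fun x => gram_resolvent (Y x) t).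
Proof.
move=> t0 mY.
apply: (entrywise_inv mfun_cst mfun_add mfun_mul mfun_inv) => [x|].
  exact: gram_unit.
apply: (entrywiseD mfun_add); last exact: (entrywise_cst mfun_cst).
apply: (entrywiseM mfun_cst mfun_add mfun_mul) => //.
exact: entrywise_tr.
Qed.

Lemma measurable_zero_row i : entrywise mfun (fun x => zero_row i (normalized x)).
Proof.
move=> k j.
have -> : (fun x => zero_row i (normalized x) k j)
    = (fun x => if k == i then 0 else normalized x k j).
  by apply/funext => x; rewrite mxE.
by case: (k == i); [exact: mfun_cst|exact: measurable_normalized].
Qed.

Lemma sqnorm_row_normalized x i : sqnorm (row i (normalized x))
  = (\sum_(j < n) x (i, j) ^+ 2) / (\sum_(j < n) x (i, j) ^+ 2).
Proof.
rewrite /sqnorm mulr_suml; apply: eq_bigr => j _; rewrite !mxE expr_div_n.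
rewrite sqr_sqrtr; last by apply: sumr_ge0 => k _; exact: sqr_ge0.
by congr (_ / _); apply: eq_bigr => k _; rewrite mxE.
Qed.

(** Only an inequality, because a vanishing row stays zero. *)
Lemma sqnorm_row_normalized_le1 x i : sqnorm (row i (normalized x)) <= 1.
Proof.
rewrite sqnorm_row_normalized; set s := \sum_(j < n) _.
by have [->|sn0] := eqVneq s 0; [rewrite mul0r|rewrite divff].
Qed.

Lemma sqnorm_row_normalized_eq1 x i : \sum_(j < n) x (i, j) ^+ 2 != 0 ->
  sqnorm (row i (normalized x)) = 1.
Proof. by move=> sn0; rewrite sqnorm_row_normalized divff. Qed.

Lemma measurable_row i : entrywise mfun (fun x => row i (normalized x)).
Proof.
move=> k j; have -> : (fun x => row i (normalized x) k j)
    = (fun x => normalized x i j) by apply/funext => x; rewrite mxE.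
exact: measurable_normalized.
Qed.

Lemma loo_quad_bound x t i : 0 < t -> 0 <= loo_quad (normalized x) t i <= t^-1.
Proof.
move=> t0; rewrite loo_quad_ge0//=; apply: le_trans (quad_resolvent_le _ _ t0) _.
by rewrite ler_pdivrMr// mulVf ?gt_eqF// sqnorm_row_normalized_le1.
Qed.

Lemma bounded_rv_loo_quad t i : 0 < t ->
  bounded_rv (fun x => loo_quad (normalized x) t i).
Proof.
move=> t0; split; last first.
  by exists t^-1 => x; have /andP[? ?] := loo_quad_bound x i t0; rewrite ger0_norm.
have mr := measurable_row i.
apply: (entrywiseM mfun_cst mfun_add mfun_mul); last exact: entrywise_tr.
apply: (entrywiseM mfun_cst mfun_add mfun_mul) => //.
by apply: measurable_gram_resolvent => //; exact: measurable_zero_row.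
Qed.

Definition mean_trace q (Y : 'M[R]_(q, n)) t : R := n%:R^-1 * \tr (gram_resolvent Y t).

Lemma mean_trace_bound q (Y : 'M[R]_(q, n)) t : 0 < t -> 0 <= mean_trace Y t <= t^-1.
Proof.
move=> t0; rewrite /mean_trace mulr_ge0 ?invr_ge0 ?trace_resolvent_ge0//=.
have := trace_resolvent_le Y t0; have [n0|n0] := eqVneq (n%:R : R) 0.
  by rewrite n0 invr0 !mul0r invr_ge0 (ltW t0).
move=> h; rewrite mulrC ler_pdivrMr; first by rewrite [leRHS]mulrC.
by rewrite lt_def n0 ler0n.
Qed.

Lemma bounded_rv_mean_trace q (Y : config -> 'M[R]_(q, n)) t : 0 < t ->
  entrywise mfun Y -> bounded_rv (fun x => mean_trace (Y x) t).
Proof.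
move=> t0 mY; split; last first.
  exists t^-1 => x; have /andP[? ?] := mean_trace_bound (Y x) t0.
  by rewrite ger0_norm.
apply: mfun_mul => //; apply: (entrywise_trace mfun_cst mfun_add).
exact: measurable_gram_resolvent.
Qed.

Lemma mean_trace_loo (Y : 'M[R]_(p, n)) t i : 0 < t ->
  `|mean_trace (zero_row i Y) t - mean_trace Y t| <= (n%:R * t)^-1.
Proof.
move=> t0; rewrite /mean_trace -mulrBr normrM ger0_norm ?invr_ge0//.
rewrite invfM ler_wpM2l ?invr_ge0// ler_norml.
have := trace_loo_le Y i t0; have := trace_loo_ge Y i t0.
have : 0 < t^-1 by rewrite invr_gt0.
by move=> *; apply/andP; split; lra.
Qed.

Lemma mean_trace_bounded_difference (Y Y' : 'M[R]_(p, n)) t i : 0 < t ->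
  (forall k, k != i -> forall j, Y k j = Y' k j) ->
  `|mean_trace Y t - mean_trace Y' t| <= (n%:R * t)^-1.
Proof.
move=> t0 YY'; rewrite /mean_trace -mulrBr normrM ger0_norm ?invr_ge0//.
by rewrite invfM ler_wpM2l ?invr_ge0// (trace_resolvent_bounded_difference t0 YY').
Qed.

Lemma normalized_eq_row x y i : (forall j, x (i, j) = y (i, j)) ->
  forall j, normalized x i j = normalized y i j.
Proof.
move=> xy j; rewrite !mxE xy; congr (_ / Num.sqrt _).
by apply: eq_bigr => k _; rewrite !mxE xy.
Qed.

(** The statistic [W] at the negative real point [- t]. *)
Definition real_W (i : 'I_p) (Y : 'M[R]_(p, n)) t : R :=
  loo_quad Y t i - mean_trace (zero_row i Y) t.

Lemma bounded_rv_real_W i t : 0 < t ->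
  bounded_rv (fun x => real_W i (normalized x) t).
Proof.
move=> t0; apply: bounded_rvB; first exact: bounded_rv_loo_quad.
by apply: bounded_rv_mean_trace => //; exact: measurable_zero_row.
Qed.

End NormalizedRows.

Section ComplexW.
Variables (R : realType) (p n : nat) (hp : (0 < p)%N).
Local Notation C := R[i].
Local Notation i0 := (Ordinal hp).
Implicit Types (Y : 'M[R]_(p, n)) (t : R) (z : C).
Local Open Scope complex_scope.

(** The complex modulus with values in the reals. *)
Definition complex_abs (z : C) : R := Num.sqrt (complex.Re z ^+ 2 + complex.Im z ^+ 2).

Lemma normc_abs z : `|z| = (complex_abs z)%:C.
Proof. by case: z. Qed.

Lemma complex_abs_le z : complex_abs z <= `|complex.Re z| + `|complex.Im z|.
Proof.
rewrite -[leRHS]ger0_norm ?addr_ge0// -sqrtr_sqr ler_wsqrtr// sqrrD !real_normK ?num_real//.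
by rewrite addrAC lerDl mulrn_wge0// mulr_ge0.
Qed.

Lemma inv_complexE (x a b : R) : b != 0 ->
  (x%:C - (a +i* b))^-1
    = ((x - a) / ((x - a) ^+ 2 + b ^+ 2)) +i* (b / ((x - a) ^+ 2 + b ^+ 2)).
Proof.
by move=> b0; apply/eqP; rewrite eq_complex /= sub0r sqrrN mulNr opprK !eqxx.
Qed.

Lemma Re_sum (I : Type) (r : seq I) (F : I -> C) :
  complex.Re (\sum_(k <- r) F k) = \sum_(k <- r) complex.Re (F k).
Proof. by apply: (big_morph _ (id1 := 0)) => [[a b] [c d]|]. Qed.

Lemma Im_sum (I : Type) (r : seq I) (F : I -> C) :
  complex.Im (\sum_(k <- r) F k) = \sum_(k <- r) complex.Im (F k).
Proof. by apply: (big_morph _ (id1 := 0)) => [[a b] [c d]|]. Qed.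

(** [W] is the Stieltjes transform of a signed measure on the half-line whose
    total variation is at most 2. *)
Lemma W_spectral Y : sqnorm (row i0 Y) <= 1 ->
  exists d c : 'I_n -> R, [/\ forall k, 0 <= d k, \sum_k `|c k| <= 2,
    forall t, 0 < t -> real_W i0 Y t = \sum_k c k / (d k + t) &
    forall a b, 0 < b ->
      complex.Re (W hp Y (a +i* b))
        = \sum_k c k * ((d k - a) / ((d k - a) ^+ 2 + b ^+ 2)) /\
      complex.Im (W hp Y (a +i* b))
        = \sum_k c k * (b / ((d k - a) ^+ 2 + b ^+ 2))].
Proof.
move=> y1; have [d [w [d0 w0 wy wt wz]]] :=
  real_gram_spectral_measure (zero_row i0 Y) (row i0 Y).
exists d, (fun k => w k - n%:R^-1); split => //.
- apply: (@le_trans _ _ (\sum_k (w k + n%:R^-1))).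
    apply: ler_sum => k _; apply: le_trans (ler_normB _ _) _.
    by rewrite !ger0_norm ?invr_ge0.
  rewrite big_split /= wy sumr_const card_ord -[_ *+ _]mulr_natl.
  have : n%:R * n%:R^-1 <= 1 :> R.
    have [->|n0] := eqVneq (n%:R : R) 0; first by rewrite mul0r.
    by rewrite mulfV.
  by move: y1; lra.
- move=> t t0; have [e1 e2] := wt t t0; rewrite /real_W /loo_quad e1 /mean_trace e2.
  by rewrite mulr_sumr -sumrB; apply: eq_bigr => k _; rewrite mulrBl.
move=> a b b0; have [_ [e1 e2]] := wz (a +i* b) b0.
have WE : W hp Y (a +i* b)
    = \sum_k (w k - n%:R^-1)%:C * ((d k)%:C - (a +i* b))^-1.
  rewrite /W /resolventB /first_row.
  have -> : Y^T *m Y - (row i0 Y)^T *m row i0 Y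
      = (zero_row i0 Y)^T *m zero_row i0 Y.
    by rewrite (gram_zero_row Y i0) addrK.
  rewrite e1 e2 mulr_sumr -sumrB; apply: eq_bigr => k _.
  by rewrite rmorphB mulrBl fmorphV /= rmorph_nat.
have b0' : b != 0 by rewrite gt_eqF.
rewrite WE Re_sum Im_sum; split; apply: eq_bigr => k _; rewrite inv_complexE//=.
  by rewrite mul0r subr0.
by rewrite mul0r addr0.
Qed.

(** The real part of [1 / (x + t - i e)] differs from [1 / (x + t)] by at most
    [e^2 / t^3] when [x >= 0]. *)
Lemma real_W_le_complex Y t (e : R) : 0 < t -> 0 < e ->
  sqnorm (row i0 Y) <= 1 ->
  `|real_W i0 Y t| <= complex_abs (W hp Y ((- t) +i* e)) + 2 * (e ^+ 2 / t ^+ 3).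
Proof.
move=> t0 e0 y1; have [d [c [d0 c2 ct cz]]] := W_spectral y1.
have [re _] := cz (- t) e e0.
have h1 : `|complex.Re (W hp Y ((- t) +i* e))| <= complex_abs (W hp Y ((- t) +i* e)).
  by rewrite -sqrtr_sqr ler_wsqrtr// lerDl sqr_ge0.
rewrite -lerBlDl; apply: le_trans (lerB (lexx _) h1) _.
apply: le_trans (lerB_dist _ _) _; rewrite re ct// -sumrB.
apply: le_trans (ler_norm_sum _ _ _) _.
apply: (@le_trans _ _ (\sum_k `|c k| * (e ^+ 2 / t ^+ 3))).
  apply: ler_sum => k _; rewrite opprK -mulrBr normrM ler_wpM2l//.
  have x0 : 0 < d k + t by rewrite ltr_wpDl.
  have den0 : 0 < (d k + t) ^+ 2 + e ^+ 2 by rewrite addr_gt0 ?exprn_gt0.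
  have -> : (d k + t)^-1 - (d k + t) / ((d k + t) ^+ 2 + e ^+ 2)
      = e ^+ 2 / ((d k + t) * ((d k + t) ^+ 2 + e ^+ 2)).
    by field; rewrite !gt_eqF.
  rewrite ger0_norm ?divr_ge0 ?sqr_ge0 ?mulr_ge0 ?(ltW x0) ?(ltW den0)//.
  rewrite ler_wpM2l ?sqr_ge0// lef_pV2 ?posrE ?mulr_gt0 ?exprn_gt0//.
  rewrite exprS ler_pM ?exprn_ge0 ?(ltW t0)//; first by rewrite lerDr.
  apply: (@le_trans _ _ ((d k + t) ^+ 2)); last by rewrite lerDl sqr_ge0.
  by rewrite lerXn2r ?nnegrE ?(ltW t0) ?(ltW x0)// lerDr.
by rewrite -mulr_suml ler_wpM2r// divr_ge0 ?sqr_ge0 ?exprn_ge0 ?(ltW t0).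
Qed.

End ComplexW.

(** The Cauchy kernel at [z] is a uniform limit of combinations of resolvents,
    and [W] integrates it against a measure of total variation at most 2; the
    list [l] is therefore the same for all matrices. *)
Lemma complex_W_le_real (R : realType) (z : R[i]) (eta : R) :
  0 < complex.Im z -> 0 < eta ->
  exists l : seq (R * rat), all (fun ct => 0 < ct.2) l /\
    forall p n (hp : (0 < p)%N) (Y : 'M[R]_(p, n)),
      sqnorm (row (Ordinal hp) Y) <= 1 ->
      complex_abs (W hp Y z)
        <= \sum_(ct <- l) `|ct.1| * `|real_W (Ordinal hp) Y (ratr ct.2)| + eta.
Proof.
case: z => a b /= b0 eta0; have eta4 : 0 < eta / 4 by rewrite divr_gt0.
have [sre sim] := cauchy_kernel_span a (lt0r_neq0 b0).
have [l1 [l1pos l1b]] := sre _ eta4; have [l2 [l2pos l2b]] := sim _ eta4.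
exists (l1 ++ l2); split; first by rewrite all_cat l1pos.
move=> p n hp Y y1; have [d [c [d0 c2 ct cz]]] := W_spectral y1.
have [re im] := cz a b b0; apply: le_trans (complex_abs_le _) _.
have aux f l : all (fun ct => 0 < ct.2) l ->
    (forall x : R, 0 <= x -> `|f x - resolvent_comb l x| <= eta / 4) ->
    `|\sum_k c k * f (d k)|
      <= \sum_(ct <- l) `|ct.1| * `|real_W (Ordinal hp) Y (ratr ct.2)| + eta / 2.
  move=> l0 fl; rewrite -lerBlDl.
  have combE : \sum_k c k * resolvent_comb l (d k)
      = \sum_(ct <- l) ct.1 * real_W (Ordinal hp) Y (ratr ct.2).
    rewrite /resolvent_comb; under eq_bigr do rewrite mulr_sumr.
    rewrite exchange_big /= !big_seq; apply: eq_bigr => -[u q] /(allP l0) /= q0.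
    rewrite ct ?ltr0q// mulr_sumr; apply: eq_bigr => k _.
    by rewrite mulrCA.
  have h1 : `|\sum_k c k * resolvent_comb l (d k)|
      <= \sum_(ct <- l) `|ct.1| * `|real_W (Ordinal hp) Y (ratr ct.2)|.
    rewrite combE; apply: le_trans (ler_norm_sum _ _ _) _.
    by apply: ler_sum => ? _; rewrite normrM.
  apply: le_trans (lerB (lexx _) h1) _; apply: le_trans (lerB_dist _ _) _.
  rewrite -sumrB; apply: le_trans (ler_norm_sum _ _ _) _.
  apply: (@le_trans _ _ (\sum_k `|c k| * (eta / 4))).
    by apply: ler_sum => k _; rewrite -mulrBr normrM ler_wpM2l// fl.
  by rewrite -mulr_suml; have := ler_wpM2r (ltW eta4) c2; lra.
rewrite re im big_cat /=.
by have := aux _ _ l1pos l1b; have := aux _ _ l2pos l2b => /= ? ?; lra.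
Qed.

(** * Measurability of W at complex points *)

Section MeasurableComplexW.
Variables (R : realType) (p n : nat) (hp : (0 < p)%N).
Local Notation C := R[i].
Local Notation config := (config ('I_p * 'I_n)%type R).
Local Open Scope complex_scope.

Definition complex_measurable (f : config -> C) : Prop :=
  measurable_fun setT (fun x => complex.Re (f x)) /\
  measurable_fun setT (fun x => complex.Im (f x)).

Lemma cm_cst (a : C) : complex_measurable (fun=> a).
Proof. by split; exact: measurable_cst. Qed.

Lemma cm_add (f g : config -> C) : complex_measurable f -> complex_measurable g ->
  complex_measurable (fun x => f x + g x).
Proof.
move=> [f1 f2] [g1 g2]; split.
  have -> : (fun x => complex.Re (f x + g x))
      = (fun x => complex.Re (f x) + complex.Re (g x)).
    by apply/funext => x; case: (f x) (g x) => [? ?] [? ?].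
  exact: mfun_add.
have -> : (fun x => complex.Im (f x + g x))
    = (fun x => complex.Im (f x) + complex.Im (g x)).
  by apply/funext => x; case: (f x) (g x) => [? ?] [? ?].
exact: mfun_add.
Qed.

Lemma cm_mul (f g : config -> C) : complex_measurable f -> complex_measurable g ->
  complex_measurable (fun x => f x * g x).
Proof.
move=> [f1 f2] [g1 g2]; split.
  have -> : (fun x => complex.Re (f x * g x))
      = (fun x => complex.Re (f x) * complex.Re (g x)
           + complex.Im (f x) * ((-1) * complex.Im (g x))).
    by apply/funext => x; case: (f x) (g x) => [? ?] [? ?] /=; rewrite mulN1r mulrN.
  apply: mfun_add; first exact: mfun_mul.
  by apply: mfun_mul => //; apply: mfun_mul => //; exact: mfun_cst.
have -> : (fun x => complex.Im (f x * g x))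
    = (fun x => complex.Re (f x) * complex.Im (g x) + complex.Im (f x) * complex.Re (g x)).
  by apply/funext => x; case: (f x) (g x) => [? ?] [? ?].
by apply: mfun_add; exact: mfun_mul.
Qed.

Lemma cm_inv (f : config -> C) : complex_measurable f ->
  complex_measurable (fun x => (f x)^-1).
Proof.
move=> [f1 f2].
have mn : measurable_fun setT
    (fun x => (complex.Re (f x) ^+ 2 + complex.Im (f x) ^+ 2)^-1).
  apply: mfun_inv; apply: mfun_add; [exact: (measurable_funX 2 f1)|exact: (measurable_funX 2 f2)].
split.
  have -> : (fun x => complex.Re (f x)^-1)
      = (fun x => complex.Re (f x) * (complex.Re (f x) ^+ 2 + complex.Im (f x) ^+ 2)^-1).
    by apply/funext => x; case: (f x).
  exact: mfun_mul.
have -> : (fun x => complex.Im (f x)^-1)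
    = (fun x => (-1) * (complex.Im (f x)
          * (complex.Re (f x) ^+ 2 + complex.Im (f x) ^+ 2)^-1)).
  by apply/funext => x; case: (f x) => ? ? /=; rewrite mulN1r.
by apply: mfun_mul; [exact: mfun_cst|exact: mfun_mul].
Qed.

Lemma cm_real (f : config -> R) : measurable_fun setT f ->
  complex_measurable (fun x => (f x)%:C).
Proof. by move=> mf; split => //; exact: measurable_cst. Qed.

Lemma measurable_complex_abs_W (z : C) : 0 < complex.Im z ->
  measurable_fun setT (fun x : config => complex_abs (W hp (normalized x) z)).
Proof.
move=> z0; have my : entrywise complex_measurable
    (fun x : config => to_complex (row (Ordinal hp) (normalized x))).
  move=> k j; have -> : (fun x : config => to_complex (row (Ordinal hp) (normalized x)) k j)
      = (fun x : config => (row (Ordinal hp) (normalized x) k j)%:C).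
    by apply/funext => x; rewrite mxE.
  by apply: cm_real; exact: measurable_row.
have mG : entrywise complex_measurable (fun x : config =>
    to_complex ((normalized x)^T *m normalized x
       - (row (Ordinal hp) (normalized x))^T *m row (Ordinal hp) (normalized x))).
  move=> k j; pose Y0 := (fun x : config => zero_row (Ordinal hp) (normalized x)).
  have -> : (fun x : config => to_complex ((normalized x)^T *m normalized x
       - (row (Ordinal hp) (normalized x))^T *m row (Ordinal hp) (normalized x)) k j)
      = (fun x : config => (((Y0 x)^T *m Y0 x) k j)%:C).
    by apply/funext => x; rewrite /Y0 (gram_zero_row (normalized x) (Ordinal hp)) addrK mxE.
  apply: cm_real; have mY0 := @measurable_zero_row R p n (Ordinal hp).
  apply: (entrywiseM (@mfun_cst R p n) (@mfun_add R p n) (@mfun_mul R p n)) => //.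
  exact: entrywise_tr.
have mB : entrywise complex_measurable (fun x : config => resolventB hp (normalized x) z).
  apply: (entrywise_inv cm_cst cm_add cm_mul cm_inv).
    move=> x; have [d [w [_ _ _ _ /(_ z z0)[u _]]]] :=
      real_gram_spectral_measure (zero_row (Ordinal hp) (normalized x)) 0.
    by rewrite /first_row (gram_zero_row (normalized x) (Ordinal hp)) addrK.
  apply: (entrywiseD cm_add); first exact: mG.
  exact: (entrywise_cst cm_cst).
have [mre mim] : complex_measurable (fun x : config => W hp (normalized x) z).
  rewrite /W; apply: cm_add.
    apply: (entrywiseM cm_cst cm_add cm_mul); last exact: entrywise_tr.
    exact: (entrywiseM cm_cst cm_add cm_mul).
  have -> : (fun x : config => - (n%:R^-1 * \tr (resolventB hp (normalized x) z)))
     = (fun x : config => (- n%:R^-1) * \tr (resolventB hp (normalized x) z)).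
    by apply/funext => x; rewrite mulNr.
  by apply: cm_mul; [exact: cm_cst|exact: (entrywise_trace cm_cst cm_add)].
apply: (@measurableT_comp _ _ _ _ _ _ (@Num.sqrt R)).
  by apply: continuous_measurable_fun; exact: sqrt_continuous.
by apply: mfun_add; [exact: (measurable_funX 2 mre)|exact: (measurable_funX 2 mim)].
Qed.

End MeasurableComplexW.

Section SelfNormalizedSum.
Variable R : realType.

(** [V] is at most 1, and at most [2 a^2 / beta] as soon as the truncated
    second moment [tb] exceeds [beta / 2]; otherwise the first term is at least 1. *)
Lemma self_normalized_bound (beta a b tb V : R) : 0 < beta ->
  0 <= V -> V <= 1 -> V * b = a ^+ 2 -> 0 <= tb -> tb <= b ->
  V <= 4 / beta ^+ 2 * (tb - beta) ^+ 2 + (1 + 2 / beta) * `|a|.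
Proof.
move=> beta0 V0 V1 Vb tb0 tbb.
have ib : 0 < beta^-1 by rewrite invr_gt0.
have q0 : 0 <= 4 / beta ^+ 2 * (tb - beta) ^+ 2.
  by rewrite mulr_ge0 ?sqr_ge0// divr_ge0 ?sqr_ge0.
have [tb2|tb2] := leP (beta / 2) tb; last first.
  have h : 1 <= 4 / beta ^+ 2 * (tb - beta) ^+ 2.
    rewrite mulrAC ler_pdivlMr ?exprn_gt0// mul1r.
    have : (beta / 2) ^+ 2 <= (beta - tb) ^+ 2.
      by rewrite lerXn2r ?nnegrE; lra.
    by rewrite -(sqrrN (beta - tb)) opprB; lra.
  have : 0 <= (1 + 2 / beta) * `|a| by rewrite mulr_ge0// addr_ge0// divr_ge0// ltW.
  by lra.
have [a1|a1] := leP 1 `|a|.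
  have : 1 <= (1 + 2 / beta) * `|a|.
    by rewrite mulr_ege1// lerDl divr_ge0// ltW.
  by lra.
have h2 : V * (beta / 2) <= a ^+ 2.
  by rewrite -Vb ler_wpM2l// (le_trans tb2).
have h3 : a ^+ 2 <= `|a|.
  by rewrite -(real_normK (num_real a)) expr2 ler_piMr// ltW.
have h4 : V <= 2 / beta * `|a|.
  have -> : 2 / beta * `|a| = `|a| / (beta / 2) by field; rewrite gt_eqF.
  by rewrite ler_pdivlMr ?divr_gt0// (le_trans h2).
have := normr_ge0 a; lra.
Qed.

(** From [2 |u| theta <= u^2 + theta^2]. *)
Lemma norm_le_sqr (u theta : R) : 0 < theta -> `|u| <= theta + u ^+ 2 / theta.
Proof.
move=> t0; rewrite -(ler_pM2r t0) mulrDl mulfVK ?gt_eqF//.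
rewrite -(real_normK (num_real u)).
have := sqr_ge0 (`|u| - theta); have := normr_ge0 u; have := sqr_ge0 theta.
have := sqr_ge0 `|u|.
set v := `|u|; move=> h0 h1 h2 h3.
have : 0 <= v * theta by rewrite mulr_ge0// ltW.
by move: h3; rewrite sqrrB; lra.
Qed.

End SelfNormalizedSum.

(** * Self-normalized sums *)

Section IdenticallyDistributed.
Context d (T : measurableType d) (R : realType) (P : probability T R).

Lemma bounded_rv_RV (X : {RV P >-> R}) (g : R -> R) :
  bounded_rv g -> bounded_rv (fun w => g (X w)).
Proof.
move=> [mg [M gM]]; split; last by exists M.
exact: (measurableT_comp mg (measurable_funPT X)).
Qed.

Lemma expect_identically_distributed (X Y : {RV P >-> R}) (g : R -> R) :
  identically_distributed X Y -> bounded_rv g ->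
  expect P (fun w => g (X w)) = expect P (fun w => g (Y w)).
Proof.
move=> XY bg; have mgE : measurable_fun setT (EFin \o g).
  by apply/measurable_EFinP; have [] := bg.
have i1 : P.-integrable setT ((EFin \o g) \o X).
  exact: (bounded_rv_integrable P (bounded_rv_RV X bg)).
have i2 : P.-integrable setT ((EFin \o g) \o Y).
  exact: (bounded_rv_integrable P (bounded_rv_RV Y bg)).
rewrite /expect /Rintegral; congr fine.
have <- := integral_distribution mgE i1; have <- := integral_distribution mgE i2.
by apply: eq_measure_integral => A mA _; exact: XY.
Qed.

Variables (xi : {RV P >-> R}) (E : finType) (X : E -> {RV P >-> R}).

Lemma bounded_rv_coord (u : R -> R) (e : E) : bounded_rv u ->
  bounded_rv (fun x : config E R => u (x e)).
Proof.
move=> [mu [M uM]]; split; last by exists M.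
exact: (measurableT_comp mu (@measurable_coord E R e)).
Qed.

(** Pairwise products of distinct centered terms have mean zero. *)
Lemma expect_sqr_sum (n : nat) (kappa : 'I_n -> E) (u : R -> R) (M : R) :
  mutually_independent X -> (forall e, identically_distributed (X e) xi) ->
  injective kappa -> bounded_rv u -> (forall x, `|u x| <= M) ->
  expect P (fun w => u (xi w)) = 0 ->
  expect P (fun w => (\sum_j u (X (kappa j) w)) ^+ 2) <= n%:R * M ^+ 2.
Proof.
move=> X_indep X_id kinj bu uM u0.
have buX e : bounded_rv (fun w => u (X e w)) by exact: bounded_rv_RV.
have -> : (fun w => (\sum_j u (X (kappa j) w)) ^+ 2)
    = (fun w => \sum_j \sum_k (u (X (kappa j) w) * u (X (kappa k) w))).
  apply/funext => w; rewrite expr2 mulr_suml; apply: eq_bigr => j _.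
  by rewrite mulr_sumr.
rewrite expect_sum; last first.
  by move=> j; apply: bounded_rv_sum => k; exact: bounded_rvM.
apply: (@le_trans _ _ (\sum_(j < n) M ^+ 2)); last first.
  by rewrite sumr_const card_ord mulr_natl.
apply: ler_sum => j _; rewrite expect_sum; last by move=> k; exact: bounded_rvM.
rewrite (bigD1 j)//= big1 ?addr0 => [|k kj].
  apply: expect_le_cst => [|w]; first exact: bounded_rvM.
  rewrite -expr2 -(real_normK (num_real _)) lerXn2r ?nnegrE//.
  exact: le_trans (normr_ge0 _) (uM (X (kappa j) w)).
have := @expect_indep_mul _ _ _ P E X X_indep [set kappa j]%SET _ _
  (bounded_rv_coord (kappa j) bu) (bounded_rv_coord (kappa k) bu).
rewrite /sample => e; rewrite {}e.
- by rewrite (expect_identically_distributed (X_id _) bu) u0 mul0r.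
- by move=> x y xy; rewrite xy// inE.
- by move=> x y xy; rewrite xy// !inE (inj_eq kinj).
Qed.

End IdenticallyDistributed.

Section RowSums.
Context d (T : measurableType d) (R : realType) (P : probability T R).
Variables (xi : {RV P >-> R}) (p n : nat) (X : 'I_p * 'I_n -> {RV P >-> R}).
Variables (i : 'I_p).
Local Notation config := (config ('I_p * 'I_n)%type R).

Definition truncate (K x : R) : R := if `|x| <= K then x else 0.
Definition excess (K x : R) : R := if `|x| <= K then 0 else x.

Lemma truncate_excess K x : truncate K x + excess K x = x.
Proof. by rewrite /truncate /excess; case: ifP; rewrite ?addr0 ?add0r. Qed.

Lemma measurable_normr_le (K : R) : measurable_fun setT (fun x : R => `|x| <= K).
Proof.
have -> : (fun x : R => `|x| <= K) = (fun x : R => ~~ (K < `|x|)).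
  by apply/funext => x; rewrite leNgt.
by apply: measurable_neg; apply: measurable_fun_ltr => //; exact: measurable_cst.
Qed.

Lemma bounded_rv_truncate (K : R) : 0 <= K -> bounded_rv (truncate K).
Proof.
move=> K0; split.
  by apply: measurable_fun_ifT => //; exact: measurable_normr_le.
by exists K => x; rewrite /truncate; case: ifP; rewrite ?normr0.
Qed.

Lemma measurable_excess (K : R) : measurable_fun setT (excess K).
Proof. by apply: measurable_fun_ifT => //; exact: measurable_normr_le. Qed.

Definition row_sum (x : config) : R := \sum_j normalized x i j.

Lemma normalized_entry_le1 (x : config) j : `|normalized x i j| <= 1.
Proof.
have := sqnorm_row_normalized_le1 x i; rewrite /sqnorm (bigD1 j)//= mxE => h.
rewrite -(ler_pXn2r (n := 2)) ?nnegrE// expr1n real_normK ?num_real//.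
apply: le_trans h; rewrite lerDl; apply: sumr_ge0 => k _; exact: sqr_ge0.
Qed.

Lemma bounded_rv_normalized j : bounded_rv (fun x : config => normalized x i j).
Proof.
split; first exact: measurable_normalized.
by exists 1 => x; exact: normalized_entry_le1.
Qed.

(** Cauchy--Schwarz, in the form [0 <= sum_{j,k} (y_j - y_k)^2]. *)
Lemma sqr_sum_le m (y : 'I_m -> R) : (\sum_j y j) ^+ 2 <= m%:R * \sum_j y j ^+ 2.
Proof.
have -> : (\sum_j y j) ^+ 2 = \sum_j \sum_k y j * y k.
  by rewrite expr2 mulr_suml; apply: eq_bigr => j _; rewrite mulr_sumr.
have <- : \sum_j \sum_k (y j ^+ 2 / 2 + y k ^+ 2 / 2) = m%:R * \sum_j y j ^+ 2.
  set S := \sum_j y j ^+ 2.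
  transitivity (\sum_(j < m) (m%:R * (y j ^+ 2 / 2) + S / 2)).
    apply: eq_bigr => j _; rewrite big_split /= sumr_const card_ord mulr_natl.
    by rewrite -mulr_suml.
  rewrite big_split /= sumr_const card_ord -mulr_sumr -mulr_suml -/S.
  by rewrite -[_ *+ m]mulr_natl; field.
apply: ler_sum => j _; apply: ler_sum => k _.
by have := sqr_ge0 (y j - y k); lra.
Qed.

Lemma row_sum_sqr (x : config) :
  row_sum x ^+ 2 * \sum_(j < n) x (i, j) ^+ 2 = (\sum_(j < n) x (i, j)) ^+ 2.
Proof.
set s := \sum_(j < n) x (i, j) ^+ 2.
have s0 : 0 <= s by apply: sumr_ge0 => j _; exact: sqr_ge0.
have -> : row_sum x = (\sum_(j < n) x (i, j)) / Num.sqrt s.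
  rewrite mulr_suml; apply: eq_bigr => j _; rewrite !mxE; congr (_ / Num.sqrt _).
  by apply: eq_bigr => k _; rewrite mxE.
rewrite expr_div_n sqr_sqrtr//; have [s00|sn0] := eqVneq s 0; last by rewrite mulfVK.
rewrite s00 mulr0; have /psumr_eq0P xz := s00.
rewrite big1 ?expr0n// => j _; apply/eqP; rewrite -sqrf_eq0.
by rewrite xz// => k _; exact: sqr_ge0.
Qed.

Hypothesis X_indep : mutually_independent X.
Hypothesis X_id : forall e, identically_distributed (X e) xi.

Let column_injective : injective (fun j : 'I_n => (i, j)).
Proof. by move=> j k []. Qed.

Lemma mean_sqr_bound (u : R -> R) (M : R) : (0 < n)%N ->
  bounded_rv u -> (forall x, `|u x| <= M) -> expect P (fun w => u (xi w)) = 0 ->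
  expect P (fun w => (n%:R^-1 * \sum_j u (X (i, j) w)) ^+ 2) <= M ^+ 2 / n%:R.
Proof.
move=> n0 bu uM u0; have n0' : 0 < n%:R :> R by rewrite ltr0n.
have b2 : bounded_rv (fun w => (\sum_j u (X (i, j) w)) ^+ 2).
  have bs : bounded_rv (fun w => \sum_j u (X (i, j) w)).
    by apply: bounded_rv_sum => j; exact: bounded_rv_RV.
  exact: (bounded_rvM bs bs).
have -> : (fun w => (n%:R^-1 * \sum_j u (X (i, j) w)) ^+ 2)
    = (fun w => n%:R^-1 ^+ 2 * (\sum_j u (X (i, j) w)) ^+ 2).
  by apply/funext => w; rewrite exprMn.
rewrite expectZ//.
have h := expect_sqr_sum X_indep X_id column_injective bu uM u0.
apply: le_trans (ler_wpM2l (sqr_ge0 _) h) _.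
by rewrite le_eqVlt; apply/orP; left; apply/eqP; field; rewrite gt_eqF.
Qed.

Lemma expect_mean (u : R -> R) : (0 < n)%N -> bounded_rv u ->
  expect P (fun w => n%:R^-1 * \sum_j u (X (i, j) w)) = expect P (fun w => u (xi w)).
Proof.
move=> n0 bu; have n0' : 0 < n%:R :> R by rewrite ltr0n.
have bX j : bounded_rv (fun w => u (X (i, j) w)) by exact: bounded_rv_RV.
rewrite expectZ; last exact: bounded_rv_sum.
rewrite expect_sum//.
rewrite (eq_bigr (fun=> expect P (fun w => u (xi w)))); last first.
  by move=> j _; exact: expect_identically_distributed.
by rewrite sumr_const card_ord -[expect _ _ *+ n]mulr_natl mulrA mulVf ?gt_eqF// mul1r.
Qed.

Lemma bounded_rv_min_sqr : bounded_rv (fun x : R => Num.min (x ^+ 2) 1).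
Proof.
split; first by apply: measurable_minr => //; exact: measurable_cst.
by exists 1 => x; rewrite ger0_norm ?ge_min ?lexx ?orbT// le_min sqr_ge0 ler01.
Qed.

Lemma bounded_rv_min_excess (K c : R) : 0 <= c ->
  bounded_rv (fun x : R => Num.min `|excess K x| c).
Proof.
move=> c0; split.
  apply: measurable_minr; last exact: measurable_cst.
  exact: (measurableT_comp (@normr_measurable R setT) (measurable_excess K)).
exists c => x; rewrite ger0_norm ?ge_min ?lexx ?orbT//.
by rewrite le_min normr_ge0.
Qed.

(** The ratio [row_sum ^ 2 / n] is [a ^ 2 / b], with [a] the mean of the entries
    and [b] the mean of their squares. The squares are truncated at [1] and the
    entries at [K], so that both means have variance of order [1 / n]; the
    excess of the entries over [K] may be cut off at [n], the ratio being at most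
    1. *)
Lemma expect_row_sum_le (beta K theta mu tail : R) : (0 < n)%N ->
  0 < beta -> 0 <= K -> 0 < theta ->
  expect P (fun w => Num.min (xi w ^+ 2) 1) = beta ->
  expect P (fun w => truncate K (xi w)) = mu ->
  (forall c : R, 0 <= c -> expect P (fun w => Num.min `|excess K (xi w)| c) <= tail) ->
  expect P (fun w => row_sum (sample X w) ^+ 2) / n%:R
    <= 4 / beta ^+ 2 * (1 / n%:R)
       + (1 + 2 / beta) * (theta + (2 * K) ^+ 2 / n%:R / theta + `|mu| + tail).
Proof.
move=> n0 beta0 K0 theta0 betaE muE tailE; have n0' : 0 < n%:R :> R by rewrite ltr0n.
pose C := 1 + 2 / beta; have C1 : 1 <= C by rewrite lerDl divr_ge0// ltW.
have C0 : 0 <= C := le_trans ler01 C1.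
pose u1 (x : R) : R := Num.min (x ^+ 2) 1 - beta; pose u2 (x : R) : R := truncate K x - mu.
pose u3 (x : R) : R := Num.min `|excess K x| n%:R.
have bu1 : bounded_rv u1.
  by apply: bounded_rvB; [exact: bounded_rv_min_sqr|exact: bounded_rv_cst].
have bt := bounded_rv_truncate K0.
have bu2 : bounded_rv u2 by apply: bounded_rvB => //; exact: bounded_rv_cst.
have bu3 : bounded_rv u3 by exact: bounded_rv_min_excess.
have tK x : `|truncate K x| <= K by rewrite /truncate; case: ifP; rewrite ?normr0.
have m01 (x : R) : 0 <= Num.min (x ^+ 2) 1 <= 1.
  by rewrite le_min sqr_ge0 ler01 ge_min lexx orbT.
have beta01 : 0 <= beta <= 1.
  rewrite -betaE; have bm := bounded_rv_RV xi bounded_rv_min_sqr.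
  apply/andP; split; [apply: expect_ge_cst|apply: expect_le_cst] => // w;
  by have /andP[] := m01 (xi w).
have u1M x : `|u1 x| <= 1.
  by have := m01 x; move: beta01; rewrite /u1 ler_norml => /andP[? ?] /andP[? ?];
     apply/andP; split; lra.
have muK : `|mu| <= K.
  rewrite -muE; apply: le_trans (expect_norm P (bounded_rv_RV xi bt)) _.
  by apply: expect_le_cst => [|w]; [exact/bounded_rv_norm/bounded_rv_RV|exact: tK].
have u2M x : `|u2 x| <= 2 * K.
  rewrite /u2; apply: le_trans (ler_normB _ _) _.
  by have := tK x; move: muK; lra.
have u10 : expect P (fun w => u1 (xi w)) = 0.
  rewrite expectB ?expect_cst ?betaE ?subrr//; last exact: bounded_rv_cst.
  exact: (bounded_rv_RV xi bounded_rv_min_sqr).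
have u20 : expect P (fun w => u2 (xi w)) = 0.
  rewrite expectB ?expect_cst ?muE ?subrr//; last exact: bounded_rv_cst.
  exact: bounded_rv_RV.
pose avg (u : R -> R) (w : T) : R := n%:R^-1 * \sum_j u (X (i, j) w).
have bavg (u : R -> R) : bounded_rv u -> bounded_rv (avg u).
  by move=> bu; apply/bounded_rvZ/bounded_rv_sum => j; exact: bounded_rv_RV.
have bavg2 (u : R -> R) : bounded_rv u -> bounded_rv (fun w => avg u w ^+ 2).
  by move=> bu; have := bavg _ bu => b; exact: (bounded_rvM b b).
have avg_cst u c : forall w, avg (fun x => u x - c) w = avg u w - c.
  move=> w; rewrite /avg sumrB sumr_const card_ord mulrBr; congr (_ - _).
  by rewrite -[c *+ n]mulr_natl mulrA mulVf ?gt_eqF// mul1r.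
pose V (w : T) : R := row_sum (sample X w) ^+ 2 / n%:R.
have key w : V w <= 4 / beta ^+ 2 * avg u1 w ^+ 2
    + (C * (theta + `|mu|) + (C / theta * avg u2 w ^+ 2 + C * avg u3 w)).
  have V0 : 0 <= V w by rewrite divr_ge0// sqr_ge0.
  have V1 : V w <= 1.
    rewrite /V ler_pdivrMr// mul1r; apply: le_trans (sqr_sum_le _) _.
    rewrite ler_piMr ?(ltW n0')//; have := sqnorm_row_normalized_le1 (sample X w) i.
    move=> h; apply: le_trans h; rewrite /sqnorm le_eqVlt; apply/orP; left.
    by apply/eqP; apply: eq_bigr => j _; rewrite [in RHS]mxE.
  pose a := avg id w; pose b := avg (fun x => x ^+ 2) w.
  pose tb := avg (fun x => Num.min (x ^+ 2) 1) w.
  have Vb : V w * b = a ^+ 2.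
    rewrite /V /b /a /avg exprMn -(row_sum_sqr (sample X w)) /=; field.
    by rewrite gt_eqF.
  have tb0 : 0 <= tb.
    rewrite mulr_ge0 ?invr_ge0//; apply: sumr_ge0 => j _.
    by have /andP[] := m01 (X (i, j) w).
  have tbb : tb <= b.
    by rewrite ler_wpM2l ?invr_ge0//; apply: ler_sum => j _; rewrite ge_min lexx.
  have h := self_normalized_bound beta0 V0 V1 Vb tb0 tbb.
  rewrite -/C in h; have -> : avg u1 w = tb - beta by exact: avg_cst.
  have q0 : 0 <= 4 / beta ^+ 2 * (tb - beta) ^+ 2.
    by rewrite mulr_ge0 ?sqr_ge0// divr_ge0 ?sqr_ge0.
  have q1 : 0 <= C * (theta + `|mu|) by rewrite mulr_ge0// addr_ge0// ltW.
  have q2 : 0 <= C / theta * avg u2 w ^+ 2.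
    by rewrite mulr_ge0 ?sqr_ge0// divr_ge0// ltW.
  have u3_ge0 x : 0 <= u3 x by rewrite /u3 le_min normr_ge0 ler0n.
  have [small|] := boolP [forall j, `|excess K (X (i, j) w)| <= n%:R]; last first.
    rewrite negb_forall => /existsP[j]; rewrite -ltNge => big.
    have : 1 <= avg u3 w.
      rewrite /avg mulrC ler_pdivlMr// mul1r.
      rewrite (bigD1 j)//= {1}/u3 min_r ?(ltW big)// lerDl.
      by apply: sumr_ge0 => k _; exact: u3_ge0.
    by move=> /(ler_wpM2l C0); rewrite mulr1; lra.
  apply: le_trans h _; rewrite lerD2l.
  have aE : a = avg u2 w + mu + avg (excess K) w.
    rewrite avg_cst subrK /a /avg -mulrDr -big_split /=; congr (_ * _).
    by apply: eq_bigr => j _; rewrite truncate_excess.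
  have e3 : `|avg (excess K) w| <= avg u3 w.
    rewrite /avg normrM ger0_norm ?invr_ge0// ler_wpM2l ?invr_ge0//.
    apply: le_trans (ler_norm_sum _ _ _) _; apply: ler_sum => j _.
    by rewrite /u3 le_min lexx; have /forallP := small; exact.
  have e2 := norm_le_sqr (avg u2 w) theta0.
  have -> : C * (theta + `|mu|) + (C / theta * avg u2 w ^+ 2 + C * avg u3 w)
    = C * (theta + avg u2 w ^+ 2 / theta + `|mu| + avg u3 w).
    by field; rewrite gt_eqF.
  rewrite ler_wpM2l// aE; apply: le_trans (ler_normD _ _) _.
  have := ler_normD (avg u2 w) mu; lra.
have bV : bounded_rv V.
  have br : bounded_rv (fun w => row_sum (sample X w)).
    apply: (bounded_rv_comp (measurable_sample X)).
    by apply: bounded_rv_sum => j; exact: bounded_rv_normalized.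
  have b2 := bounded_rvM br br.
  have -> : V = (fun w => n%:R^-1 * (row_sum (sample X w) * row_sum (sample X w))).
    by apply/funext => w; rewrite /V expr2 mulrC.
  exact: bounded_rvZ.
have -> : expect P (fun w => row_sum (sample X w) ^+ 2) / n%:R = expect P V.
  have br : bounded_rv (fun w => row_sum (sample X w) ^+ 2).
    have b1 : bounded_rv (fun w => n%:R * V w) by exact: bounded_rvZ.
    by move: b1; congr bounded_rv; apply/funext => w; rewrite /V mulrC mulfVK ?gt_eqF.
  rewrite mulrC -expectZ//; congr expect; apply/funext => w.
  by rewrite /V mulrC.
have b1 := bounded_rvZ (4 / beta ^+ 2) (bavg2 _ bu1).
have b2 := bounded_rvZ (C / theta) (bavg2 _ bu2).
have b3 := bounded_rvZ C (bavg _ bu3).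
have b0 := bounded_rv_cst T (C * (theta + `|mu|)).
apply: le_trans (expect_le P bV (bounded_rvD b1 (bounded_rvD b0 (bounded_rvD b2 b3))) key) _.
rewrite expectD//; last by apply: bounded_rvD => //; exact: bounded_rvD.
rewrite expectD//; last exact: bounded_rvD.
rewrite expectD// expect_cst (expectZ P _ (bavg2 _ bu1)) (expectZ P _ (bavg2 _ bu2)).
rewrite (expectZ P _ (bavg _ bu3)).
have h1 := mean_sqr_bound n0 bu1 u1M u10; rewrite expr1n in h1.
have h2 := mean_sqr_bound n0 bu2 u2M u20.
have h3 : expect P (avg u3) <= tail by rewrite expect_mean//; exact: tailE.
have k1 : 0 <= 4 / beta ^+ 2 by rewrite divr_ge0 ?sqr_ge0.
have k2 : 0 <= C / theta by rewrite divr_ge0// ltW.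
have := ler_wpM2l k1 h1; have := ler_wpM2l k2 h2; have := ler_wpM2l C0 h3.
rewrite -/C; have -> : (2 * K) ^+ 2 / n%:R / theta = theta^-1 * ((2 * K) ^+ 2 / n%:R).
  by rewrite mulrC.
by move=> *; lra.
Qed.

End RowSums.

(** * Truncation *)

Section Moments.
Context d (T : measurableType d) (R : realType) (P : probability T R).
Variable (xi : {RV P >-> R}).
Hypothesis xi_centered : ('E_P[xi] = 0)%E.
Hypothesis xi_nondeg : non_degenerate xi.
Variable (delta : R).
Hypothesis delta_gt0 : 0 < delta.
Hypothesis xi_moment : ('E_P[(fun w => (`|xi w| `^ (1 + delta))%R)] < +oo)%E.

Let h (w : T) : R := `|xi w| `^ (1 + delta).

Let measurable_h : measurable_fun setT h.
Proof.
apply: (measurableT_comp (measurable_powR _)).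
exact: (measurableT_comp (@normr_measurable R setT) (measurable_funPT xi)).
Qed.

Let integrable_h : P.-integrable setT (EFin \o h).
Proof.
apply/integrableP; split; first by apply/measurable_EFinP; exact: measurable_h.
have -> : (\int[P]_w `|(EFin \o h) w| = 'E_P[h])%E.
  by rewrite unlock; apply: eq_integral => w _ /=; rewrite ger0_norm// powR_ge0.
exact: xi_moment.
Qed.

Lemma excess_le_moment (K x : R) : 0 < K ->
  `|excess K x| <= (K `^ delta)^-1 * `|x| `^ (1 + delta).
Proof.
move=> K0; rewrite /excess; have [_|Kx] := leP `|x| K.
  by rewrite normr0 mulr_ge0 ?powR_ge0// invr_ge0 powR_ge0.
have x0 : 0 < `|x| := lt_trans K0 Kx.
rewrite mulrC ler_pdivlMr ?powR_gt0//.
rewrite powRD ?powRr1//; last by rewrite (gt_eqF x0) implybT.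
by rewrite ler_wpM2l// ge0_ler_powR// ?nnegrE ?ltW.
Qed.

Lemma integrable_excess (K : R) : 0 < K ->
  P.-integrable setT (EFin \o (fun w => excess K (xi w))).
Proof.
move=> K0; have iZ := integrableZl measurableT (K `^ delta)^-1 integrable_h.
apply: le_integrable iZ => //.
  by apply/measurable_EFinP;
     exact: (measurableT_comp (measurable_excess K) (measurable_funPT xi)).
move=> w _ /=; rewrite lee_fin; apply: le_trans (excess_le_moment _ K0) _.
exact: ler_norm.
Qed.

Let integrable_norm_excess (K : R) : 0 < K ->
  P.-integrable setT (EFin \o (fun w => `|excess K (xi w)|)).
Proof. by move=> K0; exact: (integrable_abse (integrable_excess K0)). Qed.

Lemma expect_excess_le (K : R) : 0 < K ->
  expect P (fun w => `|excess K (xi w)|) <= (K `^ delta)^-1 * expect P h.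
Proof.
move=> K0; rewrite /expect -RintegralZl//; apply: le_Rintegral => //.
- exact: integrable_norm_excess.
- exact: (integrableZl measurableT _ integrable_h).
by move=> w _; exact: excess_le_moment.
Qed.

Lemma expect_min_excess_le (K c : R) : 0 < K -> 0 <= c ->
  expect P (fun w => Num.min `|excess K (xi w)| c)
    <= expect P (fun w => `|excess K (xi w)|).
Proof.
move=> K0 c0; apply: le_Rintegral => //.
- exact: (bounded_rv_integrable P (bounded_rv_RV xi (bounded_rv_min_excess K c0))).
- exact: integrable_norm_excess.
by move=> w _; rewrite ge_min lexx.
Qed.

(** The mean of the truncation equals minus the mean of what is cut off. *)
Lemma expect_truncate_le (K : R) : 0 < K ->
  `|expect P (fun w => truncate K (xi w))| <= expect P (fun w => `|excess K (xi w)|).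
Proof.
move=> K0; have it : P.-integrable setT (EFin \o (fun w => truncate K (xi w))).
  exact: (bounded_rv_integrable P (bounded_rv_RV xi (bounded_rv_truncate (ltW K0)))).
have ie := integrable_excess K0.
have : expect P (fun w => truncate K (xi w) + excess K (xi w)) = 0.
  transitivity (fine 'E_P[xi])%E; last by rewrite xi_centered.
  rewrite unlock /expect /Rintegral; congr fine; apply: eq_integral => w _.
  by rewrite truncate_excess.
rewrite /expect RintegralD// => /eqP; rewrite addr_eq0 => /eqP ->; rewrite normrN.
exact: le_normr_Rintegral.
Qed.

Lemma expect_min_sqr_gt0 : 0 < expect P (fun w => Num.min (xi w ^+ 2) 1).
Proof.
pose m (w : T) : R := Num.min (xi w ^+ 2) 1.
have b : bounded_rv m by exact: (bounded_rv_RV xi (@bounded_rv_min_sqr R)).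
have m0 w : 0 <= m w by rewrite le_min sqr_ge0 ler01.
rewrite -/m lt0r expect_ge_cst// andbT; apply/eqP => e0.
have i0 : (\int[P]_w `|(EFin \o m) w| = 0)%E.
  transitivity (\int[P]_w (EFin \o m) w)%E.
    by apply: eq_integral => w _ /=; rewrite ger0_norm.
  rewrite -[LHS]fineK; first exact: (congr1 EFin e0).
  exact: (integrable_fin_num measurableT (bounded_rv_integrable P b)).
have mb : measurable_fun setT (EFin \o m) by apply/measurable_EFinP; have [] := b.
have /(ae_eq_integral_abs P measurableT mb) ae0 := i0.
have := xi_nondeg 0; move/eqP; apply.
have mA : measurable (xi @^-1` [set 0]).
  by rewrite -[X in measurable X]setTI; exact: measurable_funPT.
have : P (~` (xi @^-1` [set 0])) = 0%E.
  apply/eqP; rewrite -measure_le0.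
  case: ae0 => A [mA' PA sub]; rewrite -(PA : P A = 0%E); apply: le_measure; rewrite ?inE//.
    exact: measurableC.
  move=> w xw; apply: sub => /= /(_ I) [] /eqP.
  rewrite /m minEle; case: ifP => _; last by rewrite oner_eq0.
  by rewrite sqrf_eq0 => /eqP.
rewrite probability_setC// => h1.
have : (P (xi @^-1` [set 0%R]) = 1 - 0)%E.
  by rewrite -h1 oppeB ?fin_num_adde_defr ?fin_num_measure// addeA subee ?add0e.
by rewrite sube0.
Qed.

Lemma truncation_level (eta : R) : 0 < eta -> exists2 K : R, 0 < K &
  expect P (fun w => `|excess K (xi w)|) <= eta.
Proof.
move=> eta0; set m := expect P h.
have m0 : 0 <= m by apply: Rintegral_ge0 => // w _; exact: powR_ge0.
have a0 : 0 < (m + 1) / eta by rewrite divr_gt0// ltr_wpDl.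
exists (((m + 1) / eta) `^ delta^-1); first exact: powR_gt0.
apply: le_trans (expect_excess_le _) _; first exact: powR_gt0.
rewrite -powRrM mulVf ?gt_eqF// powRr1 ?(ltW a0)// invf_div -/m.
rewrite mulrAC ler_pdivrMr ?ltr_wpDl// ler_wpM2l ?(ltW eta0)//; lra.
Qed.

(** The self-normalized law of large numbers, uniformly in the shape of the
    array and in the row. *)
Lemma expect_row_sum_cvg0 (eta : R) : 0 < eta ->
  exists N : nat, forall p n (X : 'I_p * 'I_n -> {RV P >-> R}) (i : 'I_p),
    (N <= n)%N -> (0 < n)%N ->
    mutually_independent X -> (forall e, identically_distributed (X e) xi) ->
    expect P (fun w => row_sum i (sample X w) ^+ 2) / n%:R <= eta.
Proof.
move=> eta0; have b0 := expect_min_sqr_gt0.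
set beta := expect P _ in b0; pose C := 1 + 2 / beta.
have C0 : 0 < C by rewrite ltr_pwDl// divr_ge0// ltW.
pose th := eta / (6 * C); have th0 : 0 < th by rewrite divr_gt0// mulr_gt0.
have [K K0 hK] := truncation_level th0.
pose A := (4 / beta ^+ 2 + C * ((2 * K) ^+ 2 / th)) * (2 / eta).
exists (Num.bound A) => p n X i Nn n0 X_indep X_id.
have n0' : 0 < n%:R :> R by rewrite ltr0n.
have tailE (c : R) : 0 <= c -> expect P (fun w => Num.min `|excess K (xi w)| c) <= th.
  by move=> c0; apply: le_trans hK; exact: expect_min_excess_le.
have mu_le := le_trans (expect_truncate_le K0) hK.
apply: le_trans (@expect_row_sum_le _ _ _ P xi p n X i X_indep X_id beta K th _ th
  n0 b0 (ltW K0) th0 erefl erefl tailE) _.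
set mu := expect P _ in mu_le *.
have An : A <= n%:R.
  apply: le_trans (ltW (archi_boundP _)) _; last by rewrite ler_nat.
  apply: mulr_ge0; last by rewrite divr_ge0 ?(ltW eta0).
  apply: addr_ge0; first by rewrite divr_ge0 ?sqr_ge0.
  by apply: mulr_ge0 (ltW C0) _; rewrite divr_ge0 ?sqr_ge0 ?(ltW th0).
have An' : (4 / beta ^+ 2 + C * ((2 * K) ^+ 2 / th)) / n%:R <= eta / 2.
  rewrite ler_pdivrMr//; set B := (X in X <= _).
  have -> : B = eta / 2 * A by rewrite /A -/B; field; rewrite gt_eqF.
  by rewrite ler_wpM2l// divr_ge0 ?(ltW eta0).
have Cth : C * th = eta / 6 by rewrite /th; field; rewrite gt_eqF.
have Cmu : C * `|mu| <= eta / 6 by rewrite -Cth ler_wpM2l ?(ltW C0).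
rewrite -/C.
have -> : 4 / beta ^+ 2 * (1 / n%:R) + C * (th + (2 * K) ^+ 2 / n%:R / th + `|mu| + th)
  = (4 / beta ^+ 2 + C * ((2 * K) ^+ 2 / th)) / n%:R + C * th + C * `|mu| + C * th.
  by field; rewrite !gt_eqF.
by move: An' Cth Cmu; lra.
Qed.

End Moments.

(** * The mean of W *)

Section QuadraticForms.
Variable R : realFieldType.

Lemma quad_sum n (Q : 'M[R]_n) (u : 'rV[R]_n) :
  quad Q u = \sum_j \sum_k u 0 j * u 0 k * Q j k.
Proof.
rewrite /quad mxE exchange_big /=; apply: eq_bigr => k _.
rewrite !mxE mulr_suml; apply: eq_bigr => j _.
by rewrite mulrAC.
Qed.

Lemma quad_delta2 n (Q : 'M[R]_n) (s : R) j k :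
  quad Q (delta_mx 0 j + s *: delta_mx 0 k)
    = Q j j + s * (Q j k + Q k j) + s ^+ 2 * Q k k.
Proof.
rewrite /quad linearD linearZ /= !mulmxDl !mulmxDr -!scalemxAl -!scalemxAr.
by rewrite !trmx_delta -!rowE -!colE !mxE; ring.
Qed.

(** Positivity on [e_j + e_k] and on [e_j - e_k]. *)
Lemma resolvent_entry_bound p n (Y : 'M[R]_(p, n)) (t : R) j k : 0 < t ->
  `|gram_resolvent Y t j k| <= t^-1.
Proof.
move=> t0; set Q := gram_resolvent Y t.
have Qd l : Q l l <= t^-1.
  have := quad_resolvent_le Y (delta_mx 0 l) t0.
  by rewrite quad_delta sqnorm_delta div1r.
have Qs : Q k j = Q j k.
  have := congr1 (fun M : 'M[R]_n => M j k) (gram_resolvent_sym Y t).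
  by rewrite mxE.
have h1 := quad_resolvent_ge0 Y (delta_mx 0 j + 1 *: delta_mx 0 k) t0.
have h2 := quad_resolvent_ge0 Y (delta_mx 0 j + (-1) *: delta_mx 0 k) t0.
rewrite -/Q !quad_delta2 Qs in h1 h2.
by rewrite ler_norml; have := Qd j; have := Qd k; move: h1 h2 => *;
   apply/andP; split; lra.
Qed.

End QuadraticForms.

Section ExchangeableColumns.
Context d (T : measurableType d) (R : realType) (P : probability T R).
Variables (xi : {RV P >-> R}) (p n : nat) (X : 'I_p * 'I_n -> {RV P >-> R}).
Local Notation config := (config ('I_p * 'I_n)%type R).
Hypothesis X_indep : mutually_independent X.
Hypothesis X_id : forall e, identically_distributed (X e) xi.
Variable i : 'I_p.
Hypothesis X_nz : {ae P, forall w, \sum_(j < n) X (i, j) w ^+ 2 != 0}.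

Let y (w : T) (j : 'I_n) : R := normalized (sample X w) i j.

Let bounded_rv_y j : bounded_rv (fun w => y w j).
Proof.
exact: (bounded_rv_comp (measurable_sample X) (bounded_rv_normalized R i j)).
Qed.

Let bounded_rv_yy j k : bounded_rv (fun w => y w j * y w k).
Proof.
by apply: bounded_rvM; exact: bounded_rv_y.
Qed.

Lemma expect_entries_permute (s : {perm 'I_n}) j k :
  expect P (fun w => y w j * y w k) = expect P (fun w => y w (s j) * y w (s k)).
Proof.
pose f (e : 'I_p * 'I_n) := (e.1, s e.2); pose g (e : 'I_p * 'I_n) := (e.1, s^-1%g e.2).
have fg : cancel f g by move=> [a b]; rewrite /f /g /= permK.
have gf : cancel g f by move=> [a b]; rewrite /f /g /= permKV.
have bF : bounded_rv (fun x : config => normalized x i j * normalized x i k).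
  by apply: bounded_rvM; exact: bounded_rv_normalized.
rewrite /y (expect_permute X_indep fg gf bF X_id); congr expect.
apply/funext => w.
have e l : normalized (fun e => X (f e) w) i l = normalized (sample X w) i (s l).
  rewrite !mxE; congr (_ / Num.sqrt _); rewrite [RHS](reindex_inj (@perm_inj _ s)).
  by apply: eq_bigr => m _; rewrite !mxE.
by rewrite !e.
Qed.

(** Two transpositions bring any pair of columns to any other. *)
Lemma expect_entries_exchangeable j k j' k' : (j == k) = (j' == k') ->
  expect P (fun w => y w j * y w k) = expect P (fun w => y w j' * y w k').
Proof.
have [<-|jk] := eqVneq j k => /esym; first move=> /eqP <-.
  by rewrite (expect_entries_permute (tperm j j')) tpermL.
move=> jk'; pose a := tperm j j' k.
have aj' : a != j'.
  apply: contraNneq jk => e; apply/eqP/(@perm_inj _ (tperm j j')).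
  by rewrite tpermL -/a e.
rewrite (expect_entries_permute (tperm j j' * tperm a k')%g) !permM tpermL -/a tpermL.
by rewrite tpermD// eq_sym jk'.
Qed.

Lemma expect_sqnorm_row : \sum_j expect P (fun w => y w j * y w j) = 1.
Proof.
rewrite -expect_sum// -[RHS](expect_cst P 1); apply: ae_eq_expect.
- by apply: bounded_rv_sum => j.
- exact: bounded_rv_cst.
apply: filterS X_nz => w nz.
rewrite -(sqnorm_row_normalized_eq1 (x := sample X w) nz) /sqnorm.
by apply: eq_bigr => j _; rewrite [in RHS]mxE expr2.
Qed.

Lemma bounded_rv_loo_entry j k (t : R) : 0 < t ->
  bounded_rv (fun x : config => gram_resolvent (zero_row i (normalized x)) t j k).
Proof.
move=> t0; split.
  by apply: measurable_gram_resolvent => //; exact: measurable_zero_row.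
by exists t^-1 => x; exact: resolvent_entry_bound.
Qed.

(** The row is independent of the leave-one-out resolvent. *)
Lemma expect_loo_quad (t : R) : 0 < t ->
  expect P (fun w => loo_quad (normalized (sample X w)) t i)
    = \sum_j \sum_k expect P (fun w => y w j * y w k)
        * expect P (fun w =>
            gram_resolvent (zero_row i (normalized (sample X w))) t j k).
Proof.
move=> t0.
have bB j k := bounded_rv_loo_entry j k t0.
have bBs j k := bounded_rv_comp (measurable_sample X) (bB j k).
have -> : (fun w => loo_quad (normalized (sample X w)) t i)
   = (fun w => \sum_j \sum_k (y w j * y w k
        * gram_resolvent (zero_row i (normalized (sample X w))) t j k)).
  apply/funext => w; rewrite /loo_quad quad_sum; apply: eq_bigr => j _.
  by apply: eq_bigr => k _; rewrite ![row _ _ _ _]mxE.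
rewrite expect_sum; last first.
  by move=> j; apply: bounded_rv_sum => k; exact: (bounded_rvM (bounded_rv_yy j k) (bBs j k)).
apply: eq_bigr => j _; rewrite expect_sum; last first.
  by move=> k; exact: (bounded_rvM (bounded_rv_yy j k) (bBs j k)).
apply: eq_bigr => k _.
have bF : bounded_rv (fun x : config => normalized x i j * normalized x i k).
  by apply: bounded_rvM; exact: bounded_rv_normalized.
apply: (expect_indep_mul (J := [set e : 'I_p * 'I_n | e.1 == i]%SET) X_indep bF (bB j k)).
  move=> x x' xx'; have e l : x (i, l) = x' (i, l) by apply: xx'; rewrite inE.
  by rewrite !(normalized_eq_row e).
move=> x x' xx'; congr (gram_resolvent _ t j k); apply/matrixP => a b.
rewrite ![zero_row _ _ _ _]mxE; have [//|ai] := eqVneq a i.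
by apply: normalized_eq_row => l; apply: xx'; rewrite !inE.
Qed.

(** The entries of a row are exchangeable, so [y^T y] has mean
    [c 1^T 1 + (1/n - c) I] with [c] the common mean of [y_j y_k]. The mean of
    the quadratic form thus deviates from that of the trace by [c] times at most
    [n / t], while the square of the row sum has mean [1 + n (n - 1) c]. *)
Lemma expect_real_W_le (t : R) : 0 < t -> (1 < n)%N ->
  `|expect P (fun w => real_W i (normalized (sample X w)) t)|
    <= 2 / t * (expect P (fun w => row_sum i (sample X w) ^+ 2) / n%:R + n%:R^-1).
Proof.
move=> t0 n1; have n0' : 0 < n%:R :> R by rewrite ltr0n (ltn_trans _ n1).
have n1' : 2 <= n%:R :> R by rewrite (ler_nat _ 2).
pose j0 := Ordinal (ltn_trans (ltn0Sn 0) n1); pose k0 := Ordinal n1.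
set c := expect P (fun w => y w j0 * y w k0).
have cjk j k : expect P (fun w => y w j * y w k) = c + (n%:R^-1 - c) * (j == k)%:R.
  have [<-|jk] := eqVneq j k; last first.
    by rewrite mulr0 addr0; apply: expect_entries_exchangeable; rewrite (negbTE jk).
  rewrite mulr1 addrC subrK; apply: (mulfI (lt0r_neq0 n0')); rewrite divff ?gt_eqF//.
  rewrite -[RHS]expect_sqnorm_row.
  rewrite (eq_bigr (fun=> expect P (fun w => y w j * y w j))) => [|l _].
    by rewrite sumr_const card_ord mulr_natl.
  by apply: expect_entries_exchangeable; rewrite !eqxx.
pose b j k := expect P (fun w =>
  gram_resolvent (zero_row i (normalized (sample X w))) t j k).
have double_sum (f : 'I_n -> 'I_n -> R) :
    \sum_j \sum_k (c + (n%:R^-1 - c) * (j == k)%:R) * f j k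
    = c * (\sum_j \sum_k f j k) + (n%:R^-1 - c) * \sum_j f j j.
  rewrite !mulr_sumr -big_split /=; apply: eq_bigr => j _.
  rewrite (bigD1 j)//= eqxx mulr1 [in RHS](bigD1 j)//= mulrDr.
  rewrite mulrDl -!addrA; congr (_ + _); rewrite addrC; congr (_ + _).
  rewrite mulr_sumr; apply: eq_bigr => k kj.
  by rewrite eq_sym (negbTE kj) mulr0 addr0.
have bB j k := bounded_rv_loo_entry j k t0.
have bBs j k := bounded_rv_comp (measurable_sample X) (bB j k).
have bq := bounded_rv_comp (measurable_sample X) (bounded_rv_loo_quad n i t0).
have trE : \sum_j b j j = expect P (fun w =>
    \tr (gram_resolvent (zero_row i (normalized (sample X w))) t)).
  by rewrite -expect_sum.
have btr : bounded_rv (fun w =>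
    \tr (gram_resolvent (zero_row i (normalized (sample X w))) t)).
  by apply: bounded_rv_sum => j.
have sumE : \sum_j \sum_k b j k = expect P (fun w =>
    quad (gram_resolvent (zero_row i (normalized (sample X w))) t) (const_mx 1)).
  under eq_bigr do rewrite -expect_sum//.
  rewrite -expect_sum; last by move=> j; apply: bounded_rv_sum => k.
  congr expect; apply/funext => w; rewrite quad_sum; apply: eq_bigr => j _.
  by apply: eq_bigr => k _; rewrite !mxE !mul1r.
have bquad : bounded_rv (fun w =>
    quad (gram_resolvent (zero_row i (normalized (sample X w))) t) (const_mx 1)).
  have -> : (fun w =>
      quad (gram_resolvent (zero_row i (normalized (sample X w))) t) (const_mx 1))
    = (fun w => \sum_j \sum_k
        gram_resolvent (zero_row i (normalized (sample X w))) t j k).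
    apply/funext => w; rewrite quad_sum; apply: eq_bigr => j _.
    by apply: eq_bigr => k _; rewrite !mxE !mul1r.
  by apply: bounded_rv_sum => j; apply: bounded_rv_sum => k.
have WE : expect P (fun w => real_W i (normalized (sample X w)) t)
    = c * (\sum_j \sum_k b j k - \sum_j b j j).
  rewrite expectB//; last exact: bounded_rvZ.
  rewrite expect_loo_quad// expectZ// -trE.
  under eq_bigr do under eq_bigr do rewrite cjk.
  by rewrite double_sum -/b; ring.
have VE : expect P (fun w => row_sum i (sample X w) ^+ 2) = 1 + n%:R * (n%:R - 1) * c.
  have -> : (fun w => row_sum i (sample X w) ^+ 2)
      = (fun w => \sum_j \sum_k (y w j * y w k)).
    by apply/funext => w; rewrite expr2 mulr_suml; apply: eq_bigr => j _;
       rewrite mulr_sumr.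
  rewrite expect_sum; last by move=> j; apply: bounded_rv_sum => k.
  under eq_bigr do rewrite expect_sum//.
  transitivity (\sum_(j < n) \sum_(k < n) (c + (n%:R^-1 - c) * (j == k)%:R) * 1).
    by apply: eq_bigr => j _; apply: eq_bigr => k _; rewrite cjk mulr1.
  rewrite double_sum !sumr_const !card_ord -[n%:R *+ n]mulr_natl.
  by field; rewrite gt_eqF.
have b1 : 0 <= \sum_j b j j <= n%:R / t.
  rewrite trE; apply/andP; split.
    by apply: expect_ge_cst => // w; exact: trace_resolvent_ge0.
  by apply: expect_le_cst => // w; exact: trace_resolvent_le.
have b2 : 0 <= \sum_j \sum_k b j k <= n%:R / t.
  rewrite sumE; apply/andP; split.
    by apply: expect_ge_cst => // w; exact: quad_resolvent_ge0.
  apply: expect_le_cst => // w; apply: le_trans (quad_resolvent_le _ _ t0) _.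
  rewrite ler_wpM2r ?invr_ge0 ?(ltW t0)// /sqnorm.
  under eq_bigr do rewrite mxE expr1n.
  by rewrite sumr_const card_ord.
have V0 : 0 <= expect P (fun w => row_sum i (sample X w) ^+ 2).
  apply: expect_ge_cst => [|w]; last exact: sqr_ge0.
  have br : bounded_rv (fun w => row_sum i (sample X w)).
    apply: (bounded_rv_comp (measurable_sample X)).
    by apply: bounded_rv_sum => j; exact: bounded_rv_normalized.
  exact: (bounded_rvM br br).
set V := expect P _ in V0 VE *.
have cn : `|c| * n%:R <= 2 * (V / n%:R + n%:R^-1).
  have h : n%:R * ((n%:R - 1) * `|c|) <= V + 1.
    have -> : n%:R * ((n%:R - 1) * `|c|) = `|V - 1|.
      have -> : V - 1 = n%:R * (n%:R - 1) * c by rewrite VE; ring.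
      have n10 : 0 <= n%:R - 1 :> R by rewrite subr_ge0 ler1n ltnW.
      by rewrite !normrM (ger0_norm (ltW n0')) (ger0_norm n10) mulrA.
    by apply: le_trans (ler_normB _ _) _; rewrite normr1 ger0_norm.
  have -> : 2 * (V / n%:R + n%:R^-1) = 2 * (V + 1) / n%:R by ring.
  rewrite ler_pdivlMr//.
  apply: le_trans (_ : 2 * (n%:R * ((n%:R - 1) * `|c|)) <= _); last by rewrite ler_pM2l.
  have := mulr_ge0 (ltW n0') (normr_ge0 c) => h0.
  have : 0 <= (n%:R - 2) * (n%:R * `|c|) by rewrite mulr_ge0// subr_ge0.
  by move: h0; lra.
rewrite WE normrM.
have h : `|\sum_j \sum_k b j k - \sum_j b j j| <= n%:R / t.
  rewrite ler_norml; move/andP: b1 => [? ?]; move/andP: b2 => [? ?].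
  by apply/andP; split; lra.
apply: le_trans (ler_wpM2l (normr_ge0 c) h) _.
by rewrite mulrA [2 / t * _]mulrAC ler_wpM2r ?invr_ge0 ?(ltW t0).
Qed.

End ExchangeableColumns.

(** * Convergence of bounded random variables *)

Section Convergence.
Context d (T : measurableType d) (R : realType) (P : probability T R).
Implicit Types (f : T -> R) (g : nat -> T -> R).

Lemma expect_le_tail f (M eps a : R) : bounded_rv f -> 0 <= M -> 0 < eps ->
  (forall w, f w <= M) -> (P [set w | (eps < f w)%R] <= a%:E)%E ->
  expect P f <= eps + M * a.
Proof.
move=> bf M0 e0 fM Pa; have [mf _] := bf.
have b1 := bounded_rv_superlevel eps mf.
rewrite probability_superlevel// lee_fin in Pa.
apply: le_trans (_ : eps + M * expect P \1_[set w | eps < f w] <= _).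
  rewrite -[X in X + _](expect_cst P eps) -(expectZ P M b1) -expectD.
  - apply: expect_le => //; first by apply: bounded_rvD (bounded_rv_cst T eps) (bounded_rvZ _ b1).
    move=> w; rewrite indicE; have [_|/negP h] := boolP (w \in _).
      by rewrite mulr1; apply: le_trans (fM w) _; rewrite lerDr ltW.
    by rewrite mulr0 addr0 leNgt; apply/negP => ew; apply: h; rewrite inE.
  - exact: bounded_rv_cst.
  - exact: bounded_rvZ.
by rewrite lerD2l ler_wpM2l.
Qed.

Lemma expect_cvg0_of_probability g (M : R) : 0 <= M -> (forall n, bounded_rv (g n)) ->
  (forall n w, 0 <= g n w <= M) ->
  (forall eps, 0 < eps -> P [set w | (eps < g n w)%R] @[n --> \oo] --> 0%E) ->
  expect P (g n) @[n --> \oo] --> 0.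
Proof.
move=> M0 bg gM gP; apply/cvgr0Pnorm_le => eps eps0; have e20 : 0 < eps / 2 by rewrite divr_gt0.
have := gP _ e20; move=> /fine_cvgP[Pfin /cvgr0Pnorm_le].
have a0 : 0 < eps / (2 * (M + 1)) by rewrite divr_gt0// mulr_gt0// ltr_wpDl.
move=> /(_ _ a0) Psmall; near=> n.
have ge0 : 0 <= expect P (g n).
  by apply: expect_ge_cst => // w; have /andP[] := gM n w.
rewrite ger0_norm//.
have h : (P [set w | (eps / 2 < g n w)%R] <= (eps / (2 * (M + 1)))%:E)%E.
  have fn : P [set w | eps / 2 < g n w] \is a fin_num by near: n.
  rewrite -(fineK fn) lee_fin; apply: le_trans (ler_norm _) _.
  by near: n.
have gM' w : g n w <= M by have /andP[] := gM n w.
apply: le_trans (expect_le_tail (bg n) M0 e20 gM' h) _.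
rewrite -lerBrDl; have -> : eps - eps / 2 = eps / 2 by field.
rewrite mulrA ler_pdivrMr ?mulr_gt0 ?ltr_wpDl//.
have -> : eps / 2 * (2 * (M + 1)) = eps * (M + 1) by field.
by rewrite mulrC ler_pM2l// lerDl.
Unshelve. all: by end_near. Qed.

Lemma bounded_convergence g (M l : R) : (forall n, bounded_rv (g n)) ->
  (forall n w, `|g n w| <= M) -> {ae P, forall w, g n w @[n --> \oo] --> l} ->
  expect P (g n) @[n --> \oo] --> l.
Proof.
move=> bg gM gl.
have mg n : measurable_fun setT (EFin \o g n) by apply/measurable_EFinP; have [] := bg n.
have mc : measurable_fun setT (EFin \o (fun _ : T => l)).
  by apply/measurable_EFinP; exact: measurable_cst.
have h1 : {ae P, forall w, setT w -> (EFin \o g n) w @[n --> \oo] --> (EFin \o (fun _ : T => l)) w}.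
  by apply: filterS gl => w gw _; apply: cvg_EFin => //; exact: nearW.
have iM := finite_measure_integrable_cst P M (@measurableT _ T).
have h2 : {ae P, forall w n, setT w -> (`|(EFin \o g n) w| <= (EFin \o cst M) w)%E}.
  by apply: nearW => w n _; rewrite lee_fin.
have [_ _] := dominated_convergence measurableT mg mc h1 iM h2.
have -> : (\int[P]_w (EFin \o (fun=> l)) w)%E = l%:E.
  rewrite -[RHS](congr1 EFin (expect_cst P l)) /expect /Rintegral fineK//.
  exact: (integrable_fin_num measurableT (bounded_rv_integrable P (bounded_rv_cst T l))).
exact: fine_cvg.
Qed.

Lemma geometric_partial_sum_le (r : R) k : 0 <= r < 1 ->
  \sum_(0 <= n < k) r ^+ n <= (1 - r)^-1.
Proof.
move=> /andP[r0 r1]; have r10 : 0 < 1 - r by rewrite subr_gt0.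
rewrite -[leRHS]mul1r ler_pdivlMr//.
have -> : (\sum_(0 <= n < k) r ^+ n) * (1 - r) = 1 - r ^+ k.
  elim: k => [|k ih]; first by rewrite big_nil mul0r expr0 subrr.
  by rewrite big_nat_recr//= mulrDl ih exprS; ring.
by rewrite gerBl exprn_ge0.
Qed.

(** The Borel--Cantelli lemma, the rate being that of a geometric series. *)
Lemma ae_eventually_le (f : nat -> T -> R) (eps a C : R) (N : nat) :
  (forall n, measurable_fun setT (f n)) -> 0 < a -> 0 <= C ->
  (forall n, (N <= n)%N -> (P [set w | (eps < f n w)%R] <= (C * expR (- a * n%:R))%:E)%E) ->
  {ae P, forall w, \forall n \near \oo, f n w <= eps}.
Proof.
move=> mf a0 C0 hP.
pose F n := if (N <= n)%N then [set w | eps < f n w] else set0.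
have mF n : measurable (F n).
  by rewrite /F; case: ifP => // _; exact: measurable_superlevel.
pose r := expR (- a : R).
have r01 : 0 <= r < 1 by rewrite expR_ge0 expR_lt1 oppr_lt0.
have PF n : (P (F n) <= (C * r ^+ n)%:E)%E.
  rewrite /F; case: ifP => [Nn|_]; last first.
    by rewrite measure0 lee_fin mulr_ge0// exprn_ge0// expR_ge0.
  apply: le_trans (hP _ Nn) _; rewrite lee_fin ler_wpM2l//.
  by rewrite /r -expRM_natr mulrC mulrC.
have s : (\sum_(n <oo) P (F n) < +oo)%E.
  apply: (@le_lt_trans _ _ (C / (1 - r))%:E); last exact: ltry.
  apply: lime_le; first by apply: is_cvg_nneseries => n _ _; exact: measure_ge0.
  apply: nearW => k; apply: le_trans (_ : (\sum_(0 <= n < k) (C * r ^+ n)%:E <= _)%E).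
    by apply: lee_sum => n _.
  rewrite sumEFin lee_fin -mulr_sumr ler_wpM2l//.
  exact: geometric_partial_sum_le.
have l0 := lim_sup_set_cvg0 mF s.
exists (lim_sup_set F); split => //.
  by apply: bigcapT_measurable => n; apply: bigcup_measurable => k _.
move=> w /= nw n _ /=; apply: contrapT => h; apply: nw.
exists (maxn n N) => // k /= nk; rewrite leNgt; apply/negP => ek; apply: h.
exists k; first exact: leq_trans (leq_maxl _ _) nk.
by rewrite /F (leq_trans (leq_maxr _ _) nk).
Qed.

End Convergence.

(** * The mean trace of the resolvent *)

Section RowPermutations.
Variable R : realFieldType.

Lemma gram_row_perm p n (s : {perm 'I_p}) (Y : 'M[R]_(p, n)) :
  (row_perm s Y)^T *m row_perm s Y = Y^T *m Y.
Proof.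
apply/matrixP => j k; rewrite !mxE [RHS](reindex_inj (@perm_inj _ s)).
by apply: eq_bigr => i _; rewrite !mxE.
Qed.

Lemma loo_quad_row_perm p n (s : {perm 'I_p}) (Y : 'M[R]_(p, n)) t i :
  loo_quad (row_perm s Y) t i = loo_quad Y t (s i).
Proof.
rewrite /loo_quad /gram_resolvent.
have -> : zero_row i (row_perm s Y) = row_perm s (zero_row (s i) Y).
  by apply/matrixP => k j; rewrite !mxE (inj_eq perm_inj).
rewrite gram_row_perm; congr quad; apply/rowP => j; by rewrite !mxE.
Qed.

End RowPermutations.

Section SelfConsistency.
Context d (T : measurableType d) (R : realType) (P : probability T R).
Variables (xi : {RV P >-> R}) (p n : nat) (X : 'I_p * 'I_n -> {RV P >-> R}).
Local Notation config := (config ('I_p * 'I_n)%type R).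
Hypothesis X_indep : mutually_independent X.
Hypothesis X_id : forall e, identically_distributed (X e) xi.
Variables (t : R).
Hypothesis t0 : 0 < t.
Local Notation Y w := (normalized (sample X w)).

Lemma bounded_rv_inv_loo_quad (i : 'I_p) :
  bounded_rv (fun x : config => (1 + loo_quad (normalized x) t i)^-1).
Proof.
have [mq _] := bounded_rv_loo_quad n i t0; split.
  apply: measurable_funV; apply: measurable_funD => //; exact: measurable_cst.
exists 1 => x; have /andP[q0 _] := loo_quad_bound x i t0.
have q1 : 1 <= 1 + loo_quad (normalized x) t i by rewrite lerDl.
by rewrite ger0_norm ?invr_ge0 ?invf_le1// (lt_le_trans _ q1, le_trans _ q1).
Qed.

Lemma expect_inv_loo_quad (i k : 'I_p) :
  expect P (fun w => (1 + loo_quad (Y w) t i)^-1)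
    = expect P (fun w => (1 + loo_quad (Y w) t k)^-1).
Proof.
pose s := tperm i k.
pose f (e : 'I_p * 'I_n) := (s e.1, e.2).
have ff : cancel f f by move=> [a b]; rewrite /f /s /= tpermK.
rewrite (expect_permute X_indep ff ff (bounded_rv_inv_loo_quad i) X_id).
congr expect; apply/funext => w; congr (1 + _)^-1.
have -> : normalized (fun e => X (f e) w) = row_perm s (Y w).
  apply/matrixP => a b; rewrite !mxE; congr (_ / Num.sqrt _).
  by apply: eq_bigr => l _; rewrite !mxE.
by rewrite loo_quad_row_perm tpermL.
Qed.

Lemma measurable_normalized_id : entrywise (fun f : config -> R => measurable_fun setT f)
  (fun x : config => normalized x).
Proof. exact: measurable_normalized. Qed.

Lemma bounded_rv_mean_trace_normalized :
  bounded_rv (fun x : config => mean_trace (normalized x) t).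
Proof. by apply: bounded_rv_mean_trace => //; exact: measurable_normalized_id. Qed.

(** The rows being exchangeable, all the terms of the trace formula have the
    same mean. *)
Lemma expect_self_consistent (i : 'I_p) : (0 < n)%N ->
  t * expect P (fun w => mean_trace (Y w) t)
    = 1 - p%:R / n%:R
      + p%:R / n%:R * expect P (fun w => (1 + loo_quad (Y w) t i)^-1).
Proof.
move=> n0; have n0' : 0 < n%:R :> R by rewrite ltr0n.
have bs := bounded_rv_comp (measurable_sample X) bounded_rv_mean_trace_normalized.
have bq k := bounded_rv_comp (measurable_sample X) (bounded_rv_inv_loo_quad k).
rewrite -expectZ//.
have -> : (fun w => t * mean_trace (Y w) t)
    = (fun w => (1 - p%:R / n%:R) + n%:R^-1 * \sum_k (1 + loo_quad (Y w) t k)^-1).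
  apply/funext => w; rewrite /mean_trace mulrCA trace_resolvent_self_consistent//.
  by field; rewrite gt_eqF.
have bS : bounded_rv (fun w => \sum_k (1 + loo_quad (Y w) t k)^-1).
  by apply: bounded_rv_sum => k.
rewrite expectD ?expect_cst ?expectZ//; [|exact: bounded_rv_cst|exact: bounded_rvZ].
rewrite expect_sum//; congr (_ + _).
rewrite (eq_bigr (fun=> expect P (fun w => (1 + loo_quad (Y w) t i)^-1))) => [|k _].
  by rewrite sumr_const card_ord -[expect _ _ *+ p]mulr_natl; ring.
exact: expect_inv_loo_quad.
Qed.

(** The quadratic form is replaced by the leave-one-out trace, then by the
    trace, then by the constant [c]. *)
Lemma inv_loo_quad_dist (x : config) (i : 'I_p) (c : R) : 0 <= c ->
  `|(1 + loo_quad (normalized x) t i)^-1 - (1 + c)^-1|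
    <= `|real_W i (normalized x) t| + (n%:R * t)^-1
       + `|mean_trace (normalized x) t - c|.
Proof.
move=> c0; have /andP[q0 _] := loo_quad_bound x i t0.
have q1 : 0 < 1 + loo_quad (normalized x) t i by rewrite ltr_wpDr.
have c1 : 0 < 1 + c by rewrite ltr_wpDr.
have -> : (1 + loo_quad (normalized x) t i)^-1 - (1 + c)^-1
    = (c - loo_quad (normalized x) t i)
      * ((1 + loo_quad (normalized x) t i)^-1 * (1 + c)^-1).
  by field; rewrite !gt_eqF.
rewrite normrM; apply: (@le_trans _ _ (`|c - loo_quad (normalized x) t i|)).
  rewrite ler_piMr// ger0_norm ?mulr_ge0 ?invr_ge0 ?(ltW q1) ?(ltW c1)//.
  by rewrite mulr_ile1 ?invr_ge0 ?(ltW q1) ?(ltW c1)// invf_le1// lerDl.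
have := mean_trace_loo (normalized x) i t0.
set a := mean_trace (zero_row _ _) _; set b := mean_trace _ _ => ab.
rewrite distrC.
have -> : loo_quad (normalized x) t i - c = real_W i (normalized x) t + (a - b) + (b - c).
  by rewrite /real_W -/a; ring.
apply: le_trans (ler_normD _ _) _; rewrite lerD2r.
by apply: le_trans (ler_normD _ _) _; rewrite lerD2l.
Qed.

(** The mean trace moves by at most [1 / (n t)] when a row is replaced, whence
    a subgaussian bound; only its decay in [n] matters. *)
Lemma mean_trace_tail (K eps alpha : R) : (0 < n)%N -> 0 < alpha ->
  alpha <= t / 2 -> 4 * K * alpha <= eps * t ^+ 2 -> p%:R <= K * n%:R ->
  (P [set w | (eps < `|mean_trace (Y w) t
      - expect P (fun w => mean_trace (Y w) t)|)%R]
    <= (2 * expR (- (alpha * eps / 2) * n%:R))%:E)%E.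
Proof.
move=> n0 a0 at2 Ka pK; have n0' : 0 < n%:R :> R by rewrite ltr0n.
have lam0 : 0 < n%:R * alpha by rewrite mulr_gt0.
have lc : n%:R * alpha * (n%:R * t)^-1 = alpha / t by field; rewrite !gt_eqF.
have lc2 : n%:R * alpha * (n%:R * t)^-1 <= 2^-1.
  by rewrite lc ler_pdivrMr// mulrC.
have bd (i : 'I_p) (x y : config) : (forall e : 'I_p * 'I_n, e.1 != i -> x e = y e) ->
    `|mean_trace (normalized x) t - mean_trace (normalized y) t| <= (n%:R * t)^-1.
  move=> xy; apply: (mean_trace_bounded_difference (i := i)) => // k ki j.
  by apply: normalized_eq_row => l; apply: xy.
have h := @bounded_difference_tail _ _ _ P _ X p fst
  (fun x => mean_trace (normalized x) t) _ _ eps X_indep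
  bounded_rv_mean_trace_normalized lam0 lc2 bd.
apply: le_trans h _; rewrite lee_fin ler_pM2l// ler_expR lc.
have : p%:R * (alpha / t) ^+ 2 <= K * n%:R * (alpha / t) ^+ 2.
  by rewrite ler_wpM2r ?sqr_ge0.
have : n%:R * (alpha / t ^+ 2) * (4 * K * alpha) <= n%:R * (alpha / t ^+ 2) * (eps * t ^+ 2).
  by rewrite ler_wpM2l// mulr_ge0 ?divr_ge0 ?sqr_ge0 ?(ltW a0) ?(ltW n0').
have -> : n%:R * (alpha / t ^+ 2) * (eps * t ^+ 2) = n%:R * alpha * eps.
  by field; rewrite gt_eqF.
have -> : n%:R * (alpha / t ^+ 2) * (4 * K * alpha) = 4 * (K * n%:R * (alpha / t) ^+ 2).
  by field; rewrite gt_eqF.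
lra.
Qed.

End SelfConsistency.

(** * Limits of traces and of W *)

Section RealLimits.
Variable R : realType.
Implicit Types u v : nat -> R.

Lemma cvg_of_dist_le u v l : (\forall n \near \oo, `|u n - l| <= v n) ->
  v n @[n --> \oo] --> 0 -> u n @[n --> \oo] --> l.
Proof.
move=> uv v0; apply/cvgrPdist_le => eps eps0.
move/cvgr0Pnorm_le: v0 => /(_ _ eps0) v0; near=> n; rewrite distrC.
have h : `|u n - l| <= v n by near: n.
by apply: le_trans h (le_trans (ler_norm _) _); near: n.
Unshelve. all: by end_near. Qed.

Lemma cvg_natV : (n%:R^-1 : R) @[n --> \oo] --> 0.
Proof.
have pos : \forall n \near \oo, (0 : R) < n%:R.
  by near=> n; rewrite ltr0n; near: n; exact: nbhs_infty_gt.
exact: (gtr0_cvgV0 pos).2 (@cvgr_idn R).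
Unshelve. all: by end_near. Qed.

Lemma cvg_natMV (t : R) : ((n%:R * t)^-1 : R) @[n --> \oo] --> 0.
Proof.
rewrite -[X in _ --> X](mul0r t^-1).
under eq_cvg do rewrite invfM; apply: cvgM; [exact: cvg_natV|exact: cvg_cst].
Qed.

End RealLimits.

Section SpectrumAndTrace.
Variable R : realType.

(** The eigenvalues of [Y Y^T] against the trace for [Y^T Y]: the two spectra
    differ by [|p - n|] zeros. *)
Lemma sample_corr_spectrum p n (Y : 'M[R]_(p, n)) :
  [/\ size (eigenvalues (sample_corr Y)) = p,
      forall l, l \in eigenvalues (sample_corr Y) -> 0 <= l &
      forall t, 0 < t -> (0 < n)%N -> (0 < p)%N ->
        t * mean_trace Y t = 1 - p%:R / n%:R + p%:R / n%:R
          * (t * empirical_mean (eigenvalues (sample_corr Y)) (fun x => (x + t)^-1))].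
Proof.
have [d [d0 dE trE]] := eigenvalues_gram Y^T; rewrite trmxK -/(sample_corr Y) in dE.
have sz : size (eigenvalues (sample_corr Y)) = p.
  by rewrite (perm_size dE) size_codom card_ord.
split=> // [l|t t0 n0 p0].
  by rewrite (perm_mem dE) => /codomP[k ->].
have n0' : 0 < n%:R :> R by rewrite ltr0n.
have p0' : 0 < p%:R :> R by rewrite ltr0n.
rewrite /empirical_mean sz (perm_big _ dE) /= big_map big_enum /= -trE//.
have := trace_companion Y t0; rewrite /mean_trace.
set A := \tr _; set B := \tr _ => AB.
have -> : t * (p%:R^-1 * A) = p%:R^-1 * (t * A) by ring.
by rewrite AB; field; rewrite !gt_eqF.
Qed.

End SpectrumAndTrace.

Section Limits.
Context d (T : measurableType d) (R : realType) (P : probability T R).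
Variables (xi : {RV P >-> R}) (p : nat -> nat) (p_gt0 : forall n, (0 < p n)%N).
Variable (X : forall n, 'I_(p n) * 'I_n -> {RV P >-> R}).
Hypothesis X_indep : forall n, mutually_independent (@X n).
Hypothesis X_id : forall n e, identically_distributed (@X n e) xi.
Variable (gamma : R).
Hypothesis gamma_gt0 : 0 < gamma.
Hypothesis p_ratio : (p n)%:R / n%:R @[n --> \oo] --> gamma.
Local Notation Y n w := (normalized (sample (@X n) w)).
Local Notation i0 n := (Ordinal (p_gt0 n)).

Let s (t : R) n w := mean_trace (Y n w) t.
Let q (t : R) n w := loo_quad (Y n w) t (i0 n).
Let rW (t : R) n w := real_W (i0 n) (Y n w) t.

Let bs t n : 0 < t -> bounded_rv (s t n).
Proof.
move=> t0; exact: (bounded_rv_comp (measurable_sample (@X n))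
  (bounded_rv_mean_trace_normalized (p n) n t0)).
Qed.

Let bq t n : 0 < t -> bounded_rv (q t n).
Proof.
move=> t0; exact: (bounded_rv_comp (measurable_sample (@X n))
  (bounded_rv_loo_quad n (i0 n) t0)).
Qed.

Let bV t n : 0 < t -> bounded_rv (fun w => (1 + q t n w)^-1).
Proof.
move=> t0; exact: (bounded_rv_comp (measurable_sample (@X n))
  (bounded_rv_inv_loo_quad n t0 (i0 n))).
Qed.

Let bW t n : 0 < t -> bounded_rv (rW t n).
Proof.
move=> t0; exact: (bounded_rv_comp (measurable_sample (@X n))
  (bounded_rv_real_W n (i0 n) t0)).
Qed.

Let s_bound t n w : 0 < t -> 0 <= s t n w <= t^-1.
Proof. exact: mean_trace_bound. Qed.

Let q_bound t n w : 0 < t -> 0 <= q t n w <= t^-1.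
Proof. exact: loo_quad_bound. Qed.

(** With [K] above [gamma] and [alpha] small, the exponent of the tail bound is
    at most a negative multiple of [n]. *)
Lemma mean_trace_tail_eventually (t eps : R) : 0 < t -> 0 < eps ->
  exists (a : R) (N : nat), 0 < a /\ forall n, (N <= n)%N ->
    (P [set w | (eps < `|s t n w - expect P (s t n)|)%R]
      <= (2 * expR (- a * n%:R))%:E)%E.
Proof.
move=> t0 eps0; pose K := gamma + 1; have K0 : 0 < K by rewrite addr_gt0.
have : \forall n \near \oo, (p n)%:R / n%:R < K :> R.
  by apply: (cvgr_lt gamma) => //; rewrite ltrDl.
move=> [N _ hN]; pose alpha := Num.min (t / 2) (eps * t ^+ 2 / (4 * K)).
have al0 : 0 < alpha.
  by rewrite lt_min divr_gt0//= divr_gt0// mulr_gt0// exprn_gt0.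
exists (alpha * eps / 2), (maxn N 1); split; first by rewrite divr_gt0// mulr_gt0.
move=> n; rewrite geq_max => /andP[Nn n0].
apply: (mean_trace_tail (@X_indep n) t0 (K := K)) => //.
- by rewrite ge_min lexx.
- rewrite mulrC -ler_pdivlMr ?mulr_gt0//.
  by rewrite ge_min lexx orbT.
by rewrite -ler_pdivrMr ?ltr0n// ltW// hN.
Qed.

(** For bounded variables convergence in probability implies convergence in
    mean. *)
Lemma cvg_expect_mean_trace_dist (t : R) : 0 < t ->
  expect P (fun w => `|s t n w - expect P (s t n)|) @[n --> \oo] --> 0.
Proof.
move=> t0; have ti : 0 <= t^-1 by rewrite invr_ge0 ltW.
have be n : 0 <= expect P (s t n) <= t^-1.
  apply/andP; split; [apply: expect_ge_cst|apply: expect_le_cst];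
  by [exact: bs|move=> w; have /andP[] := s_bound n w t0].
apply: (expect_cvg0_of_probability (M := t^-1)) => //.
- by move=> n; apply/bounded_rv_norm/bounded_rvB; [exact: bs|exact: bounded_rv_cst].
- move=> n w; rewrite normr_ge0 /= ler_norml.
  have /andP[? ?] := s_bound n w t0; have /andP[? ?] := be n.
  by apply/andP; split; lra.
move=> eps eps0; have [a [N [a0 h]]] := mean_trace_tail_eventually t0 eps0.
apply: (squeeze_cvge (f := cst 0%E) (h := fun n => (2 * expR (- a * n%:R))%:E)).
- by exists N => // n /= Nn; rewrite h// andbT measure_ge0.
- exact: cvg_cst.
apply: cvg_EFin; first exact: nearW.
rewrite -[X in _ --> X](mulr0 2); apply: cvgM; first exact: cvg_cst.
have -> : (fun n : nat => expR (- a * n%:R)) = GRing.exp (expR (- a)).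
  by apply/funext => n; rewrite expRM_natr.
by apply: cvg_expr; rewrite ger0_norm ?expR_ge0// expR_lt1 oppr_lt0.
Qed.

(** Borel--Cantelli for the tolerances [1 / (m + 1)]. *)
Lemma ae_cvg_mean_trace (t l : R) : 0 < t ->
  expect P (s t n) @[n --> \oo] --> l ->
  {ae P, forall w, s t n w @[n --> \oo] --> l}.
Proof.
move=> t0 el.
have h (m : nat) : {ae P, forall w, \forall n \near \oo,
    `|s t n w - expect P (s t n)| <= m.+1%:R^-1}.
  have m0 : 0 < m.+1%:R^-1 :> R by rewrite invr_gt0.
  have [a [N [a0 hN]]] := mean_trace_tail_eventually t0 m0.
  apply: (ae_eventually_le (f := fun n w => `|s t n w - expect P (s t n)|)
    (N := N) (C := 2) _ a0) => //.
  move=> n; suff /bounded_rv_norm[] : bounded_rv (fun w => s t n w - expect P (s t n)) by [].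
  by apply: bounded_rvB; [exact: bs|exact: bounded_rv_cst].
apply: filterS (ae_foralln h) => w hw.
have d0 : s t n w - expect P (s t n) @[n --> \oo] --> 0.
  apply/cvgr0Pnorm_le => eps eps0.
  have [m _ hm] := near_infty_natSinv_lt (PosNum eps0).
  apply: filterS (hw m) => n; move=> /le_trans; apply.
  by apply/ltW/(hm m) => /=.
rewrite -[X in _ --> X](add0r l).
have -> : (fun n => s t n w)
    = (fun n => (s t n w - expect P (s t n)) + expect P (s t n)).
  by apply/funext => n; rewrite subrK.
exact: cvgD.
Qed.


(** [E s_n] is an approximate root of the increasing function
    [x |-> t x - (1 - gamma) - gamma / (1 + x)], whose slope is at least [t] and
    whose root is [MP_companion gamma t]. *)
Lemma cvg_expect_mean_trace (t : R) : 0 < t ->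
  expect P (fun w => `|rW t n w|) @[n --> \oo] --> 0 ->
  expect P (s t n) @[n --> \oo] --> MP_companion gamma t.
Proof.
move=> t0 W0; set sg := MP_companion gamma t.
have sg0 : 0 <= sg by exact: MP_companion_ge0.
pose r n := expect P (fun w => `|rW t n w|) + (n%:R * t)^-1
  + expect P (fun w => `|s t n w - expect P (s t n)|).
have r0 : r n @[n --> \oo] --> 0.
  rewrite -[X in _ --> X](addr0 0); apply: cvgD; last exact: cvg_expect_mean_trace_dist.
  by rewrite -[X in _ --> X](addr0 0); apply: cvgD => //; exact: cvg_natMV.
pose c n : R := (p n)%:R / n%:R.
have c0 : `|gamma - c n| @[n --> \oo] --> 0.
  have := cvg_norm (cvgB (cvg_cst gamma) p_ratio).
  by rewrite subrr normr0; exact.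
apply: (cvg_of_dist_le (v := fun n => t^-1 * (2 * `|gamma - c n| + gamma * r n))); last first.
  rewrite -[X in _ --> X](mulr0 t^-1); apply: cvgM; first exact: cvg_cst.
  rewrite -[X in _ --> X](addr0 0); apply: cvgD.
    by rewrite -[X in _ --> X](mulr0 2); apply: cvgM => //; exact: cvg_cst.
  by rewrite -[X in _ --> X](mulr0 gamma); apply: cvgM => //; exact: cvg_cst.
near=> n; have n0 : (0 < n)%N by near: n; exact: nbhs_infty_gt.
set e := expect P (s t n).
have e0 : 0 <= e.
  by apply: expect_ge_cst => [|w]; [exact: bs|have /andP[] := s_bound n w t0].
set v := expect P (fun w => (1 + q t n w)^-1).
have v01 : 0 <= v <= 1.
  have h w : 0 <= (1 + q t n w)^-1 <= 1.
    have /andP[q0 _] := q_bound n w t0.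
    rewrite invr_ge0 addr_ge0//= invf_le1 ?lerDl//.
    by rewrite ltr_wpDr.
  by apply/andP; split; [apply: expect_ge_cst|apply: expect_le_cst];
     try (by move=> w; have /andP[] := h w); exact: bV.
have eE : t * e = 1 - c n + c n * v.
  exact: (expect_self_consistent (@X_indep n) (@X_id n) t0 (i0 n) n0).
have ve : `|v - (1 + e)^-1| <= r n.
  have -> : v - (1 + e)^-1 = expect P (fun w => (1 + q t n w)^-1 - (1 + e)^-1).
    by rewrite expectB ?expect_cst//; [exact: bV|exact: bounded_rv_cst].
  have bd : bounded_rv (fun w => (1 + q t n w)^-1 - (1 + e)^-1).
    by apply: bounded_rvB; [exact: bV|exact: bounded_rv_cst].
  have b1 : bounded_rv (fun w => `|rW t n w|) by apply/bounded_rv_norm/bW.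
  have b2 : bounded_rv (fun w => `|s t n w - e|).
    by apply/bounded_rv_norm/bounded_rvB; [exact: bs|exact: bounded_rv_cst].
  have b3 := bounded_rv_cst T ((n%:R * t)^-1 : R).
  apply: le_trans (expect_norm P bd) _.
  rewrite /r -/e -[X in _ + X + _](expect_cst P) -!expectD//; last exact: bounded_rvD.
  apply: expect_le; [exact: bounded_rv_norm|exact: bounded_rvD (bounded_rvD b1 b3) b2|].
  by move=> w; exact: inv_loo_quad_dist.
have sgE := MP_companion_equation gamma_gt0 t0; rewrite -/sg in sgE.
have e1 : 0 < 1 + e by rewrite ltr_wpDr.
have sg1 : 0 < 1 + sg by rewrite ltr_wpDr.
pose A := (gamma - c n) * (1 - v) + gamma * (v - (1 + e)^-1).
have DE : (t + gamma / ((1 + e) * (1 + sg))) * (e - sg) = A.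
  have -> : (t + gamma / ((1 + e) * (1 + sg))) * (e - sg)
      = t * e - t * sg - gamma * ((1 + e)^-1 - (1 + sg)^-1).
    by field; rewrite !gt_eqF.
  by rewrite eE sgE /A; ring.
have k0 : 0 <= gamma / ((1 + e) * (1 + sg)) by rewrite divr_ge0 ?mulr_ge0 ?ltW.
rewrite mulrC ler_pdivlMr// mulrC.
apply: (@le_trans _ _ `|A|).
  rewrite -DE normrM ler_wpM2r// ger0_norm ?lerDl//.
  by rewrite addr_ge0 ?(ltW t0).
apply: le_trans (ler_normD _ _) _; apply: lerD; last first.
  by rewrite normrM gtr0_norm// ler_wpM2l ?(ltW gamma_gt0).
rewrite normrM mulrC ler_wpM2r// ler_norml.
by move/andP: v01 => [? ?]; apply/andP; split; lra.
Unshelve. all: by end_near. Qed.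

Let row_le1 n w : sqnorm (row (i0 n) (Y n w)) <= 1.
Proof. exact: sqnorm_row_normalized_le1. Qed.

(** At the point [z = - t + i e], with [e] chosen so that the error
    [2 e^2 / t^3] of [real_W_le_complex] is half of the given [eps]. *)
Lemma expect_norm_real_W_cvg0 (t : R) : 0 < t ->
  (forall (z : R[i]) (eps : R), 0 < complex.Im z -> 0 < eps ->
    P [set w | (eps < complex_abs (W (p_gt0 n) (Y n w) z))%R] @[n --> \oo] --> 0%E) ->
  expect P (fun w => `|rW t n w|) @[n --> \oo] --> 0.
Proof.
move=> t0 hW; have ti : 0 <= t^-1 by rewrite invr_ge0 ltW.
apply: (expect_cvg0_of_probability (M := t^-1)) => //.
- by move=> n; exact/bounded_rv_norm/bW.
- move=> n w; rewrite normr_ge0 /= ler_norml /rW /real_W.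
  have /andP[q0 q1] := q_bound n w t0; rewrite /q in q0 q1.
  have /andP[? ?] := mean_trace_bound (zero_row (i0 n) (Y n w)) t0.
  by apply/andP; split; lra.
move=> eps eps0; pose e := Num.sqrt (eps * t ^+ 3 / 4).
have ee0 : 0 < eps * t ^+ 3 / 4 by rewrite divr_gt0// mulr_gt0// exprn_gt0.
have e0 : 0 < e by rewrite sqrtr_gt0.
have eE : 2 * (e ^+ 2 / t ^+ 3) = eps / 2.
  by rewrite sqr_sqrtr ?(ltW ee0)//; field; rewrite gt_eqF.
have e20 : 0 < eps / 2 by rewrite divr_gt0.
have := hW (Complex (- t) e) (eps / 2) e0 e20.
apply: squeeze_cvge (cvg_cst 0%E); apply: nearW => n.
rewrite measure_ge0 /=; apply: le_measure; rewrite ?inE.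
- by apply: measurable_superlevel; have /bounded_rv_norm[] := bW n t0.
- apply: measurable_superlevel.
  exact: (measurableT_comp (measurable_complex_abs_W (p_gt0 n) _)
            (measurable_sample (@X n))).
move=> w /= h; have := real_W_le_complex t0 e0 (row_le1 n w).
by rewrite eE -/(rW t n w) => h'; move: h; lra.
Qed.

(** Markov's inequality at finitely many real points. *)
Lemma complex_W_cvg0 :
  (forall r : rat, 0 < r ->
    expect P (fun w => `|rW (ratr r) n w|) @[n --> \oo] --> 0) ->
  forall (z : R[i]) (eps : R), 0 < complex.Im z -> 0 < eps ->
    P [set w | (eps < complex_abs (W (p_gt0 n) (Y n w) z))%R] @[n --> \oo] --> 0%E.
Proof.
move=> h z eps z0 eps0; have e20 : 0 < eps / 2 by rewrite divr_gt0.
have [l [lpos lW]] := complex_W_le_real z0 e20.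
pose F n w := \sum_(ct <- l) `|ct.1| * `|rW (ratr ct.2) n w|.
have bt : all (fun ct : R * rat => 0 < ratr ct.2 :> R) l.
  by apply: sub_all lpos => ct; rewrite ltr0q.
have bFl (l' : seq (R * rat)) n : all (fun ct : R * rat => 0 < ratr ct.2 :> R) l' ->
    bounded_rv (fun w => \sum_(ct <- l') `|ct.1| * `|rW (ratr ct.2) n w|).
  elim: l' => [|ct l' ih] /=.
    move=> _; have -> : (fun w : T => \sum_(ct <- [::] : seq (R * rat)) `|ct.1| * `|rW (ratr ct.2) n w|)
        = (fun _ : T => 0 : R).
      by apply/funext => w; rewrite big_nil.
    exact: bounded_rv_cst.
  move=> /andP[ct0 hl']; have -> : (fun w => \sum_(c <- ct :: l') `|c.1| * `|rW (ratr c.2) n w|)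
      = (fun w => `|ct.1| * `|rW (ratr ct.2) n w|
           + \sum_(c <- l') `|c.1| * `|rW (ratr c.2) n w|).
    by apply/funext => w; rewrite big_cons.
  by apply: bounded_rvD (ih hl'); apply/bounded_rvZ/bounded_rv_norm/bW.
have EF0 (l' : seq (R * rat)) : all (fun ct : R * rat => 0 < ratr ct.2 :> R) l' ->
    expect P (fun w => \sum_(ct <- l') `|ct.1| * `|rW (ratr ct.2) n w|) @[n --> \oo] --> 0.
  elim: l' => [|ct l' ih] /=.
    move=> _; have -> : (fun n => expect P (fun w =>
        \sum_(ct <- [::] : seq (R * rat)) `|ct.1| * `|rW (ratr ct.2) n w|)) = cst 0.
      apply/funext => n /=; rewrite -[RHS](expect_cst P 0); congr expect.
      by apply/funext => w; rewrite big_nil.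
    exact: cvg_cst.
  move=> /andP[ct0 hl']; have -> : (fun n => expect P (fun w =>
        \sum_(c <- ct :: l') `|c.1| * `|rW (ratr c.2) n w|))
    = (fun n => `|ct.1| * expect P (fun w => `|rW (ratr ct.2) n w|)
         + expect P (fun w => \sum_(c <- l') `|c.1| * `|rW (ratr c.2) n w|)).
    apply/funext => n; rewrite -expectZ; last exact/bounded_rv_norm/bW.
    rewrite -expectD; [|exact/bounded_rvZ/bounded_rv_norm/bW|exact: bFl].
    by congr expect; apply/funext => w; rewrite big_cons.
  rewrite -[X in _ --> X](addr0 0); apply: cvgD; last exact: ih.
  rewrite -[X in _ --> X](mulr0 `|ct.1|); apply: cvgM; first exact: cvg_cst.
  by apply: h; rewrite -(ltr0q R).
have F0 n w : 0 <= F n w by apply: sumr_ge0 => ct _; rewrite mulr_ge0.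
apply: (squeeze_cvge (f := cst 0%E) (h := fun n => (expect P (F n) / (eps / 2))%:E)).
- apply: nearW => n; rewrite measure_ge0 /=.
  apply: le_trans (markov_bounded P e20 (bFl l n bt) (F0 n)).
  apply: le_measure; rewrite ?inE.
  + apply: measurable_superlevel.
    exact: (measurableT_comp (measurable_complex_abs_W (p_gt0 n) z0)
            (measurable_sample (@X n))).
  + by apply: measurable_superlevel; have [] := bFl l n bt.
  move=> w /= ew; have := lW _ _ (p_gt0 n) _ (row_le1 n w).
  by rewrite /rW; move: ew; lra.
- exact: cvg_cst.
apply: cvg_EFin; first exact: nearW.
rewrite -[X in _ --> X](mul0r (eps / 2)^-1); apply: cvgM; last exact: cvg_cst.
exact: EF0.
Qed.

(** The trace formula turns the limit of the traces into that of the mean of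
    [1 / (1 + q)], and the mean of [W] tends to 0, so that the mean of [q] tends
    to the same [sg] as the traces. Strict convexity of [1 / (1 + q)] then forces
    [q] itself to concentrate at [sg]: [(q - sg)^2 / (1 + q)] is an affine
    combination of [q] and [1 / (1 + q)] whose mean tends to 0. *)
Lemma expect_norm_real_W_of_trace (t : R) : 0 < t ->
  {ae P, forall w, s t n w @[n --> \oo] --> MP_companion gamma t} ->
  expect P (rW t n) @[n --> \oo] --> 0 ->
  expect P (fun w => `|rW t n w|) @[n --> \oo] --> 0.
Proof.
move=> t0; set sg := MP_companion gamma t => s_sg EW0.
have ti : 0 < t^-1 by rewrite invr_gt0.
have sg0 : 0 <= sg by exact: MP_companion_ge0.
have sg1 : 0 < 1 + sg by rewrite ltr_wpDr.
have sgE := MP_companion_equation gamma_gt0 t0; rewrite -/sg in sgE.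
have Es : expect P (s t n) @[n --> \oo] --> sg.
  apply: (bounded_convergence (M := t^-1)) => [n|n w|//]; first exact: bs.
  by have /andP[s0 s1] := s_bound n w t0; rewrite ger0_norm.
have Eds : expect P (fun w => `|s t n w - sg|) @[n --> \oo] --> 0.
  apply: (bounded_convergence (M := t^-1 + sg)) => [n|n w|].
  - by apply/bounded_rv_norm/bounded_rvB; [exact: bs|exact: bounded_rv_cst].
  - have /andP[s0' s1] := s_bound n w t0; rewrite normr_id.
    by apply: le_trans (ler_normB _ _) _; rewrite !ger0_norm// lerD2r.
  apply: filterS s_sg => w sw.
  by have := cvg_norm (cvgB sw (cvg_cst sg)); rewrite subrr normr0; exact.
pose c n : R := (p n)%:R / n%:R.
pose v n := expect P (fun w => (1 + q t n w)^-1).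
have cinv : (c n)^-1 @[n --> \oo] --> gamma^-1 by apply: cvgV; rewrite ?gt_eqF.
have v_lim : v n @[n --> \oo] --> (1 + sg)^-1.
  have -> : (1 + sg)^-1 = (t * sg - 1 + gamma) * gamma^-1.
    by rewrite sgE; field; rewrite !gt_eqF.
  apply: cvg_trans (_ : (t * expect P (s t n) - 1 + c n) * (c n)^-1 @[n --> \oo] --> _); last first.
    apply: cvgM => //; apply: cvgD => //; apply: cvgB; last exact: cvg_cst.
    by apply: cvgM => //; exact: cvg_cst.
  apply: near_eq_cvg; near=> n.
  have n0 : (0 < n)%N by near: n; exact: nbhs_infty_gt.
  have cn0 : 0 < c n by rewrite divr_gt0 ?ltr0n.
  have -> : t * expect P (s t n) = 1 - c n + c n * v n.
    exact: (expect_self_consistent (@X_indep n) (@X_id n) t0 (i0 n) n0).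
  by field; rewrite gt_eqF.
have loo_dist n w : `|mean_trace (zero_row (i0 n) (Y n w)) t - s t n w| <= (n%:R * t)^-1.
  exact: mean_trace_loo.
have bz n : bounded_rv (fun w => mean_trace (zero_row (i0 n) (Y n w)) t).
  have b := bounded_rv_mean_trace t0 (@measurable_zero_row R (p n) n (i0 n)).
  exact: (bounded_rv_comp (measurable_sample (@X n)) b).
have Eq : expect P (q t n) @[n --> \oo] --> sg.
  apply: (cvg_of_dist_le (v := fun n => `|expect P (rW t n)| + (n%:R * t)^-1
    + `|expect P (s t n) - sg|)).
    apply: nearW => n.
    have -> : expect P (q t n) - sg = expect P (rW t n)
        + (expect P (fun w => mean_trace (zero_row (i0 n) (Y n w)) t) - expect P (s t n))
        + (expect P (s t n) - sg).
      by rewrite [expect P (rW t n)](expectB P (bq n t0) (bz n)); ring.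
    apply: le_trans (ler_normD _ _) _; rewrite lerD2r.
    apply: le_trans (ler_normD _ _) _; rewrite lerD2l -expectB//; last exact: bs.
    have bd : bounded_rv (fun w => mean_trace (zero_row (i0 n) (Y n w)) t - s t n w).
      by apply: bounded_rvB => //; exact: bs.
    apply: le_trans (expect_norm P bd) _.
    by apply: expect_le_cst => [|w]; [exact: bounded_rv_norm|exact: loo_dist].
  rewrite -[X in _ --> X](addr0 0); apply: cvgD.
    rewrite -[X in _ --> X](addr0 0); apply: cvgD; last exact: cvg_natMV.
    by have := cvg_norm EW0; rewrite normr0; exact.
  by have := cvg_norm (cvgB Es (cvg_cst sg)); rewrite subrr normr0; exact.
pose D n := expect P (fun w => (q t n w - sg) ^+ 2).
have bD n : bounded_rv (fun w => (q t n w - sg) ^+ 2).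
  have b : bounded_rv (fun w => q t n w - sg).
    by apply: bounded_rvB; [exact: bq|exact: bounded_rv_cst].
  exact: (bounded_rvM b b).
have D0 n : 0 <= D n by apply: expect_ge_cst => // w; exact: sqr_ge0.
have Dlim : D n @[n --> \oo] --> 0.
  pose B n := (1 + t^-1) * ((1 + sg) ^+ 2 * (v n - (1 + sg)^-1) + (expect P (q t n) - sg)).
  apply: (cvg_of_dist_le (v := B)).
    apply: nearW => n; rewrite subr0 ger0_norm// /B.
    have bV' : bounded_rv (fun w => (1 + q t n w)^-1 - (1 + sg)^-1).
      by apply: bounded_rvB; [exact: bV|exact: bounded_rv_cst].
    have bq' : bounded_rv (fun w => q t n w - sg).
      by apply: bounded_rvB; [exact: bq|exact: bounded_rv_cst].
    have -> : v n - (1 + sg)^-1 = expect P (fun w => (1 + q t n w)^-1 - (1 + sg)^-1).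
      by rewrite expectB ?expect_cst//; [exact: bV|exact: bounded_rv_cst].
    have -> : expect P (q t n) - sg = expect P (fun w => q t n w - sg).
      by rewrite expectB ?expect_cst//; [exact: bq|exact: bounded_rv_cst].
    rewrite -expectZ// -expectD//; last exact: bounded_rvZ.
    have bE := bounded_rvD (bounded_rvZ ((1 + sg) ^+ 2) bV') bq'.
    rewrite -expectZ//; apply: expect_le => // [|w]; first exact: bounded_rvZ.
    have /andP[q0 q1] := q_bound n w t0.
    have qq : 0 < 1 + q t n w by rewrite ltr_wpDr.
    have -> : (1 + sg) ^+ 2 * ((1 + q t n w)^-1 - (1 + sg)^-1) + (q t n w - sg)
        = (q t n w - sg) ^+ 2 / (1 + q t n w).
      by field; rewrite !gt_eqF.
    rewrite mulrCA ler_peMr ?sqr_ge0// ler_pdivlMr// mul1r lerD2l//.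
  rewrite -[X in _ --> X](mulr0 (1 + t^-1)); apply: cvgM; first exact: cvg_cst.
  rewrite -[X in _ --> X](addr0 0); apply: cvgD.
    rewrite -[X in _ --> X](mulr0 ((1 + sg) ^+ 2)); apply: cvgM; first exact: cvg_cst.
    by rewrite -[X in _ --> X](subrr (1 + sg)^-1); apply: cvgB => //; exact: cvg_cst.
  by rewrite -[X in _ --> X](subrr sg); apply: cvgB => //; exact: cvg_cst.
have Edq : expect P (fun w => `|q t n w - sg|) @[n --> \oo] --> 0.
  apply/cvgr0Pnorm_le => eps eps0; have e20 : 0 < eps / 2 by rewrite divr_gt0.
  have e40 : 0 < (eps / 2) ^+ 2 by rewrite exprn_gt0.
  move/cvgr0Pnorm_le: Dlim => /(_ _ e40) Dsmall; near=> n.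
  have bd : bounded_rv (fun w => q t n w - sg).
    by apply: bounded_rvB; [exact: bq|exact: bounded_rv_cst].
  rewrite ger0_norm; last first.
    by apply: expect_ge_cst => [|w]; [exact: bounded_rv_norm|exact: normr_ge0].
  apply: (@le_trans _ _ (expect P (fun w => eps / 2 + (eps / 2)^-1 * (q t n w - sg) ^+ 2))).
    apply: expect_le => [||w].
    - exact: bounded_rv_norm.
    - exact: bounded_rvD (bounded_rv_cst T _) (bounded_rvZ _ (bD n)).
    by rewrite [(eps / 2)^-1 * _]mulrC; exact: norm_le_sqr.
  rewrite expectD; [|exact: bounded_rv_cst|exact: bounded_rvZ].
  rewrite expect_cst expectZ// -/(D n).
  have Dn : D n <= (eps / 2) ^+ 2.
    by apply: le_trans (ler_norm _) _; near: n.
  apply: (@le_trans _ _ (eps / 2 + (eps / 2)^-1 * (eps / 2) ^+ 2)).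
    by rewrite lerD2l ler_pM2l ?invr_gt0.
  by rewrite le_eqVlt; apply/orP; left; apply/eqP; field; rewrite gt_eqF.
apply: (cvg_of_dist_le (v := fun n => expect P (fun w => `|q t n w - sg|)
   + expect P (fun w => `|s t n w - sg|) + (n%:R * t)^-1)).
  apply: nearW => n; rewrite subr0 ger0_norm; last first.
    by apply: expect_ge_cst => [|w]; [exact/bounded_rv_norm/bW|exact: normr_ge0].
  have b1 : bounded_rv (fun w => `|q t n w - sg|).
    by apply/bounded_rv_norm/bounded_rvB; [exact: bq|exact: bounded_rv_cst].
  have b2 : bounded_rv (fun w => `|s t n w - sg|).
    by apply/bounded_rv_norm/bounded_rvB; [exact: bs|exact: bounded_rv_cst].
  rewrite -[X in _ <= _ + X](expect_cst P) -!expectD//; last 2 first.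
  - exact: bounded_rvD.
  - exact: bounded_rv_cst.
  apply: expect_le => [||w].
  - exact/bounded_rv_norm/bW.
  - exact: bounded_rvD (bounded_rvD b1 b2) (bounded_rv_cst T _).
  have -> : rW t n w = (q t n w - sg) + (sg - s t n w)
      + (s t n w - mean_trace (zero_row (i0 n) (Y n w)) t).
    by rewrite /rW /real_W /q; ring.
  apply: le_trans (ler_normD _ _) _; rewrite [in leRHS]addrC [in leLHS]addrC.
  apply: lerD; first by rewrite distrC.
  by apply: le_trans (ler_normD _ _) _; rewrite (distrC sg).
rewrite -[X in _ --> X](addr0 0); apply: cvgD; last exact: cvg_natMV.
by rewrite -[X in _ --> X](addr0 0); exact: cvgD.
Unshelve. all: by end_near. Qed.

End Limits.

(** * The equivalence *)

Section SpectralLimits.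
Variable R : realType.

Lemma ESD_empirical_mean p n (Y : 'M[R]_(p, n)) :
  ESD (sample_corr Y)
    = (fun x => empirical_mean (eigenvalues (sample_corr Y)) (fun l => (l <= x)%R%:R)).
Proof.
by have [sz _ _] := sample_corr_spectrum Y; apply/funext => x; rewrite /ESD /empirical_mean sz.
Qed.

Variables (p : nat -> nat) (gamma : R) (Y : forall n, 'M[R]_(p n, n)).
Hypothesis p_gt0 : forall n, (0 < p n)%N.
Hypothesis gamma_gt0 : 0 < gamma.
Hypothesis p_ratio : (p n)%:R / n%:R @[n --> \oo] --> gamma.

(** The resolvent traces of [Y^T Y] and of [Y Y^T] determine each other. *)
Lemma mean_trace_cvgP (t : R) : 0 < t ->
  (mean_trace (Y n) t @[n --> \oo] --> MP_companion gamma t) <->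
  (empirical_mean (eigenvalues (sample_corr (Y n))) (fun x => (x + t)^-1)
     @[n --> \oo] --> MP_mean gamma (fun x => (x + t)^-1)).
Proof.
move=> t0; pose c n : R := (p n)%:R / n%:R.
pose m n := empirical_mean (eigenvalues (sample_corr (Y n))) (fun x => (x + t)^-1).
have c0 n : (0 < n)%N -> 0 < c n by move=> n0; rewrite divr_gt0 ?ltr0n.
have cinv : (c n)^-1 @[n --> \oo] --> gamma^-1 by apply: cvgV; rewrite ?gt_eqF.
have E n : (0 < n)%N -> t * mean_trace (Y n) t = 1 - c n + c n * (t * m n).
  by move=> n0; have [_ _ h] := sample_corr_spectrum (Y n); rewrite h.
have L := MP_companion_mean gamma_gt0 t0.
have cvg1 (a : R) : (a : R) @[n --> \oo] --> a by exact: cvg_cst.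
split=> h.
- have -> : MP_mean gamma (fun x => (x + t)^-1)
      = t^-1 * ((t * MP_companion gamma t - 1 + gamma) * gamma^-1).
    by rewrite L; field; rewrite !gt_eqF.
  apply: cvg_trans
    (_ : t^-1 * ((t * mean_trace (Y n) t - 1 + c n) * (c n)^-1) @[n --> \oo] --> _).
    apply: near_eq_cvg; near=> n.
    have n0 : (0 < n)%N by near: n; exact: nbhs_infty_gt.
    by rewrite E// -/(m n); field; rewrite !gt_eqF ?c0.
  apply: cvgM => //; apply: cvgM => //; apply: cvgD => //; apply: cvgB => //.
  exact: cvgM.
- have -> : MP_companion gamma t
      = t^-1 * (1 - gamma + gamma * (t * MP_mean gamma (fun x => (x + t)^-1))).
    by rewrite -L mulKf ?gt_eqF.
  apply: cvg_trans (_ : t^-1 * (1 - c n + c n * (t * m n)) @[n --> \oo] --> _).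
    apply: near_eq_cvg; near=> n.
    have n0 : (0 < n)%N by near: n; exact: nbhs_infty_gt.
    by rewrite -E// mulKf ?gt_eqF.
  apply: cvgM => //; apply: cvgD; first exact: cvgB.
  by apply: cvgM => //; exact: cvgM.
Unshelve. all: by end_near. Qed.

(** Weak convergence of the spectra, read off the traces for [Y^T Y]. *)
Lemma weak_cvg_mean_traceP :
  weak_cvg (fun n => ESD (sample_corr (Y n))) (MP_cdf gamma) <->
  forall r : rat, 0 < r ->
    mean_trace (Y n) (ratr r) @[n --> \oo] --> MP_companion gamma (ratr r).
Proof.
have -> : (fun n => ESD (sample_corr (Y n))) = (fun n x =>
    empirical_mean (eigenvalues (sample_corr (Y n))) (fun l => (l <= x)%R%:R)).
  by apply/funext => n; exact: ESD_empirical_mean.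
have sz n : (0 < size (eigenvalues (sample_corr (Y n))))%N.
  by have [-> _ _] := sample_corr_spectrum (Y n).
have pos n l : l \in eigenvalues (sample_corr (Y n)) -> 0 <= l.
  by have [_ h _] := sample_corr_spectrum (Y n); exact: h.
split=> h.
- move=> r r0; have t0 : 0 < ratr r :> R by rewrite ltr0q.
  by apply/mean_trace_cvgP => //; exact: resolvents_of_weak_cvg.
- apply: weak_cvg_of_resolvents => // r r0.
  have t0 : 0 < ratr r :> R by rewrite ltr0q.
  by apply/mean_trace_cvgP => //; exact: h.
Qed.

End SpectralLimits.

Theorem theorem2p1 (R : realType) (d : measure_display) (T : measurableType d)
  (P : probability T R)
  (xi : {RV P >-> R})
  (xi_centered : ('E_P[xi] = 0)%E)
  (xi_nondeg : non_degenerate xi)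
  (delta : R) (delta_gt0 : 0 < delta)
  (xi_moment : ('E_P[(fun w => (`|xi w| `^ (1 + delta))%R)] < +oo)%E)
  (xi_var : ('E_P[(fun w => (xi w ^+ 2)%R)] < +oo)%E ->
            ('E_P[(fun w => (xi w ^+ 2)%R)] = 1)%E)
  (p : nat -> nat) (p_gt0 : forall n, (0 < p n)%N)
  (X : forall n, 'I_(p n) -> 'I_n -> {RV P >-> R})
  (X_iid : forall n, iid_entries xi (@X n))
  (X_nz : forall n, (0 < n)%N -> forall i : 'I_(p n),
     {ae P, forall w, \sum_(j < n) X n i j w ^+ 2 != 0})
  (gamma : R) (gamma_gt0 : 0 < gamma)
  (p_infty : p n @[n --> \oo] --> \oo)
  (p_ratio : (p n)%:R / n%:R @[n --> \oo] --> gamma) :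
  {ae P, forall w,
     weak_cvg (fun n => ESD (sample_corr (Ymx (@X n) w))) (MP_cdf gamma)}
  <->
  (forall z : R[i], 0 < complex.Im z ->
     cvg_in_probability P (fun n w => W (p_gt0 n) (Ymx (@X n) w) z) 0).
Proof.
pose Z n (e : 'I_(p n) * 'I_n) := X n e.1 e.2.
have Z_indep n : mutually_independent (Z n) by have [] := X_iid n.
have Z_id n e : identically_distributed (Z n e) xi by have [_ h] := X_iid n; exact: h.
have YE n w : Ymx (@X n) w = normalized (sample (Z n) w) by [].
have wP w := weak_cvg_mean_traceP (fun n => Ymx (@X n) w) p_gt0 gamma_gt0 p_ratio.
have inP (z : R[i]) : cvg_in_probability P (fun n w => W (p_gt0 n) (Ymx (@X n) w) z) 0 <->
    forall eps : R, 0 < eps -> P [set w | (eps < complex_abs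
      (W (p_gt0 n) (normalized (sample (Z n) w)) z))%R] @[n --> \oo] --> 0%E.
  have E (eps : R) n : [set w | (eps%:C)%C < `|W (p_gt0 n) (Ymx (@X n) w) z - 0|]
      = [set w | eps < complex_abs (W (p_gt0 n) (normalized (sample (Z n) w)) z)].
    by apply/seteqP; split => w /=; rewrite subr0 normc_abs ltcR YE.
  have E' (eps : R) : (fun n => P [set w | (eps%:C)%C < `|W (p_gt0 n) (Ymx (@X n) w) z - 0|])
      = (fun n => P [set w | eps < complex_abs
          (W (p_gt0 n) (normalized (sample (Z n) w)) z)]).
    by apply/funext => n; rewrite E.
  by split=> h eps eps0; have := h eps eps0; rewrite E'.
split=> [ae_weak z z0|hW].
- have ae_s (r : rat) : 0 < r -> {ae P, forall w,
      mean_trace (normalized (sample (Z n) w)) (ratr r) @[n --> \oo]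
        --> MP_companion gamma (ratr r)}.
    by move=> r0; apply: filterS ae_weak => w /wP h; exact: h.
  apply/inP => eps eps0; apply: (complex_W_cvg0 (X := Z)) => // r r0.
  have t0 : 0 < ratr r :> R by rewrite ltr0q.
  apply: (expect_norm_real_W_of_trace Z_indep Z_id gamma_gt0 p_ratio t0); first exact: ae_s.
  apply/cvgr0Pnorm_le => eta eta0; have e0 : 0 < eta * ratr r / 4 by rewrite divr_gt0// mulr_gt0.
  have [N hN] := expect_row_sum_cvg0 xi_centered xi_nondeg delta_gt0 xi_moment e0.
  move/cvgr0Pnorm_le: (@cvg_natV R) => /(_ _ e0) [M _ hM].
  exists (maxn 2 (maxn N M)) => // n; rewrite /= !geq_max => /and3P[n2 Nn Mn].
  have n0 : (0 < n)%N by exact: ltn_trans n2.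
  have nz := X_nz n n0 (Ordinal (p_gt0 n)).
  apply: le_trans (expect_real_W_le (Z_indep n) (Z_id n) nz t0 n2) _.
  have h1 := hN _ _ (Z n) (Ordinal (p_gt0 n)) Nn n0 (Z_indep n) (Z_id n).
  have h2 := le_trans (ler_norm _) (hM n Mn).
  have -> : eta = 2 / ratr r * (eta * ratr r / 4 + eta * ratr r / 4).
    by field; rewrite gt_eqF.
  apply: ler_wpM2l; last exact: lerD.
  by rewrite divr_ge0 ?(ltW t0).
have hW' (z : R[i]) (eps : R) : 0 < complex.Im z -> 0 < eps -> P [set w | (eps < complex_abs
      (W (p_gt0 n) (normalized (sample (Z n) w)) z))%R] @[n --> \oo] --> 0%E.
  by move=> z0; have /inP := hW z z0; exact.
have ae_s (r : rat) : 0 < r -> {ae P, forall w,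
    mean_trace (normalized (sample (Z n) w)) (ratr r) @[n --> \oo]
      --> MP_companion gamma (ratr r)}.
  move=> r0; have t0 : 0 < ratr r :> R by rewrite ltr0q.
  apply: (ae_cvg_mean_trace Z_indep gamma_gt0 p_ratio t0).
  apply: (cvg_expect_mean_trace (p_gt0 := p_gt0) Z_indep Z_id gamma_gt0 p_ratio t0).
  exact: expect_norm_real_W_cvg0.
(* Countably many exceptional sets, enumerated by [pickle]. *)
have all_r : {ae P, forall w, forall k : nat, forall r : rat, unpickle k = Some r -> 0 < r ->
    mean_trace (normalized (sample (Z n) w)) (ratr r) @[n --> \oo]
      --> MP_companion gamma (ratr r)}.
  apply: ae_foralln => k; case: (unpickle k) => [r|]; last by apply: nearW.
  have [r0|r0] := boolP (0 < r).
    by apply: filterS (ae_s r r0) => w h _ [<-] _.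
  by apply: nearW => w _ [<-]; rewrite (negbTE r0).
apply: filterS all_r => w h; apply/wP => r r0.
exact: (h (pickle r) r (pickleK r)).
Qed.
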